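(* Let the radius distribution be $f(r)=\mathbb{P}(R\ge r)=\frac1r$ for $r\ge1$. Then $\frac{T_n}{n}\Longrightarrow Y$ in distribution, where $Y$ is a non-trivial distribution with support equal to $[0,1]$, which satisfies for every $\alpha\in(0,1)$: $$\mathbb{P}(\mathcal{C}_\alpha=\mathbb{S}^1)=\mathbb{P}(Y\le\alpha),$$ and $$\frac{\log|\mathbb{Z}/n\mathbb{Z}\setminus X_{\alpha n}|}{\log n}\mathbf{1}\{X_{\alpha n}\neq\mathbb{Z}/n\mathbb{Z}\}\Longrightarrow(1-\alpha)\mathbf{1}\{\mathcal{C}_\alpha\neq\mathbb{S}^1\}$$ in distribution as $n\to\infty$.
   Context: Covering process: $R$ takes values in $\{1,2,\dots\}$ with $f(r)=\mathbb{P}(R\ge r)$. On $\mathbb{Z}/n\mathbb{Z}$, let $(R_k)$ be i.i.d. copies of $R$, $(U_k)$ i.i.d. uniform on $\mathbb{Z}/n\mathbb{Z}$, independent; $\mathcal{O}_k=\{U_k,\dots,U_k+R_k-1\}$ (mod $n$), $C_0=\emptyset$, $C_k=C_{k-1}\cup\mathcal{O}_k$; with an independent rate-one Poisson process $N(t)$, $X_t=C_{N(t)}$ and $T_n=\inf\{t:X_t=\mathbb{Z}/n\mathbb{Z}\}$. Mandelbrot–Shepp model: $\mathbb{S}^1=\mathbb{R}/\mathbb{Z}$, represented by $[0,1)$. For $\alpha>0$ let $\omega=\sum_i\delta_{(x_i,y_i)}$ be a Poisson point process on $\mathbb{S}^1\times(0,\infty)$ with intensity $\alpha\,dx\otimes\frac{dy}{y^2}$.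 For a point $(x,y)$ let $\Pi(x,y)=\mathbb{S}^1$ if $y>1$ and otherwise the open arc $(x,x+y)$ taken mod 1. Then $\mathcal{C}_\alpha=\bigcup_i\Pi(x_i,y_i)$ is the covered set at parameter $\alpha$. The support of a law $Y$ is the set of $y$ such that every neighbourhood of $y$ has positive probability. *)

(* Defs.v *)
From mathcomp Require Import all_boot all_order all_algebra.
From mathcomp Require Import all_classical all_reals all_analysis.
Set Implicit Arguments.
Unset Strict Implicit.
Unset Printing Implicit Defensive.
Import Order.TTheory GRing.Theory Num.Theory numFieldNormedType.Exports.
Local Open Scope classical_set_scope.
Local Open Scope ring_scope.

Definition distr_fn {R : realType} {d : measure_display} {T : measurableType d}
  (P : probability T R) (X : T -> R) (x : R) : R :=
  fine (P [set w | X w <= x]).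

Definition law_cdf {R : realType} (Y : probability R R) (x : R) : R :=
  fine (Y [set` `]-oo, x]]).

Definition cvg_in_law {R : realType} (F : nat -> R -> R) (G : R -> R) : Prop :=
  forall x : R, {for x, continuous G} -> (F n x) @[n --> \oo] --> G x.

Definition law_support {R : realType} (Y : probability R R) : set R :=
  [set y | forall e : R, 0 < e -> (0 < Y [set` `](y - e)%R, (y + e)%R[])%E].

Definition nontrivial_law {R : realType} (Y : probability R R) : Prop :=
  forall c : R, Y [set c] != 1%E.

Definition poisson_mass {R : realType} (lam : R) (k : nat) : R :=
  expR (- lam) * lam ^+ k / k`!%:R.

Definition in_arc (n u r x : nat) : bool :=
  has (fun j => x == ((u + j) %% n)%N) (iota 0 r).

Definition in_C (n : nat) (Rad U : nat -> nat) (m x : nat) : bool :=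
  has (fun k => in_arc n (U k) (Rad k) x) (iota 0 m).

Definition C_full (n : nat) (Rad U : nat -> nat) (m : nat) : bool :=
  all (in_C n Rad U m) (iota 0 n).

Definition C_uncovered (n : nat) (Rad U : nat -> nat) (m : nat) : nat :=
  count (fun x => ~~ in_C n Rad U m x) (iota 0 n).

(* Rate-one Poisson process built from i.i.d. Exp(1) inter-arrival times E:
   the k-th arrival (k = 0,1,...) happens at time E 0 + ... + E k, and
   N(t) is the number of arrivals in [0, t]. *)
Definition arrival {R : realType} (E : nat -> R) (k : nat) : R :=
  \sum_(i < k.+1) E i.

Definition poisN {R : realType} (E : nat -> R) (t : R) : nat :=
  xget 0%N [set m : nat | ([set k : nat | arrival E k <= t] #= `I_m)%card].

Definition X_full {R : realType} (n : nat) (Rad U : nat -> nat) (E : nat -> R)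
  (t : R) : bool := C_full n Rad U (poisN E t).

Definition cover_time {R : realType} (n : nat) (Rad U : nat -> nat)
  (E : nat -> R) : \bar R :=
  ereal_inf [set t%:E | t in [set t : R | X_full n Rad U E t]].

Definition covering_model {R : realType} {d : measure_display}
  {T : measurableType d} (P : probability T R) (n : nat)
  (Rad U : nat -> T -> nat) (E : nat -> T -> R) : Prop :=
  [/\ (forall k (A : set nat), measurable (Rad k @^-1` A)) /\
      (forall k (A : set nat), measurable (U k @^-1` A)) /\
      (forall k, measurable_fun setT (E k)),
      (forall k (r : nat), (1 <= r)%N ->
          P [set w | (r <= Rad k w)%N] = (r%:R^-1)%:E),
      (forall k (i : nat), (i < n)%N -> P [set w | U k w = i] = (n%:R^-1)%:E),
      (forall k (t : R), 0 <= t -> P [set w | t < E k w] = (expR (- t))%:E) &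
      (forall (m : nat) (A B : nat -> set nat) (C : nat -> set R),
          (forall k, measurable (C k)) ->
          P (\bigcap_(k < m) (Rad k @^-1` A k `&` U k @^-1` B k `&` E k @^-1` C k))
          = (\prod_(k < m) (P (Rad k @^-1` A k) * P (U k @^-1` B k)
                             * P (E k @^-1` C k)))%E)].

(* The Mandelbrot--Shepp model on S^1 = R/Z, represented by [0,1)      *)

Definition ms_intensity {R : realType} (alpha : R) (A : set (R * R)) : \bar R :=
  (alpha%:E * \int[lebesgue_measure]_(x in `[0%R, 1%R[)
      \int[lebesgue_measure]_(y in `]0%R, +oo[)
         ((\1_A (x, y))%:E * (y ^-2)%:E))%E.

Definition point_count {R : realType} (pts : nat -> R * R) (A : set (R * R))
  : \bar R := (\sum_(i <oo) (\1_A (pts i))%:E)%E.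

(* omega = sum_i delta_{(x_i, y_i)} is a Poisson point process on
   S^1 x (0, oo) with intensity alpha dx (x) dy/y^2: the counts of
   pairwise disjoint measurable sets of finite intensity are independent
   Poisson variables with the intensities as means. *)
Definition is_MS_PPP {R : realType} {d : measure_display}
  {T : measurableType d} (P : probability T R) (alpha : R)
  (pts : nat -> T -> R * R) : Prop :=
  [/\ (forall i, measurable_fun setT (pts i)),
      (forall i w, 0 <= (pts i w).1 < 1 /\ 0 < (pts i w).2) &
      (forall (m : nat) (A : nat -> set (R * R)) (k : nat -> nat),
          (forall j, measurable (A j)) ->
          (forall j, (ms_intensity alpha (A j) < +oo)%E) ->
          (forall i j, (i < m)%N -> (j < m)%N -> i != j -> A i `&` A j = set0) ->
          P (\bigcap_(j < m) [set w | point_count (pts ^~ w) (A j) = ((k j)%:R)%:E])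
          = (\prod_(j < m) (poisson_mass (fine (ms_intensity alpha (A j))) (k j))%:E)%E)].

(* z in [0,1) lies in Pi(x, y): all of S^1 if y > 1, otherwise the open arc
   (x, x + y) taken mod 1. *)
Definition in_Pi {R : realType} (p : R * R) (z : R) : Prop :=
  if 1 < p.2 then True
  else exists m : int, p.1 < z + m%:~R < p.1 + p.2.

Definition ms_covers {R : realType} (pts : nat -> R * R) : Prop :=
  forall z : R, 0 <= z < 1 -> exists i, in_Pi (pts i) z.

(* Main.v *)
From HB Require Import structures.
Require Import Defs.
From mathcomp Require Import all_boot all_order all_algebra.
From mathcomp Require Import ring lra zify.
Set Implicit Arguments.
Unset Strict Implicit.
Unset Printing Implicit Defensive.
Import Order.TTheory GRing.Theory Num.Theory.
Local Open Scope ring_scope.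

(** At time [alpha n] a set of sites of [Z/n] is uncovered with a probability
that factors over the gaps of the set: a site [a] together with [Q] is
uncovered with probability [prod_x rho (g x)], where [x] ranges over [Z/n],
[g x + 1] is the distance from [x] to the next point of the set, and
[rho k = exp (- alpha / (k + 1))].  This is the law of a renewal process on the
cycle, with renewal masses [v_n = prod_(k < n) rho k] of order [n ^ (-alpha)],
so the probability that some site is uncovered, computed from the gap
straddling a fixed edge, is the coefficient of [x^n] in [x V' / V] with
[V = sum_n v_n x^n].  It tends to [1 - alpha], so the limit law [Y] is uniform.
By Markov's inequality, an uncovered set has at most [n ^ (1 - alpha + eps)]
sites with high probability; it is unlikely to be nonempty and smaller than
[n ^ (1 - alpha - eps)] because a renewal set with few points has a very long
gap.  On the circle, cut into [n] cells, the cells not contained in a single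
Poisson arc have the same product structure with
[rho k = (1 + 1 / (k + 1)) ^ (-alpha)], and by compactness the circle is covered
if and only if no such cell is left once [n] is large.  Hence the covering
probability is [alpha] as well. *)

(** * Renewal sequences *)

(** The limit [1 - alpha] comes from an exact case and a perturbation of it. If
    [rho k = 1 - alpha / (k + 1)], then [V = (1 - x)^(alpha - 1)] and
    [x V' / V = (1 - alpha) x / (1 - x)], so that every coefficient from [x] on is [1 - alpha]. For
    other [rho] the departure from this case is the sequence [drift]; it is of order [v_j / j], and
    its contribution vanishes in the limit. The two models satisfy the same sandwich [alpha / (k +
    2) <= - ln (rho k) <= alpha / (k + 1)], under which all asymptotics are done once. The product
    formula itself has a simple source: an arc hits a set exactly when it reaches the first point of
    the set after its start, so the Poisson void probability factors over the possible starts. What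
    is known at the outset is only the probability that given sites are all uncovered. Probabilities
    that sites in between are covered have to be recovered from it by a recursion on the gap length,
    which is the defining recursion of the first-return sequence; this is why the gap weights are
    defined by that recursion. *)

Fixpoint renewal_seq (R : pzRingType) (v : nat -> R) (n : nat) : seq R :=
  if n is n'.+1 then
    let s := renewal_seq v n' in
    rcons s (v n'.+1 - \sum_(k < n') s`_k * v (n' - k)%N)
  else [::].

(* [first_gap v k] is the weight of a gap of length [k + 1]: the first-return
   sequence of the renewal sequence [v], shifted by one. *)
Definition first_gap (R : pzRingType) (v : nat -> R) (k : nat) : R :=
  (renewal_seq v k.+1)`_k.

(** The weight of a gap longer than [n], an infinite one included. Its generating function is
    [(1 - H) / (1 - x)], where [H] is that of the gap lengths. *)
Definition gap_tail (R : pzRingType) (v : nat -> R) (n : nat) : R :=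
  1 - \sum_(k < n) first_gap v k.

Section RenewalSequence.
Variables (R : realFieldType) (rho : nat -> R).
Hypothesis rho_gt0 : forall k, 0 < rho k.
Hypothesis rho_le1 : forall k, rho k <= 1.
Hypothesis rho_mono : forall j k, (j <= k)%N -> rho j <= rho k.

Definition ren_mass (n : nat) : R := \prod_(k < n) rho k.
Local Notation v := ren_mass.
Local Notation f := (first_gap v).
Local Notation hb := (gap_tail v).

Lemma ren_mass0 : v 0 = 1. Proof. by rewrite /v big_ord0. Qed.

Lemma ren_massS n : v n.+1 = v n * rho n.
Proof. by rewrite /v big_ord_recr. Qed.

Lemma ren_mass_gt0 n : 0 < v n.
Proof. by apply: prodr_gt0 => i _. Qed.

Lemma ren_mass_ge0 n : 0 <= v n. Proof. exact/ltW/ren_mass_gt0. Qed.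

Lemma ren_mass_le m n : (m <= n)%N -> v n <= v m.
Proof.
elim: n => [|n IHn]; first by rewrite leqn0 => /eqP ->.
rewrite leq_eqVlt => /orP[/eqP -> //|]; rewrite ltnS => /IHn; apply: le_trans.
by rewrite ren_massS ler_piMr ?ren_mass_ge0.
Qed.

Lemma renewal_seq_size n : size (renewal_seq v n) = n.
Proof. by elim: n => //= n IHn; rewrite size_rcons IHn. Qed.

Lemma renewal_seq_nth n k : (k < n)%N -> (renewal_seq v n)`_k = f k.
Proof.
elim: n => // n IHn; rewrite ltnS leq_eqVlt => /orP[/eqP -> //|kn].
by rewrite /= nth_rcons renewal_seq_size kn IHn.
Qed.

Lemma first_gapE n : f n = v n.+1 - \sum_(k < n) f k * v (n - k)%N.
Proof.
rewrite /f /= nth_rcons renewal_seq_size ltnn eqxx; congr (_ - _).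
by apply: eq_bigr => k _; rewrite renewal_seq_nth.
Qed.

Lemma renewal_eq n : v n.+1 = \sum_(k < n.+1) f k * v (n - k)%N.
Proof.
by rewrite big_ord_recr /= subnn ren_mass0 mulr1 first_gapE addrC subrK.
Qed.

(* Kaluza: the log-convexity of the renewal sequence makes the gap weights
   nonnegative. *)
Lemma first_gap_ge0 n : 0 <= f n.
Proof.
elim/ltn_ind: n => -[|n] IHn.
  by rewrite first_gapE big_ord0 subr0 ren_mass_ge0.
rewrite first_gapE ren_massS {1}renewal_eq mulr_suml -sumrB.
apply: sumr_ge0 => k _.
have kn : (k <= n)%N by rewrite -ltnS.
rewrite subSn // ren_massS -mulrA -mulrBr mulr_ge0 ?IHn // -mulrBr.
by rewrite mulr_ge0 ?ren_mass_ge0 // subr_ge0 rho_mono // leqW // leq_subr.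
Qed.

(** As [v] is nonincreasing, replacing each [v (n - k)] in the renewal equation by [v n.+1] can only
    lower the right-hand side; then divide by [v n.+1]. *)
Lemma gap_sum_le1 n : \sum_(k < n) f k <= 1.
Proof.
case: n => [|n]; first by rewrite big_ord0.
rewrite -(@ler_pM2r _ (v n.+1)) ?ren_mass_gt0 // mul1r.
rewrite [leRHS]renewal_eq mulr_suml; apply: ler_sum => k _.
by rewrite ler_wpM2l ?first_gap_ge0 // ren_mass_le // leqW // leq_subr.
Qed.

Lemma gap_tail_ge0 n : 0 <= hb n.
Proof. by rewrite subr_ge0 gap_sum_le1. Qed.

Lemma gap_tail0 : hb 0 = 1.
Proof. by rewrite /gap_tail big_ord0 subr0. Qed.

Lemma gap_tailS n : hb n.+1 = hb n - f n.
Proof. by rewrite /gap_tail big_ord_recr /= opprD addrA. Qed.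

Lemma gap_tail_le m n : (m <= n)%N -> hb n <= hb m.
Proof.
elim: n => [|n IHn]; first by rewrite leqn0 => /eqP ->.
rewrite leq_eqVlt => /orP[/eqP -> //|]; rewrite ltnS => /IHn; apply: le_trans.
by rewrite gap_tailS lerBlDr lerDl first_gap_ge0.
Qed.

(** Decomposition by the last renewal point [k] up to [n]: after it comes a gap longer than [n - k].
    In generating functions, [V (1 - H) / (1 - x) = 1 / (1 - x)]. *)
Lemma sum_mass_tail n : \sum_(k < n.+1) v k * hb (n - k)%N = 1.
Proof.
elim: n => [|n IHn].
  by rewrite big_ord_recr big_ord0 /= ren_mass0 gap_tail0 add0r mulr1.
rewrite big_ord_recr /= subnn gap_tail0 mulr1.
rewrite (eq_bigr (fun k : 'I_n.+1 => v k * hb (n - k)%N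
            - v k * f (n - k)%N)); last first.
  move=> k _; have kn : (k <= n)%N by rewrite -ltnS.
  by rewrite subSn // gap_tailS mulrBr.
rewrite big_split /= IHn sumrN renewal_eq (reindex_inj rev_ord_inj) /=.
rewrite -addrA [X in _ + X](_ : _ = 0) ?addr0 //.
rewrite addrC; apply/eqP; rewrite subr_eq0; apply/eqP/eq_bigr => k _.
have kn : (k <= n)%N by rewrite -ltnS.
by rewrite subSS subKn // mulrC.
Qed.

(** This bound and the next freeze one monotone factor of [sum_mass_tail] at its smallest value.
    They turn lower bounds on [v] into upper bounds on [hb] and on its partial sums. *)
Lemma gap_tail_mul_sum_mass n : hb n * \sum_(k < n.+1) v k <= 1.
Proof.
rewrite -[leRHS](sum_mass_tail n) mulr_sumr; apply: ler_sum => k _.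
by rewrite mulrC ler_wpM2l ?ren_mass_ge0 // gap_tail_le // leq_subr.
Qed.

Lemma mass_mul_sum_tail n : v n * \sum_(k < n.+1) hb k <= 1.
Proof.
rewrite -[leRHS](sum_mass_tail n) mulr_sumr (reindex_inj rev_ord_inj) /=.
apply: ler_sum => k _; rewrite subSS ler_wpM2r ?gap_tail_ge0 //.
by rewrite ren_mass_le // -ltnS.
Qed.

(** The right-hand side is the mean of the gap length truncated at [K]; it exceeds the left-hand
    side by [K * hb K], the share of the longer gaps. *)
Lemma sum_gap_length_le K : \sum_(k < K) k.+1%:R * f k <= \sum_(k < K) hb k.
Proof.
rewrite -subr_ge0 [X in 0 <= X](_ : _ = K%:R * hb K).
  by rewrite mulr_ge0 ?gap_tail_ge0.
elim: K => [|K IHK]; first by rewrite !big_ord0 mul0r subr0.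
rewrite !big_ord_recr /= gap_tailS -natr1.
move: IHK; set A := \sum_(i < K) _; set B := \sum_(i < K) _ => IHK.
rewrite [LHS](_ : _ = (A - B) + hb K - (K%:R + 1) * f K); last by ring.
by rewrite IHK; ring.
Qed.

(* The weight of nonempty uncovered sets, [sum_k k h_k v_(n-k)], which is the
   coefficient of [x^n] in [x V' / V]. *)
Definition straddle_mass (n : nat) : R :=
  \sum_(k < n) k.+1%:R * f k * v (n - k.+1)%N.
Local Notation a := straddle_mass.

(** Differentiating [V (1 - H) = 1] gives [x H' V = x V' (1 - H)]. On coefficients this is the
    splitting of the gap length [k.+1] as [n.+1 - (n - k)]. *)
Lemma straddle_massS n :
  a n.+1 = n.+1%:R * v n.+1 - \sum_(k < n.+1) f k * ((n - k)%:R * v (n - k)%N).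
Proof.
rewrite {1}renewal_eq mulr_sumr -sumrB; apply: eq_bigr => k _.
have kn : (k <= n)%N by rewrite -ltnS.
rewrite subSS natrB // -!natr1; ring.
Qed.

Variable alpha : R.

(** It vanishes identically when [rho j = 1 - alpha / j.+1], the case in which [V] is a power of
    [1 - x]. *)
Definition drift (j : nat) : R := v j * (j.+1%:R * rho j - j.+1%:R + alpha).
Definition drift_conv (n : nat) : R := \sum_(j < n) drift j * hb (n - j.+1)%N.

Lemma mass_increment j :
  j.+1%:R * v j.+1 - j%:R * v j = (1 - alpha) * v j + drift j.
Proof. by rewrite /drift ren_massS -natr1; ring. Qed.

(* Summation by parts turns the coefficients [n v_n] of [x V'] against
   [1 - H = 1 / V] into [1 - alpha] plus the drift correction. *)
Lemma straddle_massE n : a n.+1 = (1 - alpha) + drift_conv n.+1.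
Proof.
have by_parts m : m.+1%:R * v m.+1 - \sum_(k < m.+1) f k * ((m - k)%:R * v (m - k)%N)
   = \sum_(j < m.+1) (j.+1%:R * v j.+1 - j%:R * v j) * hb (m - j)%N.
  elim: m => [|m IHm].
    by rewrite !big_ord_recr !big_ord0 /= subnn gap_tail0 !mulr0n mulr1n; ring.
  rewrite [RHS]big_ord_recr /= subnn gap_tail0 mulr1.
  under [in RHS]eq_bigr => j _.
    have jm : (j <= m)%N by rewrite -ltnS.
    rewrite subSn // gap_tailS mulrBr; over.
  rewrite sumrB -IHm.
  have -> : \sum_(i < m.+1) (i.+1%:R * v i.+1 - i%:R * v i) * f (m - i)%N =
     \sum_(k < m.+1) f k * ((m.+1 - k)%:R * v (m.+1 - k)%N)
        - \sum_(k < m.+1) f k * ((m - k)%:R * v (m - k)%N).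
    rewrite (reindex_inj rev_ord_inj) /= -sumrB; apply: eq_bigr => k _.
    have km : (k <= m)%N by rewrite -ltnS.
    by rewrite subSS subKn // subSn // -mulrBr mulrC.
  rewrite [in LHS]big_ord_recr /= subnn mulr0n mul0r mulr0 addr0.
  set A := \sum_(i < _) _; set B := \sum_(i < _) _.
  by move: (_ * v m.+2) (_ * v m.+1) => x y; clearbody A B; ring.
rewrite straddle_massS by_parts.
under eq_bigr do rewrite mass_increment mulrDl.
rewrite big_split /=; congr (_ + _).
rewrite -[RHS]mulr1 -(sum_mass_tail n) mulr_sumr.
by apply: eq_bigr => j _; rewrite mulrA.
Qed.

Definition seq_conv (p q : nat -> R) (n : nat) : R :=
  \sum_(k < n.+1) p k * q (n - k)%N.

(** Only the terms up to [n] matter, so the sequences are truncated to polynomials and associativity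
    is that of the polynomial product. *)
Lemma seq_convA p q r n :
  seq_conv p (seq_conv q r) n = seq_conv (seq_conv p q) r n.
Proof.
pose T (s : nat -> R) : {poly R} := \poly_(i < n.+1) s i.
have TE s k : (k <= n)%N -> (T s)`_k = s k by move=> kn; rewrite coef_poly ltnS kn.
have TM s t k : (k <= n)%N -> (T s * T t)`_k = seq_conv s t k.
  move=> kn; rewrite coefM; apply: eq_bigr => i _.
  have ik : (i <= k)%N by rewrite -ltnS.
  by rewrite !TE ?(leq_trans ik) // (leq_trans (leq_subr _ _)).
have : (T p * (T q * T r))`_n = (T p * T q * T r)`_n by rewrite mulrA.
rewrite !coefM => E; rewrite /seq_conv.
transitivity (\sum_(j < n.+1) (T p)`_j * (T q * T r)`_(n - j)).
  by apply: eq_bigr => k _; rewrite (TE p k (leq_ord k)) (TM q r) // leq_subr.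
rewrite E; apply: eq_bigr => k _.
by rewrite (TM p q k (leq_ord k)) (TE r) // leq_subr.
Qed.

Lemma seq_convC p q n : seq_conv p q n = seq_conv q p n.
Proof.
rewrite /seq_conv (reindex_inj rev_ord_inj) /=; apply: eq_bigr => k _.
by rewrite subSS (subKn (leq_ord k)) mulrC.
Qed.

(** Multiplying [x H' V] by [1 - H = 1 / V] gives back [x H']. Thus a gap weight is controlled by
    how far the straddling masses are from constant. *)
Lemma gap_length_straddle k :
  k.+1%:R * f k = a k.+1 - \sum_(i < k) f i * a (k - i)%N.
Proof.
pose D i := i.+1%:R * f i.
have aE n : a n.+1 = seq_conv D v n.
  by apply: eq_bigr => i _; rewrite subSS.
case: k => [|k].
  by rewrite /a !big_ord_recr !big_ord0 /= ren_mass0; ring.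
rewrite aE [seq_conv _ _ _]big_ord_recr /= subnn ren_mass0 mulr1 -/(D k.+1).
suff -> : \sum_(i < k.+1) D i * v (k.+1 - i)%N = \sum_(i < k.+1) f i * a (k.+1 - i)%N.
  by rewrite [_ + D _]addrC addrK.
transitivity (seq_conv D (seq_conv f v) k).
  apply: eq_bigr => i _; rewrite (subSn (leq_ord i)); congr (_ * _); exact: renewal_eq.
rewrite seq_convA.
have swap : forall n, seq_conv D f n = seq_conv f D n by move=> n; exact: seq_convC.
transitivity (seq_conv (seq_conv f D) v k).
  by apply: eq_bigr => i _; rewrite swap.
by rewrite -seq_convA; apply: eq_bigr => i _; rewrite (subSn (leq_ord i)) aE.
Qed.

Hypothesis alpha_gt0 : 0 < alpha.
Hypothesis alpha_lt1 : alpha < 1.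
Hypothesis rho_ge : forall k, 1 - alpha / k.+1%:R <= rho k.
Hypothesis rho_le : forall k, rho k <= (1 + alpha / k.+2%:R)^-1.

Lemma drift_ge0 j : 0 <= drift j.
Proof.
rewrite mulr_ge0 ?ren_mass_ge0 //.
have j0 : 0 < j.+1%:R :> R by rewrite ltr0n.
have := rho_ge j; rewrite -(ler_pM2l j0) mulrBr mulr1 mulrCA divff ?gt_eqF //.
by rewrite mulr1; lra.
Qed.

(** Inserting the upper bound on [rho j] leaves [alpha * (1 + alpha) / (j + 2 + alpha)]; the
    constant [2] bounds [alpha * (1 + alpha)]. *)
Lemma drift_le j : drift j <= 2 * v j / j.+1%:R.
Proof.
have a0 := alpha_gt0; have a1 := alpha_lt1.
have j0 : 0 < j.+1%:R :> R by rewrite ltr0n.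
rewrite [2 * _]mulrC -mulrA ler_wpM2l ?ren_mass_ge0 //.
have j2 : j.+2%:R = j.+1%:R + 1 :> R by rewrite -natr1.
set x : R := j.+1%:R in j0 j2 *.
have := rho_le j; rewrite j2; clearbody x => rho_le'.
have le1 : x * rho j <= x * (x + 1) / (x + 1 + alpha).
  rewrite -mulrA ler_pM2l //; apply: le_trans rho_le' _.
  have -> : 1 + alpha / (x + 1) = (x + 1 + alpha) / (x + 1) by field; apply: lt0r_neq0; lra.
  by rewrite invf_div.
apply: (@le_trans _ _ (x * (x + 1) / (x + 1 + alpha) - x + alpha)); first by lra.
have -> : x * (x + 1) / (x + 1 + alpha) - x + alpha =
   alpha * (1 + alpha) / (x + 1 + alpha) by field; apply: lt0r_neq0; lra.
rewrite ler_pdivrMr; last by lra.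
rewrite mulrAC ler_pdivlMr //.
have aa : alpha * (1 + alpha) <= 2 by nra.
apply: le_trans (_ : 2 * x <= _); last by lra.
by rewrite ler_pM2r.
Qed.

(** Serves to dominate the drift by decrements of [v], which telescope. The [4] comes from
    [x + 1 + alpha <= 4 * x] for [x >= 1]. *)
Lemma mass_step_ge j : alpha / 4 * (v j / j.+1%:R) <= v j - v j.+1.
Proof.
have a0 := alpha_gt0.
rewrite ren_massS -{2}[v j]mulr1 -mulrBr mulrCA.
rewrite ler_wpM2l ?ren_mass_ge0 //.
have j0 : 1 <= j.+1%:R :> R by rewrite ler1n.
have j2 : j.+2%:R = j.+1%:R + 1 :> R by rewrite -natr1.
have := rho_le j; rewrite j2; set x : R := j.+1%:R in j0 j2 *; clearbody x => le1.
have -> : alpha / 4 / x = alpha / (4 * x) by field; apply: lt0r_neq0; lra.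
apply: (@le_trans _ _ (1 - (x + 1) / (x + 1 + alpha))); last first.
  rewrite lerB //; apply: le_trans le1 _.
  have -> : 1 + alpha / (x + 1) = (x + 1 + alpha) / (x + 1) by field; apply: lt0r_neq0; lra.
  by rewrite invf_div.
have -> : 1 - (x + 1) / (x + 1 + alpha) = alpha / (x + 1 + alpha) by field; apply: lt0r_neq0; lra.
have a1 := alpha_lt1; rewrite (ler_wpM2l (ltW alpha_gt0)) // lef_pV2 ?posrE; lra.
Qed.

Lemma drift_le_step j : drift j <= 8 / alpha * (v j - v j.+1).
Proof.
apply: le_trans (drift_le j) _; rewrite -mulrA.
have e : 8 / alpha * (alpha / 4) = 2.
  by field; apply: lt0r_neq0.
have := mass_step_ge j; rewrite -(@ler_pM2l _ (8 / alpha)) ?divr_gt0 //.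
by rewrite [X in X <= _ -> _]mulrA e.
Qed.

(** By [drift_le_step] the sum is at most [8 / alpha] times a telescoping sum of decrements, itself
    at most [v 0 = 1]. *)
Lemma sum_drift_le m : \sum_(j < m) drift j <= 8 / alpha.
Proof.
have c0 : 0 <= 8 / alpha by rewrite divr_ge0 // ltW.
apply: (@le_trans _ _ (8 / alpha * (v 0 - v m))); last first.
  by rewrite ler_piMr // ren_mass0 gerBl ren_mass_ge0.
elim: m => [|m IHm]; first by rewrite big_ord0 subrr mulr0.
rewrite big_ord_recr /=; apply: le_trans (lerD IHm (drift_le_step m)) _.
by rewrite -mulrDr ler_wpM2l // addrA subrK.
Qed.

Lemma drift_conv_ge0 n : 0 <= drift_conv n.
Proof. by apply: sumr_ge0 => j _; rewrite mulr_ge0 ?drift_ge0 ?gap_tail_ge0. Qed.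

(* Cut the convolution at [m]: below, [hb] is small; above, the drift is. *)
Lemma drift_conv_le m k : drift_conv (m + k) <=
  8 / alpha * hb k + 2 * v m / (m.+1%:R * v k).
Proof.
rewrite /drift_conv big_split_ord /=; apply: lerD.
  apply: le_trans (_ : (\sum_(j < m) drift j) * hb k <= _).
    rewrite mulr_suml; apply: ler_sum => j _; rewrite ler_wpM2l ?drift_ge0 //.
    by apply: gap_tail_le; rewrite -addnBAC ?leq_addl.
  by rewrite ler_wpM2r ?gap_tail_ge0 ?sum_drift_le.
have vk := ren_mass_gt0 k.
have m1 : 0 < m.+1%:R :> R by rewrite ltr0n.
apply: le_trans (_ : \sum_(j < k) (2 * v m / m.+1%:R) * hb (k - j.+1)%N <= _).
  apply: ler_sum => j _; rewrite (_ : m + k - (m + j).+1 = k - j.+1)%N; last by lia.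
  rewrite ler_wpM2r ?gap_tail_ge0 //; apply: le_trans (drift_le _) _.
  rewrite -!mulrA ler_wpM2l //; apply: ler_pM; rewrite ?ren_mass_ge0 ?invr_ge0 //.
    by rewrite ren_mass_le ?leq_addr.
  by rewrite lef_pV2 ?posrE ?ltr0n // ler_nat ltnS leq_addr.
rewrite -mulr_sumr invfM !mulrA ler_wpM2l //.
  by rewrite divr_ge0 ?mulr_ge0 ?ren_mass_ge0.
rewrite -[leRHS]mul1r ler_pdivlMr // mulrC.
apply: le_trans (mass_mul_sum_tail k); rewrite ler_wpM2l ?ren_mass_ge0 //.
rewrite (reindex_inj rev_ord_inj) /= big_ord_recr /=.
rewrite -[leLHS]addr0 lerD ?gap_tail_ge0 //; apply: ler_sum => j _.
by rewrite (_ : k - (k - j.+1).+1 = j)%N //; have := ltn_ord j; lia.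
Qed.

(** In [gap_length_straddle] every subtracted [a] is at least [1 - alpha], the drift being
    nonnegative. What remains is [(1 - alpha)] times a gap tail, plus the drift of the leading
    term. *)
Lemma gap_length_le k : k.+1%:R * f k <= (1 - alpha) * hb k + drift_conv k.+1.
Proof.
rewrite gap_length_straddle straddle_massE.
have : (1 - alpha) * \sum_(i < k) f i <= \sum_(i < k) f i * a (k - i)%N.
  rewrite mulr_sumr; apply: ler_sum => i _.
  rewrite mulrC ler_wpM2l ?first_gap_ge0 //.
  rewrite -[(k - i)%N]prednK ?subn_gt0 // straddle_massE lerDl.
  exact: drift_conv_ge0.
by rewrite /gap_tail; lra.
Qed.

End RenewalSequence.

(** * Random finite sets with the renewal property *)

Definition none_in (p : pred nat) (t k : nat) : bool :=
  all (fun x => ~~ p x) (iota t k).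

Lemma none_inS p t k : none_in p t k.+1 = none_in p t k && ~~ p (t + k)%N.
Proof. by rewrite /none_in -addn1 iotaD all_cat /= andbT. Qed.

Lemma first_hit (R : pzSemiRingType) (p : pred nat) (t m : nat) :
  \sum_(j < m) (none_in p t j && p (t + j)%N)%:R = (~~ none_in p t m)%:R :> R.
Proof.
elim: m => [|m IHm]; first by rewrite big_ord0.
rewrite big_ord_recr /= IHm none_inS.
by case: (none_in p t m); case: (p _); rewrite /= ?addr0 ?add0r.
Qed.

(* Distance minus one from [x] to the next point of [Q], where [n] counts as a
   point. *)
Definition next_gap (n : nat) (Q : pred nat) (x : nat) : nat :=
  find (fun j => Q (x + j.+1)%N) (iota 0 (n - x.+1)).

Lemma next_gap_eq n (Q : pred nat) x u : (x < u)%N -> (u <= n)%N ->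
  (u = n \/ Q u) -> (forall y, (x < y)%N -> (y < u)%N -> ~~ Q y) ->
  next_gap n Q x = (u - x.+1)%N.
Proof.
move=> xu un Qu Qn; rewrite /next_gap.
have -> : (n - x.+1 = (u - x.+1) + (n - u))%N by lia.
rewrite iotaD find_cat add0n.
rewrite ifF; last first.
  apply/negbTE/hasPn => j; rewrite mem_iota add0n => /andP[_ j_lt].
  by apply: Qn; lia.
rewrite size_iota; case: (ltngtP u n) Qu => [lt_un|lt_nu|->] Qu.
- case: Qu => [E|Qu]; first by rewrite E ltnn in lt_un.
  have -> : (n - u = (n - u).-1.+1)%N by lia.
  by rewrite /= (_ : x + (u - x.+1).+1 = u)%N ?Qu ?addn0 //; lia.
- lia.
- by rewrite subnn /= addn0.
Qed.

Lemma eq_next_gap n (Q Q' : pred nat) x :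
  (forall y, (x < y)%N -> (y < n)%N -> Q y = Q' y) ->
  next_gap n Q x = next_gap n Q' x.
Proof.
move=> QQ'; apply: eq_in_find => j; rewrite mem_iota add0n => /andP[_ j_lt].
by apply: QQ'; lia.
Qed.

Section RenewalSet.
Variables (R : realFieldType) (rho : nat -> R).
Hypothesis rho_gt0 : forall k, 0 < rho k.
Hypothesis rho_le1 : forall k, rho k <= 1.
Hypothesis rho_mono : forall j k, (j <= k)%N -> rho j <= rho k.
Variables (N : nat) (w : {set 'I_N.+1} -> R).
Hypothesis w_ge0 : forall S, 0 <= w S.
Local Notation n := N.+1.
Local Notation v := (ren_mass rho).
Local Notation f := (first_gap v).
Local Notation hb := (gap_tail v).

(** Sites are read cyclically from an origin [a]. Rotations then act on [a] and leave the set alone,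
    and position [n] is the origin again. *)
Definition site (S : {set 'I_n}) (a x : nat) : bool := inord ((a + x) %% n) \in S.

Definition wsum (phi : {set 'I_n} -> R) : R := \sum_S w S * phi S.

Definition contains (Q : pred nat) (S : {set 'I_n}) (a t : nat) : bool :=
  all (fun x => Q x ==> site S a x) (iota t.+1 (n - t.+1)).

Hypothesis renewal_law : forall (a : nat) (Q : pred nat),
  wsum (fun S => (site S a 0 && contains Q S a 0)%:R)
  = \prod_(0 <= x < n) rho (next_gap n Q x).

Lemma eq_wsum phi psi : phi =1 psi -> wsum phi = wsum psi.
Proof. by move=> E; apply: eq_bigr => S _; rewrite E. Qed.

Lemma ler_wsum phi psi : (forall S, phi S <= psi S) -> wsum phi <= wsum psi.
Proof. by move=> le; apply: ler_sum => S _; rewrite ler_wpM2l. Qed.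

Lemma wsum_sum (I : Type) (r : seq I) (P : pred I) (phi : I -> {set 'I_n} -> R) :
  wsum (fun S => \sum_(i <- r | P i) phi i S) = \sum_(i <- r | P i) wsum (phi i).
Proof.
rewrite /wsum exchange_big /=; apply: eq_bigr => S _; by rewrite mulr_sumr.
Qed.

Lemma site_period S a : site S a n = site S a 0.
Proof. by rewrite /site addn0 modnDr. Qed.

Lemma site_shift S a b x : site S ((a + b) %% n) x = site S a (b + x).
Proof. by rewrite /site modnDml addnA. Qed.

(* [phi] is a functional of the past of [t], and [t] is a renewal point: the
   part of the set after [t] has the renewal law. *)
Definition renewal_at (a t : nat) (phi : {set 'I_n} -> R) (c : R) : Prop :=
  (forall S, phi S * (site S a 0)%:R = phi S) /\
  (forall Q : pred nat,
     wsum (fun S => phi S * (site S a t && contains Q S a t)%:R)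
     = c * \prod_(t <= x < n) rho (next_gap n Q x)).

Lemma renewal_at0 a : renewal_at a 0 (fun S => (site S a 0)%:R) 1.
Proof.
split=> [S|Q]; first by case: site; rewrite ?mulr1 ?mulr0.
rewrite mul1r -(renewal_law a); apply: eq_wsum => S.
by case: site; rewrite ?mul1r ?mul0r.
Qed.

Lemma eq_renewal_at a t phi psi c : phi =1 psi ->
  renewal_at a t phi c -> renewal_at a t psi c.
Proof.
move=> E [H1 H2]; split=> [S|Q]; first by rewrite -E H1.
by rewrite -H2; apply: eq_wsum => S; rewrite E.
Qed.

Lemma renewal_at_sum a t (m : nat) (phi : 'I_m -> {set 'I_n} -> R) (c : 'I_m -> R) :
  (forall i, renewal_at a t (phi i) (c i)) ->
  renewal_at a t (fun S => \sum_i phi i S) (\sum_i c i).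
Proof.
move=> H; split=> [S|Q].
  by rewrite mulr_suml; apply: eq_bigr => i _; case: (H i) => ->.
rewrite mulr_suml -(eq_bigr _ (fun i _ => (H i).2 Q)) -wsum_sum.
by apply: eq_wsum => S; rewrite mulr_suml.
Qed.

(** Between [t] and [u] the next point is [u], and the arguments of [rho] run through
    [u - t - 1, ..., 0], so these factors multiply to [v (u - t)]. *)
Lemma prod_next_gap (Q : pred nat) t u : (t <= u)%N -> (u <= n)%N ->
  (u = n \/ Q u) -> (forall y, (t < y)%N -> (y < u)%N -> ~~ Q y) ->
  \prod_(t <= x < n) rho (next_gap n Q x)
  = v (u - t)%N * \prod_(u <= x < n) rho (next_gap n Q x).
Proof.
move=> tu un Qu Qn; rewrite (big_cat_nat tu un) /=; congr (_ * _).
rewrite -{1}[t]add0n big_addn big_mkord /ren_mass (reindex_inj rev_ord_inj) /=.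
apply: eq_bigr => x _; have := ltn_ord x => xlt; congr rho.
rewrite (@next_gap_eq _ _ _ u) //; try lia.
by move=> y ty yu; apply: Qn; lia.
Qed.

Lemma prod_next_gap0 t : (t <= n)%N ->
  \prod_(t <= x < n) rho (next_gap n pred0 x) = v (n - t)%N.
Proof.
move=> tn; rewrite (@prod_next_gap pred0 t n) //; last by left.
by rewrite big_geq ?mulr1.
Qed.

Lemma containsE Q S a t k : (t + k.+1 <= n)%N -> site S a 0 ->
  contains (fun x => (x == t + k.+1)%N || (t + k.+1 < x)%N && Q x) S a t
  = site S a (t + k.+1) && contains Q S a (t + k.+1).
Proof.
move=> tkn s0; rewrite /contains.
have -> : (n - t.+1 = k + (n - (t + k.+1)))%N by lia.
rewrite iotaD all_cat.
have -> : all (fun x => (x == t + k.+1)%N || (t + k.+1 < x)%N && Q x ==> site S a x)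
    (iota t.+1 k).
  apply/allP => x; rewrite mem_iota => xk.
  by have /negbTE -> : ~~ ((x == t + k.+1)%N || (t + k.+1 < x)%N && Q x) by lia.
rewrite /= (_ : (t.+1 + k)%N = (t + k.+1)%N) ?addSnnS //.
case: (ltngtP (t + k.+1) n) tkn => // [lt|E] _.
  have -> : (n - (t + k.+1) = (n - (t + k.+1).+1).+1)%N by lia.
  rewrite /= eqxx /=; congr (_ && _); apply: eq_in_all => x; rewrite mem_iota => xk.
  by move/andP: xk => [xk _]; rewrite (gtn_eqF xk) xk.
(* When [t + k.+1 = n] the point reached is the origin, present by [s0]; this is why [renewal_at]
   asks that [phi] vanish when the origin is absent. *)
by rewrite E site_period s0 subnn subnS subnn.
Qed.

(** Strong induction on [k]. The renewal property at [t] is applied to [Q] together with the point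
    [t + k.+1], and the event is split by the first point [t + j.+1] after [t]. The cases [j < k]
    are known by induction; subtracting them leaves [c] times the recursion [first_gapE]. *)
Lemma renewal_step a t k phi c : (t + k.+1 <= n)%N -> renewal_at a t phi c ->
  renewal_at a (t + k.+1)
    (fun S => phi S * (site S a t && none_in (site S a) t.+1 k)%:R) (c * f k).
Proof.
move=> tkn H; have [H1 H2] := H; elim/ltn_ind: k tkn => k IHk tkn.
split=> [S|Q]; first by rewrite mulrAC H1.
pose Q' x := (x == t + k.+1)%N || (t + k.+1 < x)%N && Q x.
have Q'P j : (j <= k)%N -> \prod_(t + j <= x < n) rho (next_gap n Q' x)
    = v (k.+1 - j)%N * \prod_(t + k.+1 <= x < n) rho (next_gap n Q x).
  move=> jk; rewrite (@prod_next_gap Q' (t + j) (t + k.+1)); try lia.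
  - congr (v _ * _); first lia.
    rewrite !big_nat; apply: eq_bigr => x /andP[x1 x2]; congr rho.
    by apply: eq_next_gap => y y1 y2; rewrite /Q'; lia.
  - by right; rewrite /Q' eqxx.
  - by move=> y y1 y2; rewrite /Q'; lia.
have split_at j S psi : psi * (site S a 0)%:R = psi ->
   (j <= k)%N -> psi * (site S a (t + j) && contains Q' S a (t + j))%:R =
   psi * (site S a (t + j) && (site S a (t + k.+1) && contains Q S a (t + k.+1)))%:R.
  case s0 : (site S a 0); last by move=> <-; rewrite mulr0 !mul0r.
  move=> _ jk; congr (_ * (_ && _)%:R).
  have E : (t + k.+1 = (t + j) + (k - j).+1)%N by lia.
  by rewrite /Q' E containsE //; lia.
have := H2 Q'; rewrite -[t in \prod_(t <= _ < n) _]addn0 Q'P // subn0.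
have -> : wsum (fun S => phi S * (site S a t && contains Q' S a t)%:R) =
    \sum_(j < k.+1) wsum (fun S =>
       phi S * (site S a t && none_in (site S a) t.+1 j)%:R *
       (site S a (t + j.+1) && (site S a (t + k.+1) && contains Q S a (t + k.+1)))%:R).
  rewrite -wsum_sum; apply: eq_wsum => S.
  rewrite -[t in contains _ _ _ t]addn0 -{1}[t]addn0 split_at // addn0.
  case: (site S a t); last first.
    by rewrite mulr0 big1 // => j _; rewrite mul0r.
  rewrite andTb -[in LHS](mulr1 (phi S)) -mulrA.
  under eq_bigr do rewrite andTb -mulrA.
  rewrite -mulr_sumr; congr (_ * _); rewrite mul1r.
  case E : (site S a (t + k.+1) && _); last first.
    by rewrite big1 // => j _; rewrite andbF mulr0.
  have := first_hit R (site S a) t.+1 k.+1.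
  have /andP[sk _] := E.
  rewrite none_inS addSn -addnS sk andbF => <-.
  by apply: eq_bigr => j _; rewrite andbT addSn -addnS -natrM mulnb.
rewrite big_ord_recr /=.
rewrite (eq_bigr (fun j : 'I_k => c * f j * (v (k - j)%N *
   \prod_(t + k.+1 <= x < n) rho (next_gap n Q x)))); last first.
  move=> j _; have jk := ltn_ord j.
  have [I1 I2] : renewal_at a (t + j.+1)
    (fun S => phi S * (site S a t && none_in (site S a) t.+1 j)%:R) (c * f j).
    by apply: IHk => //; lia.
  have := I2 Q'; rewrite Q'P // subSS => <-; apply: eq_wsum => S.
  by rewrite split_at.
under eq_wsum do rewrite andbA andbb.
set X := wsum _ => EX; move: EX; set P := \prod_(_ <= _ < n) _ => EX.
rewrite first_gapE mulrBr mulrBl -(mulrA c (v _)) -EX.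
rewrite addrC mulr_sumr mulr_suml.
rewrite (eq_bigr (fun i : 'I_k => c * (f i * v (k - i)%N) * P)) => [|i _].
  by rewrite addrK.
by rewrite !mulrA.
Qed.

(** For [k = N] the right end is the left end after a full turn, so a singleton also has a gap. *)
Definition gap_at (S : {set 'I_n}) (a k : nat) : bool :=
  [&& site S a 0, none_in (site S a) 1 k & site S a k.+1].

Lemma wsum_gap_at a k : (k < n)%N ->
  wsum (fun S => (gap_at S a k)%:R) = f k * v (n - k.+1)%N.
Proof.
move=> kn; have [_ H] := @renewal_step a 0 k _ _ kn (renewal_at0 a).
rewrite -(prod_next_gap0 kn) -[f k]mul1r -[k.+1]add0n -(H pred0).
apply: eq_wsum => S; rewrite /gap_at.
rewrite (_ : contains _ _ _ _ = true) ?andbT; last by apply/allP.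
by rewrite -natrM -natrM !mulnb; case: (site S a 0).
Qed.

(* Every nonempty set has exactly one gap straddling the boundary between the
   sites [n - 1] and [0]. *)
Lemma straddling_gap S :
  (S != set0)%:R = \sum_(k < n) \sum_(i < k.+1) (gap_at S (N - i) k)%:R :> R.
Proof.
have := first_hit R (fun i => site S 0 (N - i)) 0 n.
rewrite (_ : ~~ none_in _ 0 n = (S != set0)); last first.
  apply/idP/set0Pn => [/allPn[i _]|[z zS]].
    by rewrite negbK => h; exists (inord ((0 + (N - i)) %% n)).
  apply/allPn; exists (N - z)%N; first by rewrite mem_iota /= ltnS leq_subr.
  by rewrite negbK /site add0n (subKn (leq_ord z)) modn_small // inord_val.
move=> <-.
transitivity (\sum_(i < n) \sum_(k < n | (i <= k)%N) (gap_at S (N - i) k)%:R : R).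
  apply: eq_bigr => i _; rewrite add0n.
  have iN : (i <= N)%N by rewrite -ltnS.
  have siteE x : (x < i)%N -> site S (N - i) x.+1 = site S 0 (N - (i - x.+1)).
    by move=> xi; rewrite /site add0n; congr (inord (_ %% _) \in S); lia.
  case si : (site S 0 (N - i)); last first.
    rewrite andbF big1 // => k _.
    by rewrite /gap_at (_ : site S (N - i) 0 = false) // /site addn0.
  have si' : site S (N - i) 0 by rewrite /site addn0.
  rewrite andbT.
  have noneE : none_in (fun i => site S 0 (N - i)) 0 i = none_in (site S (N - i)) 1 i.
    apply/allP/allP => H x; rewrite mem_iota => xi.
      have x0 : (0 < x)%N by lia.
      rewrite -(prednK x0) siteE; last by lia.
      by apply: H; rewrite mem_iota; lia.
    have -> : (x = i - (i - x.+1).+1)%N by lia.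
    by rewrite -siteE; [apply: H; rewrite mem_iota|]; lia.
  rewrite noneE; case E : (none_in _ 1 i); last first.
    rewrite big1 // => k ik; rewrite /gap_at (_ : none_in _ 1 k = false) ?andbF //.
    apply/negbTE; move/negbT: E => /allPn[x]; rewrite mem_iota => xi sx.
    by apply/allPn; exists x => //; rewrite mem_iota; lia.
  have := first_hit R (site S (N - i)) 1 n.
  rewrite none_inS add1n site_period si' andbF => <-.
  rewrite (bigID (fun k : 'I_n => (i <= k)%N)) /= [X in _ + X]big1 ?addr0.
    by apply: eq_bigr => k _; rewrite /gap_at si' add1n.
  move=> k; rewrite -ltnNge => ki; rewrite add1n.
  have /allP/(_ k.+1) := E; rewrite mem_iota => H.
  by rewrite (negbTE (H _)) ?andbF //; lia.
rewrite (exchange_big_dep predT) //=; apply: eq_bigr => k _.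
by rewrite (big_ord_widen n (fun i => (gap_at S (N - i) k)%:R)).
Qed.

(** The weight of a gap does not depend on its position, and a gap of length [k.+1] can be placed
    over the fixed edge in [k.+1] ways; this is the factor [k.+1] in [straddle_mass]. *)
Lemma wsum_nonempty : \sum_(S | S != set0) w S = straddle_mass rho n.
Proof.
transitivity (wsum (fun S => (S != set0)%:R)).
  rewrite /wsum [RHS](bigID (fun S : {set 'I_n} => S != set0)) /=.
  rewrite [X in _ + X]big1 ?addr0; last by move=> S /negbTE ->; rewrite mulr0.
  by apply: eq_bigr => S ->; rewrite mulr1.
under eq_wsum do rewrite straddling_gap.
rewrite wsum_sum; apply: eq_bigr => k _; rewrite wsum_sum.
under eq_bigr do rewrite wsum_gap_at //.
by rewrite sumr_const card_ord -[LHS]mulr_natl mulrA.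
Qed.

(** Each site belongs to the set with weight [v n], by the renewal law with [Q] empty. The terms
    [gap_at S a N] are split off and cancel again. *)
Lemma wsum_card : wsum (fun S => #|S|%:R) = n%:R * v n.
Proof.
transitivity (wsum (fun S => \sum_(a < n) (gap_at S a N)%:R
   + \sum_(a < n) ((site S a 0)%:R - (gap_at S a N)%:R))).
  apply: eq_wsum => S; rewrite -big_split /=.
  rewrite (eq_bigr (fun a : 'I_n => (a \in S)%:R)) => [|a _].
    by rewrite -sum1_card natr_sum (big_mkcond (fun i => i \in S)) /=;
      apply: eq_bigr => i _; case: (i \in S).
  by rewrite addrC subrK /site addn0 modn_small // inord_val.
rewrite (@eq_wsum _ (fun S => \sum_(a < n) (site S a 0)%:R)) => [|S]; last first.
  by rewrite -big_split /=; apply: eq_bigr => a _; rewrite addrC subrK.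
rewrite wsum_sum.
under eq_bigr => a _.
  rewrite (@eq_wsum _ (fun S => (site S a 0 && contains pred0 S a 0)%:R)) => [|S].
  rewrite renewal_law prod_next_gap0 // subn0; over.
  rewrite (_ : contains _ _ _ _ = true) ?andbT //; exact/allP.
by rewrite sumr_const card_ord [RHS]mulr_natl.
Qed.

(** The [j]-fold convolution of the gap law at [t], that is, the weight of the [j]-th renewal
    falling at [t]. The index [t - u.+1] reflects that [f k] is the weight of length [k.+1]. *)
Fixpoint gap_conv (j t : nat) : R :=
  if j is j'.+1 then \sum_(u < t) gap_conv j' u * f (t - u.+1)%N
  else (t == 0%N)%:R.

Lemma gap_conv_ge0 j t : 0 <= gap_conv j t.
Proof.
elim: j t => [|j IHj] t /=; first by case: eqP.
by apply: sumr_ge0 => u _; rewrite mulr_ge0 // first_gap_ge0.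
Qed.

(** The position of the [j]-th renewal has a law of total mass at most one, because a single gap
    has. *)
Lemma sum_gap_conv_le1 j m : \sum_(t < m) gap_conv j t <= 1.
Proof.
elim: j m => [|j IHj] m /=.
  case: m => [|m]; first by rewrite big_ord0.
  by rewrite big_ord_recl /= big1 ?addr0.
apply: le_trans (IHj m).
have -> : \sum_(t < m) \sum_(u < t) gap_conv j u * f (t - u.+1)%N =
   \sum_(u < m) gap_conv j u * \sum_(i < m - u.+1) f i.
  elim: m => [|m IHm]; first by rewrite !big_ord0.
  rewrite !big_ord_recr /= IHm subnn big_ord0 mulr0 addr0 -big_split /=.
  apply: eq_bigr => u _; have um := ltn_ord u.
  by rewrite subSn // big_ord_recr /= mulrDr.
apply: ler_sum => u _; rewrite ler_piMr ?gap_conv_ge0 //.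
exact: gap_sum_le1.
Qed.

(** Induction on [j], decomposing by the last point [u] before [t]: [j] points precede [u], and
    [renewal_step] leads from [u] to [t]. *)
Lemma renewal_at_count a j t : (t <= n)%N ->
  renewal_at a t (fun S => (site S a 0 && (count (site S a) (iota 0 t) == j))%:R)
    (gap_conv j t).
Proof.
elim: j t => [|j IHj] t tn.
  case: t tn => [|t] tn.
    by apply: eq_renewal_at (renewal_at0 a) => S; rewrite andbT.
  split=> [S|Q].
    by case: (site S a 0); rewrite /= ?mulr0 ?mulr1.
  rewrite mul0r /wsum big1 // => S _ /=.
  by case: (site S a 0); rewrite /= ?mul0r ?mulr0.
have H (u : 'I_t) : renewal_at a t
   (fun S => (site S a 0 && (count (site S a) (iota 0 u) == j))%:R *
      (site S a u && none_in (site S a) u.+1 (t - u.+1))%:R)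
   (gap_conv j u * f (t - u.+1)%N).
  have ut := ltn_ord u.
  have -> : renewal_at a t = renewal_at a (u + (t - u.+1).+1) by congr renewal_at; lia.
  by apply: renewal_step; [lia|apply: IHj; lia].
apply: eq_renewal_at (renewal_at_sum H) => S.
case: (site S a 0) => /=; last by rewrite big1 // => u _; rewrite mul0r.
elim: t {tn H} => [|t IHt]; first by rewrite big_ord0.
have -> : count (site S a) (iota 0 t.+1) = (count (site S a) (iota 0 t) + site S a t)%N.
  by rewrite -{1}[t.+1]addn1 iotaD count_cat /= addn0.
rewrite big_ord_recr /= subnn andbT.
rewrite (eq_bigr (fun u : 'I_t => (count (site S a) (iota 0 u) == j)%:R *
   (site S a u && none_in (site S a) u.+1 (t - u.+1))%:R * (~~ site S a t)%:R)).
  rewrite -mulr_suml IHt; case: (site S a t) => /=.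
    by rewrite mulr0 add0r mulr1 addn1 eqSS.
  by rewrite mulr1 mulr0 addr0 addn0.
move=> u _; have ut := ltn_ord u.
rewrite subSn // none_inS (subnKC ut).
by rewrite -!natrM !mulnb -!andbA.
Qed.

Lemma card_sites (S : {set 'I_n}) a : #|S| = count (site S a) (iota 0 n).
Proof.
transitivity (\sum_(x < n) site S a x)%N; last first.
  have -> : iota 0 n = index_iota 0 n by rewrite /index_iota subn0.
  rewrite -sum1_count [RHS]big_mkcond big_mkord.
  by apply: eq_bigr => i _; case: site.
rewrite -sum1_card big_mkcond /=.
pose h (x : 'I_n) : 'I_n := inord ((a + x) %% n).
have h_inj : injective h.
  move=> x y /(congr1 val) /=; rewrite !inordK ?ltn_mod // => /eqP.
  by rewrite eqn_modDl !modn_small // => /eqP/val_inj.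
by rewrite (reindex_inj h_inj) /=; apply: eq_bigr => x _; rewrite /site; case: (_ \in _).
Qed.

(** Read from its right end, the gap is the last one of the turn: the set first needs [#|S| - 1]
    gaps to reach the left end at distance [L], then makes one jump of length [k.+1]. *)
Lemma wsum_gap_at_small p k m : (k < n)%N ->
  wsum (fun S => (gap_at S p k && (#|S| <= m)%N)%:R)
  <= f k * \sum_(j < m) gap_conv j (n - k.+1).
Proof.
move=> kn; pose L := (n - k.+1)%N; pose a := ((p + k.+1) %% n)%N.
have Lk : (L + k.+1 = n)%N by rewrite /L; lia.
have H j : renewal_at a n (fun S =>
    (site S a 0 && (count (site S a) (iota 0 L) == j))%:R *
    (site S a L && none_in (site S a) L.+1 k)%:R) (gap_conv j L * f k).
  by rewrite -{1}Lk; apply: renewal_step; [lia|apply: renewal_at_count; lia].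
rewrite mulr_sumr (eq_bigr (fun j : 'I_m => wsum (fun S =>
   (site S a 0 && (count (site S a) (iota 0 L) == j))%:R *
    (site S a L && none_in (site S a) L.+1 k)%:R))); last first.
  move=> j _; have [H1 H2] := H j.
  have := H2 pred0; rewrite big_geq // mulr1 [f k * _]mulrC => <-.
  apply: eq_wsum => S; rewrite (_ : contains _ _ _ _ = true) ?andbT; last exact/allP.
  by rewrite site_period; case: (site S a 0); rewrite /= ?mul0r ?mulr1.
rewrite -wsum_sum; apply: ler_wsum => S.
have sa x : site S a (L + x) = site S p x.
  rewrite /a site_shift /site; congr (inord _ \in S).
  by rewrite (_ : p + (k.+1 + (L + x)) = (p + x) + n)%N ?modnDr //; lia.
have sa' : site S a 0 = site S p k.+1 by rewrite /a site_shift addn0.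
case g : (gap_at S p k); last by apply: sumr_ge0 => j _; rewrite -natrM ler0n.
have /and3P[g1 g2 g3] := g.
have none : none_in (site S a) L.+1 k.
  apply/allP => x; rewrite mem_iota => xk.
  rewrite (_ : x = L + (x - L))%N; last by lia.
  by rewrite sa; apply: (allP g2); rewrite mem_iota; lia.
have sL : site S a L by rewrite -[L]addn0 sa.
have cardE : #|S| = (count (site S a) (iota 0 L)).+1.
  rewrite (card_sites S a) -{1}Lk iotaD count_cat /= add0n sL.
  rewrite (_ : count _ (iota L.+1 k) = 0%N) ?addn0 ?addn1 //.
  apply/eqP; rewrite -leqn0 leqNgt -has_count -all_predC; exact: none.
rewrite sa' g3 sL none /=.
case: leqP => [|_]; last by apply: sumr_ge0 => j _; rewrite -natrM ler0n.
rewrite cardE => cm; rewrite (bigD1 (Ordinal cm)) //= eqxx mulr1 lerDl.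
by apply: sumr_ge0 => j _; rewrite -natrM ler0n.
Qed.

(** The straddling gap is cut at length [K]. A shorter one leaves a factor
    [v (n - k.+1) <= v (n - K)]. A longer one has [k.+1%:R * f k <= B], and for each of the [m]
    possible numbers of other gaps the weights [gap_conv j] sum over [k] to at most one. *)
Lemma wsum_small_le m K B : (K <= n)%N ->
  (forall k, (K <= k)%N -> k.+1%:R * f k <= B) ->
  \sum_(S : {set 'I_n} | (0 < #|S| <= m)%N) w S
  <= v (n - K)%N * \sum_(k < K) hb k + m%:R * B.
Proof.
move=> Kn HB.
have B0 : 0 <= B.
  by apply: le_trans (HB K (leqnn _)); rewrite mulr_ge0 ?first_gap_ge0.
have -> : \sum_(S : {set 'I_n} | (0 < #|S| <= m)%N) w S =
   \sum_(k < n) \sum_(i < k.+1) wsum (fun S => (gap_at S (N - i) k && (#|S| <= m)%N)%:R).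
  transitivity (wsum (fun S => (S != set0)%:R * (#|S| <= m)%N%:R)).
    rewrite big_mkcond /=; apply: eq_bigr => S _.
    by rewrite card_gt0 -natrM mulnb; case: andb; rewrite ?mulr1 ?mulr0.
  under eq_bigr do rewrite -wsum_sum.
  rewrite -wsum_sum; apply: eq_wsum => S; rewrite straddling_gap mulr_suml.
  apply: eq_bigr => k _; rewrite mulr_suml; apply: eq_bigr => i _.
  by rewrite -natrM mulnb.
have splitE (F : nat -> R) :
    \sum_(k < n) F k = \sum_(k < K) F k + \sum_(k < n - K) F (K + k)%N.
  rewrite -(big_mkord xpredT F) (big_cat_nat (leq0n K) Kn) /= big_mkord.
  congr (_ + _); rewrite -[X in index_iota X _]add0n big_addn big_mkord.
  by apply: eq_bigr => k _; rewrite addnC.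
rewrite (splitE (fun k => \sum_(i < k.+1) wsum (fun S =>
  (gap_at S (N - i) k && (#|S| <= m)%N)%:R))); apply: lerD.
  apply: le_trans (_ : v (n - K)%N * \sum_(k < K) k.+1%:R * f k <= _); last first.
    by rewrite ler_wpM2l ?ren_mass_ge0 ?sum_gap_length_le.
  rewrite mulr_sumr; apply: ler_sum => k _; have kK := ltn_ord k.
  apply: le_trans (_ : \sum_(i < k.+1) f k * v (n - k.+1)%N <= _).
    apply: ler_sum => i _; rewrite -(@wsum_gap_at (N - i)); last by lia.
    by apply: ler_wsum => S; rewrite ler_nat; case: gap_at; case: (#|S| <= m)%N.
  rewrite sumr_const card_ord -[leLHS]mulr_natl mulrA mulrC ler_wpM2r //.
    by rewrite mulr_ge0 ?first_gap_ge0.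
  by apply: ren_mass_le => //; lia.
apply: le_trans (_ : \sum_(k < n - K) B * \sum_(j < m) gap_conv j (n - (K + k).+1) <= _).
  apply: ler_sum => k _; have kK := ltn_ord k.
  apply: le_trans (_ : \sum_(i < (K + k).+1) f (K + k)%N *
      \sum_(j < m) gap_conv j (n - (K + k).+1) <= _).
    by apply: ler_sum => i _; apply: wsum_gap_at_small; lia.
  rewrite sumr_const card_ord -[leLHS]mulr_natl mulrA ler_wpM2r ?HB ?leq_addr //.
  by apply: sumr_ge0 => j _; exact: gap_conv_ge0.
rewrite -mulr_sumr mulrC ler_wpM2r // exchange_big /=.
rewrite -[leRHS]mulr1 -[m in leRHS]card_ord mulr_natl -sumr_const; apply: ler_sum => j _.
rewrite (reindex_inj rev_ord_inj) /= (eq_bigr (fun k : 'I_(n - K) => gap_conv j k)).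
  exact: sum_gap_conv_le1.
by move=> k _; congr gap_conv; have := ltn_ord k; lia.
Qed.

End RenewalSet.

From mathcomp Require Import finmap.
From mathcomp Require Import all_classical all_reals all_analysis measurable_realfun.
Import Order.TTheory GRing.Theory Num.Theory numFieldNormedType.Exports.
Local Open Scope classical_set_scope.
Local Open Scope ring_scope.

(** * Asymptotics *)

Lemma cvg_natSr_powRN (R : realType) (x : R) : x < 0 ->
  (n.+1%:R : R) `^ x @[n --> \oo] --> (0 : R).
Proof.
move=> x0; apply/cvgr0Pnorm_le => e e0; near=> n.
rewrite ger0_norm ?powR_ge0 //.
have -> : e = (e `^ x^-1) `^ x by rewrite -powRrM mulVf ?lt_eqF // powRr1 // ltW.
rewrite -[x]opprK !(powRN _ (- x)) lef_pV2 ?posrE ?powR_gt0 //.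
apply: ge0_ler_powR; rewrite ?nnegrE ?powR_ge0 // ?oppr_ge0; first exact: ltW.
apply: (@le_trans _ _ n%:R); last by rewrite ler_nat.
near: n; exact: nbhs_infty_ger.
Unshelve. all: by end_near. Qed.

Lemma cvgr0_le (R : realType) (u z : nat -> R) : (forall n, 0 <= u n) ->
  (\forall n \near \oo, u n <= z n) -> z n @[n --> \oo] --> 0 ->
  u n @[n --> \oo] --> 0.
Proof.
move=> u0 uz z0; apply: (squeeze_cvgr _ (cvg_cst 0) z0).
by apply: filterS uz => n ->; rewrite u0.
Qed.

Lemma powR_nat_le (R : realType) (j k : nat) (x : R) : x <= 0 -> (j <= k)%N ->
  (k.+1%:R : R) `^ x <= j.+1%:R `^ x.
Proof.
move=> x0 jk; rewrite -[x]opprK !(powRN _ (- x)) lef_pV2 ?posrE ?powR_gt0 //.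
by apply: ge0_ler_powR; rewrite ?nnegrE ?oppr_ge0 // ler_nat.
Qed.

Lemma powR_natSD (R : realType) (n : nat) (r s : R) :
  n.+1%:R `^ (r + s) = n.+1%:R `^ r * n.+1%:R `^ s.
Proof. by rewrite powRD // pnatr_eq0 implybT. Qed.

Lemma powR_natSB (R : realType) (n : nat) (r s : R) :
  n.+1%:R `^ (r - s) = n.+1%:R `^ r / n.+1%:R `^ s.
Proof. by rewrite powRB // pnatr_eq0 implybT. Qed.

Section PowerLawRenewal.
Variables (R : realType) (alpha : R) (mb : nat -> R).
Hypothesis alpha_gt0 : 0 < alpha.
Hypothesis alpha_lt1 : alpha < 1.
Hypothesis mb_mono : forall j k, (j <= k)%N -> mb k <= mb j.
Hypothesis mb_ge : forall k, alpha / k.+2%:R <= mb k.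
Hypothesis mb_le : forall k, mb k <= alpha / k.+1%:R.

(** In both applications [mb k] is the mean number of arcs that start in a given site or cell and
    reach the next point of the set: [alpha / k.+1] on the cycle, [alpha * ln (1 + 1 / k.+1)] on the
    circle. [rho k] is the probability of no such arc. *)
Definition hazard_ratio (k : nat) : R := expR (- mb k).
Local Notation rho := hazard_ratio.
Local Notation v := (ren_mass rho).
Local Notation f := (first_gap v).
Local Notation hb := (gap_tail v).
Local Notation E := (expR (1 : R)).

Let alpha_ge0 : 0 <= alpha. Proof. exact: ltW. Qed.

Let mb_ge0 k : 0 <= mb k.
Proof. by apply: le_trans (mb_ge k); rewrite divr_ge0. Qed.

Lemma hazard_ratio_gt0 k : 0 < rho k. Proof. exact: expR_gt0. Qed.
Lemma hazard_ratio_le1 k : rho k <= 1.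
Proof. by rewrite -[leRHS]expR0 ler_expR oppr_le0. Qed.
Lemma hazard_ratio_mono j k : (j <= k)%N -> rho j <= rho k.
Proof. by move=> jk; rewrite ler_expR lerN2 mb_mono. Qed.
Lemma hazard_ratio_ge k : 1 - alpha / k.+1%:R <= rho k.
Proof. by apply: le_trans (expR_ge1Dx _); rewrite lerD2l lerN2. Qed.
Lemma hazard_ratio_le k : rho k <= (1 + alpha / k.+2%:R)^-1.
Proof.
have a2 : 0 < 1 + alpha / k.+2%:R :> R by rewrite ltr_pwDl // divr_ge0.
rewrite /rho expRN lef_pV2 ?posrE ?expR_gt0 //.
by apply: le_trans (expR_ge1Dx _); rewrite lerD2l.
Qed.

Local Hint Resolve hazard_ratio_gt0 hazard_ratio_le1 hazard_ratio_mono
  hazard_ratio_ge hazard_ratio_le : core.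

Let hb_ge0 n : 0 <= hb n.
Proof. exact: gap_tail_ge0 hazard_ratio_gt0 hazard_ratio_le1 hazard_ratio_mono n. Qed.

Let v_gt0 n : 0 < v n. Proof. exact: ren_mass_gt0. Qed.

Local Hint Resolve hb_ge0 v_gt0 : core.

Lemma ren_mass_expR n : v n = expR (- \sum_(k < n) mb k).
Proof.
elim: n => [|n IHn]; first by rewrite ren_mass0 big_ord0 oppr0 expR0.
by rewrite ren_massS IHn -expRD big_ord_recr /= opprD.
Qed.

(** [ln (1 + y) <= y] bounds the exponent from below by a telescoping difference of logarithms
    starting at [ln 2]; the factor [2] absorbs [2 ^ alpha]. *)
Lemma ren_mass_ub n : v n <= 2 * n.+1%:R `^ (- alpha).
Proof.
have H : alpha * (ln n.+2%:R - ln 2) <= \sum_(k < n) mb k.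
  elim: n => [|n IHn]; first by rewrite big_ord0 subrr mulr0.
  rewrite big_ord_recr /=; apply: le_trans (_ : alpha * (ln n.+2%:R - ln 2)
    + alpha / n.+2%:R <= _); last by rewrite lerD.
  rewrite -mulrDr ler_wpM2l //.
  have -> : n.+3%:R = n.+2%:R * (1 + n.+2%:R^-1) :> R.
    by rewrite mulrDr mulr1 divff // natr1.
  rewrite lnM ?posrE ?addr_gt0 ?invr_gt0 //.
  have : ln (1 + n.+2%:R^-1) <= n.+2%:R^-1 :> R.
    by apply: le_ln1Dx; rewrite (lt_trans (ltrN10 _)) // invr_gt0.
  by set a := ln (1 + _); set b := _^-1; set c := ln _; lra.
apply: (@le_trans _ _ (2 * n.+2%:R `^ (- alpha))); last first.
  by rewrite ler_pM2l // powR_nat_le // oppr_le0.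
rewrite ren_mass_expR /powR gt_eqF //.
apply: le_trans (_ : expR (ln 2) * expR (- alpha * ln n.+2%:R) <= _); last first.
  by rewrite lnK ?posrE.
rewrite -expRD ler_expR.
have l2 : 0 <= ln 2 :> R by apply: ln_ge0; rewrite ler1n.
have : alpha * ln 2 <= ln 2 by rewrite ler_piMl // ltW.
by move: H; rewrite mulrBr mulNr; set a := alpha * ln _; lra.
Qed.

(** [ln (1 - y) <= - y] bounds the harmonic sum by [1 + ln]; the factor [E^-1] absorbs
    [expR (- alpha)]. The estimate is made at [n.+1], where the sum is not empty. *)
Lemma ren_mass_lb n : E^-1 * n.+1%:R `^ (- alpha) <= v n.
Proof.
have H m : \sum_(k < m.+1) mb k <= alpha * (1 + ln m.+1%:R).
  elim: m => [|m IHm].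
    by rewrite big_ord_recr big_ord0 /= add0r ln1 addr0 mulr1; have := mb_le 0; rewrite divr1.
  rewrite big_ord_recr /=; apply: le_trans (lerD IHm (mb_le m.+1)) _.
  rewrite -mulrDr ler_wpM2l //.
  have -> : m.+1%:R = m.+2%:R * (1 - m.+2%:R^-1) :> R.
    by rewrite mulrBr mulr1 divff // -[m.+2%:R]natr1 addrK.
  have i1 : m.+2%:R^-1 < 1 :> R by rewrite invf_lt1 // ltr1n.
  rewrite lnM ?posrE ?subr_gt0 //.
  have : ln (1 - m.+2%:R^-1) <= - m.+2%:R^-1 :> R.
    by apply: le_ln1Dx; rewrite ltrN2.
  by set a := ln (1 - _); set b := _^-1; set c := ln _; lra.
apply: le_trans (ren_mass_le hazard_ratio_gt0 hazard_ratio_le1 (leqnSn n)).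
rewrite ren_mass_expR /powR gt_eqF // -expRN -expRD ler_expR.
have := H n; rewrite mulrDr mulr1 mulNr; have := alpha_lt1.
by set a := alpha * ln _; set b := \sum_(k < _) _; lra.
Qed.

Lemma ren_mass_inv_ub n : (v n)^-1 <= E * n.+1%:R `^ alpha.
Proof.
have := ren_mass_lb n; rewrite powRN -invfM => le.
rewrite -[leRHS]invrK lef_pV2 ?posrE ?invr_gt0 ?mulr_gt0 ?powR_gt0 ?expR_gt0 //. 
Qed.

(** By monotonicity the partial sum of [v] is at least [n.+1 * v n], so [gap_tail_mul_sum_mass]
    yields the inverse of this quantity as a bound. *)
Lemma gap_tail_ub n : hb n <= E * n.+1%:R `^ (alpha - 1).
Proof.
have := gap_tail_mul_sum_mass hazard_ratio_gt0 hazard_ratio_mono n.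
have : n.+1%:R * v n <= \sum_(k < n.+1) v k.
  rewrite mulr_natl -[n.+1 in leLHS]card_ord -sumr_const; apply: ler_sum => k _.
  by apply: ren_mass_le => //; exact: leq_ord.
have vn := ren_mass_gt0 hazard_ratio_gt0 n => le1 le2.
have n0 : 0 < n.+1%:R :> R by [].
have le3 : hb n <= (n.+1%:R * v n)^-1.
  rewrite -[leRHS]mul1r ler_pdivlMr ?mulr_gt0 //; apply: le_trans le2.
  by rewrite ler_wpM2l // hb_ge0.
apply: le_trans le3 _; rewrite invfM mulrC.
apply: le_trans (ler_wpM2r _ (ren_mass_inv_ub n)) _; first by rewrite invr_ge0.
rewrite -mulrA; apply: ler_wpM2l; first exact/ltW/expR_gt0.
by rewrite powR_natSB powRr1.
Qed.

Lemma sum_gap_tail_ub K : \sum_(k < K) hb k <= E * K.+1%:R `^ alpha.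
Proof.
apply: le_trans (ren_mass_inv_ub K).
have := mass_mul_sum_tail hazard_ratio_gt0 hazard_ratio_le1 hazard_ratio_mono K.
rewrite mulrC -ler_pdivlMr ?v_gt0 // div1r; apply: le_trans.
by rewrite big_ord_recr /= lerDl hb_ge0.
Qed.

(** The two terms of [drift_conv_le]: [8 / alpha] times the constant of [gap_tail_ub], and the [2]
    of [drift_le]. *)
Definition drift_const : R := 8 / alpha * E + 2.
Local Notation C := drift_const.

Lemma drift_const_ge0 : 0 <= C.
Proof. by rewrite addr_ge0 // mulr_ge0 ?expR_ge0 // divr_ge0. Qed.

Lemma drift_conv_ub n : drift_conv rho alpha n <= C * n./2.+1%:R `^ (alpha - 1).
Proof.
(* Cutting at the upper half gives [k <= m], so that [v m / v k <= 1] in the second term, which is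
   then at most [2 / k.+1]. *)
have -> : n = (uphalf n + n./2)%N by lia.
set k := n./2; set m := uphalf n.
have km : (k <= m)%N by rewrite /k /m uphalf_half leq_addl.
have -> : (m + k)./2 = k by rewrite /m /k; lia.
apply: le_trans (drift_conv_le hazard_ratio_gt0 hazard_ratio_le1 hazard_ratio_mono
  alpha_gt0 alpha_lt1 hazard_ratio_ge hazard_ratio_le m k) _.
set p := _ `^ (alpha - 1).
have -> : C * p = 8 / alpha * (E * p) + 2 * p by rewrite [LHS]mulrDl -(mulrA _ E).
apply: lerD.
  by rewrite ler_wpM2l ?divr_ge0 // gap_tail_ub.
have vk := ren_mass_gt0 hazard_ratio_gt0 k.
rewrite -mulrA ler_pM2l // ler_pdivrMr ?mulr_gt0 //.
apply: le_trans (_ : v k <= _); first exact: ren_mass_le.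
rewrite mulrA; apply: ler_peMl; first exact: ltW.
have k0 : 0 < k.+1%:R :> R by [].
apply: le_trans (_ : k.+1%:R `^ (alpha - 1) * k.+1%:R <= _); last first.
  by rewrite ler_wpM2l ?powR_ge0 // ler_nat.
rewrite -{2}[k.+1%:R]powRr1 // -powR_natSD subrK.
rewrite -[leLHS](powRr0 k.+1%:R); apply: ler_powR; rewrite ?ler1n //.
Qed.

Lemma cvg_half_powR (x : R) : x < 0 -> (n./2.+1%:R : R) `^ x @[n --> \oo] --> (0 : R).
Proof.
move=> x0; apply: (@cvg_comp _ _ _ half (fun n => (n.+1%:R : R) `^ x) _ \oo).
  move=> A [N _ NA]; exists N.*2 => // k /= Nk; apply: NA => /=.
  by rewrite -[N]doubleK half_leq.
exact: cvg_natSr_powRN.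
Qed.

Lemma straddle_mass_cvg : straddle_mass rho n.+1 @[n --> \oo] --> 1 - alpha.
Proof.
have b1 : alpha - 1 < 0 by rewrite subr_lt0.
rewrite -[X in _ --> X]addr0.
under eq_fun do rewrite (straddle_massE _ alpha).
apply: cvgD; first exact: cvg_cst.
rewrite (cvg_shiftS (drift_conv rho alpha)).
apply: (@cvgr0_le _ _ (fun n => C * n./2.+1%:R `^ (alpha - 1))).
- by move=> n; exact: (drift_conv_ge0 hazard_ratio_gt0 hazard_ratio_le1
    hazard_ratio_mono hazard_ratio_ge).
- by apply: nearW => n; exact: drift_conv_ub.
- by rewrite -(mulr0 C); apply: cvgMr; exact: cvg_half_powR.
Qed.

(** A bound uniform over all gaps longer than [K]: it serves as the [B] of [wsum_small_le]. *)
Lemma gap_length_ub K k : (K <= k)%N ->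
  k.+1%:R * f k <= (E + C) * K./2.+1%:R `^ (alpha - 1).
Proof.
have b1 : alpha - 1 <= 0 by rewrite subr_le0 ltW.
move=> Kk; apply: le_trans (gap_length_le hazard_ratio_gt0 hazard_ratio_le1
  hazard_ratio_mono hazard_ratio_ge k) _.
rewrite [leRHS]mulrDl; apply: lerD.
  apply: le_trans (_ : hb k <= _).
    by rewrite ler_piMl ?hb_ge0 // gerBl.
  apply: le_trans (gap_tail_ub k) _.
  rewrite ler_wpM2l ?expR_ge0 // powR_nat_le // (leq_trans _ Kk) //.
  by rewrite -{2}[K]odd_double_half -addnn addnA leq_addl.
apply: le_trans (drift_conv_ub _) _.
by rewrite ler_wpM2l ?drift_const_ge0 // powR_nat_le // half_leq // leqW.
Qed.

Variable w : forall N, {set 'I_N.+1} -> R.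
Hypothesis w_ge0 : forall N (S : {set 'I_N.+1}), 0 <= w S.
Hypothesis renewal_law : forall N (a : nat) (Q : pred nat),
  wsum (@w N) (fun S => (site S a 0 && contains Q S a 0)%:R)
  = \prod_(0 <= x < N.+1) rho (next_gap N.+1 Q x).

Lemma nonempty_weight_cvg :
  \sum_(S : {set 'I_N.+1} | S != finset.set0) w S @[N --> \oo] --> 1 - alpha.
Proof.
under eq_fun do rewrite (wsum_nonempty (@renewal_law _)).
exact: straddle_mass_cvg.
Qed.

Lemma large_weight_cvg0 (x : R) : 1 - alpha < x ->
  \sum_(S : {set 'I_N.+1} | N.+1%:R `^ x < #|S|%:R) w S @[N --> \oo] --> (0 : R).
Proof.
move=> xa; apply: (@cvgr0_le _ _ (fun N => 2 * N.+1%:R `^ (1 - alpha - x))).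
- by move=> N; apply: sumr_ge0.
- apply: nearW => N; have n0 : 0 < N.+1%:R :> R by [].
  have nx : 0 < (N.+1%:R : R) `^ x by rewrite powR_gt0.
  apply: le_trans (_ : N.+1%:R * v N.+1 / N.+1%:R `^ x <= _).
    rewrite -(wsum_card (@renewal_law N)) ler_pdivlMr // mulr_suml /wsum.
    rewrite [leRHS](bigID (fun S : {set 'I_N.+1} => N.+1%:R `^ x < #|S|%:R :> R)) /=.
    apply: ler_wpDr; first by apply: sumr_ge0 => S _; rewrite mulr_ge0.
    by apply: ler_sum => S /ltW xS; rewrite ler_wpM2l.
  rewrite !powR_natSB powRr1 // mulrA ler_pM2r ?invr_gt0 //.
  rewrite mulrCA ler_pM2l // -powRN.
  apply: le_trans (ren_mass_ub _) _; rewrite ler_pM2l //.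
  by rewrite powR_nat_le // oppr_le0.
- rewrite -(mulr0 2); apply: cvgMr; apply: cvg_natSr_powRN; by rewrite subr_lt0.
Qed.

Lemma small_weight_cvg0 (x : R) : 0 <= x -> x < 1 - alpha ->
  \sum_(S : {set 'I_N.+1} | (0 < #|S|)%N && (#|S|%:R <= N.+1%:R `^ x :> R)) w S
    @[N --> \oo] --> (0 : R).
Proof.
move=> x0 xb; have a1 := alpha_lt1; have a0 := alpha_gt0.
set b := 1 - alpha in xb; have b0 : 0 < b by rewrite subr_gt0.
(* The gap length is cut at [n ^ kap]. Short gaps contribute [n ^ ((kap - 1) * alpha)] and long ones
   [n ^ (x - kap * b)], so [kap] must lie strictly between [x / b] and [1]; the midpoint is
   taken. *)
pose kap := (1 + x / b) / 2.
have xb1 : x / b < 1 by rewrite ltr_pdivrMr // mul1r.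
have xb0 : 0 <= x / b by rewrite divr_ge0 // ltW.
have k0 : 0 < kap by rewrite /kap; lra.
have k1 : kap < 1 by rewrite /kap; lra.
have kb : x < kap * b.
  have -> : kap * b = (b + x) / 2 by rewrite /kap; field; exact: lt0r_neq0.
  by lra.
(* [8 = 4 * 2]: [4] from [v (n - K)] with [n - K >= n / 2], and [2] from [K.+1 <= 2 * n ^ kap]. The
   second [2] comes from [K./2.+1 >= n ^ kap / 2]. *)
pose bnd N : R := 8 * E * N.+1%:R `^ ((kap - 1) * alpha) +
               2 * (E + C) * N.+1%:R `^ (x - kap * b).
have C0 := drift_const_ge0; have E0 : 0 < E := expR_gt0 1.
apply: (@cvgr0_le _ _ bnd).
- by move=> N; apply: sumr_ge0.
- near=> N; have n1 : 1 <= N.+1%:R :> R by rewrite ler1n.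
  have n0 : 0 < N.+1%:R :> R by [].
  have nk1 : 1 <= (N.+1%:R : R) `^ kap.
    rewrite -[leLHS](powRr0 N.+1%:R); apply: ler_powR => //; exact: ltW.
  have half : N.+1%:R `^ kap <= N.+1%:R / 2 :> R.
    have : N.+1%:R `^ (kap - 1) <= 2^-1 :> R.
      near: N; have /cvgr0Pnorm_le/(_ 2^-1) : (n.+1%:R : R) `^ (kap - 1) @[n --> \oo] --> (0 : R).
        by apply: cvg_natSr_powRN; rewrite subr_lt0.
      rewrite invr_gt0 => /(_ (ltr0n R 2)); apply: filterS => N.
      by rewrite ger0_norm ?powR_ge0.
    rewrite powR_natSB powRr1 // ler_pdivrMr // mulrC.
    by rewrite mulrC.
  pose K := Num.truncn ((N.+1%:R : R) `^ kap); pose m := Num.truncn ((N.+1%:R : R) `^ x).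
  have /andP[K1 K2] : (K%:R : R) <= N.+1%:R `^ kap < K.+1%:R.
    by apply: truncn_itv; rewrite powR_ge0.
  have /andP[m1 m2] : (m%:R : R) <= N.+1%:R `^ x < m.+1%:R.
    by apply: truncn_itv; rewrite powR_ge0.
  have Kn2 : K%:R <= N.+1%:R / 2 :> R := le_trans K1 half.
  have Kn : (K <= N.+1)%N.
    by rewrite -(ler_nat R); apply: le_trans Kn2 _; lra.
  apply: le_trans (_ : \sum_(S : {set 'I_N.+1} | (0 < #|S| <= m)%N) w S <= _).
    rewrite [leRHS](bigID (fun S : {set 'I_N.+1} => #|S|%:R <= N.+1%:R `^ x :> R)) /=.
    apply: ler_wpDr; first exact: sumr_ge0.
    rewrite le_eqVlt; apply/orP; left; apply/eqP/eq_bigl => S; rewrite -!andbA; congr (_ && _).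
    apply/idP/andP => [h|[]//]; split => //.
    by rewrite -ltnS -(ltr_nat R); apply: le_lt_trans h m2.
  apply: le_trans (@wsum_small_le _ _ hazard_ratio_gt0 hazard_ratio_le1 hazard_ratio_mono
    N _ (@w_ge0 N) (@renewal_law N) m _ _ Kn (@gap_length_ub K)) _.
  rewrite /bnd; apply: lerD.
    have vle : v (N.+1 - K) <= 4 * N.+1%:R `^ (- alpha).
      apply: le_trans (ren_mass_ub _) _.
      have -> : 4 = 2 * 2 :> R by rewrite -natrM.
      rewrite -mulrA ler_pM2l //.
      have le1 : N.+1%:R / 2 <= (N.+1 - K).+1%:R :> R.
        by rewrite -[leRHS]natr1 natrB //; lra.
      apply: (@le_trans _ _ ((N.+1%:R / 2) `^ (- alpha))).
        rewrite !powRN lef_pV2 ?posrE ?powR_gt0 ?divr_gt0 //.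
        by apply: ge0_ler_powR => //; rewrite nnegrE // divr_ge0.
      rewrite powRM // ?invr_ge0 // mulrC ler_wpM2r ?powR_ge0 //.
      rewrite -(powR_inv1 (ler0n _ _)) -powRrM mulN1r opprK.
      by rewrite -[leRHS]powRr1 //; apply: ler_powR; [rewrite ler1n|exact: ltW].
    have hle : \sum_(k < K) hb k <= 2 * E * N.+1%:R `^ (kap * alpha).
      apply: le_trans (sum_gap_tail_ub K) _.
      rewrite (mulrC 2) -mulrA ler_pM2l //.
      rewrite powRrM.
      apply: (@le_trans _ _ ((2 * N.+1%:R `^ kap) `^ alpha)).
        apply: ge0_ler_powR => //; rewrite ?nnegrE ?mulr_ge0 ?powR_ge0 //.
        by rewrite -natr1; lra.
      rewrite powRM ?powR_ge0 // ler_wpM2r ?powR_ge0 //.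
      by rewrite -[leRHS]powRr1 //; apply: ler_powR; [rewrite ler1n|exact: ltW].
    apply: le_trans (ler_pM _ _ vle hle) _.
    - exact: ren_mass_ge0.
    - by apply: sumr_ge0 => k _; exact: hb_ge0.
    rewrite mulrBl mul1r addrC powR_natSD.
    by set p := _ `^ _; set q := _ `^ _; lra.
  apply: le_trans (_ : N.+1%:R `^ x * ((E + C) * (2 * N.+1%:R `^ (- (kap * b)))) <= _).
    apply: ler_pM => //; first by rewrite mulr_ge0 ?powR_ge0 // addr_ge0 // ltW.
    rewrite (ler_wpM2l (addr_ge0 (ltW E0) C0)) //.
    have le1 : N.+1%:R `^ kap / 2 <= K./2.+1%:R :> R.
      rewrite ler_pdivrMr //; apply: le_trans (ltW K2) _.
      by rewrite -natrM ler_nat muln2 doubleS ltnS -{1}[K]odd_double_half; case: odd.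
    have -> : alpha - 1 = - b by rewrite /b opprB.
    apply: (@le_trans _ _ ((N.+1%:R `^ kap / 2) `^ (- b))).
      rewrite !(powRN _ b) lef_pV2 ?posrE ?powR_gt0 ?divr_gt0 ?powR_gt0 //.
      apply: ge0_ler_powR => //; rewrite ?nnegrE ?divr_ge0 ?powR_ge0 //; exact: ltW.
    rewrite powRM ?powR_ge0 ?invr_ge0 // -powRrM mulrN mulrC ler_wpM2r ?powR_ge0 //.
    rewrite -(powR_inv1 (ler0n _ _)) -powRrM mulN1r opprK.
    by rewrite -[leRHS]powRr1 //; apply: ler_powR; [rewrite ler1n|rewrite /b; lra].
  rewrite powR_natSD.
  by set p := _ `^ _; set q := _ `^ _; lra.
- rewrite -[X in _ --> X]addr0; apply: cvgD.
    rewrite -(mulr0 (8 * E)); apply: cvgMr; apply: cvg_natSr_powRN; nra.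
  rewrite -(mulr0 (2 * (E + C))); apply: cvgMr; apply: cvg_natSr_powRN; lra.
Unshelve. all: by end_near. Qed.

End PowerLawRenewal.

(** * Independence and uniqueness of measures *)

Section IndependentPair.
Context d d1 d2 (T : measurableType d) (T1 : measurableType d1)
  (T2 : measurableType d2) (R : realType) (P : probability T R).
Variables (F : set T) (X : T -> T1) (Y : T -> T2).
Hypotheses (mF : measurable F) (mX : measurable_fun setT X)
  (mY : measurable_fun setT Y).

Let XY w := (X w, Y w).
Let mXY : measurable_fun setT XY.
Proof. exact: measurable_fun_pair. Qed.

(** [X] and [Y] may depend on each other; only [F] is independent of the pair. Both sides are finite
    measures in [D] that agree on rectangles, a generating family stable under intersection. *)
Lemma indep_pair_event :
  (forall A B, measurable A -> measurable B ->
     P (F `&` (X @^-1` A `&` Y @^-1` B)) = (P F * P (X @^-1` A `&` Y @^-1` B))%E) ->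
  forall D : set (T1 * T2), measurable D ->
    P (F `&` [set w | D (X w, Y w)]) = (P F * P [set w | D (X w, Y w)])%E.
Proof.
move=> H D mD.
have PF : P F = (fine (P F))%:E by rewrite fineK // fin_num_measure.
have PF0 : 0 <= fine (P F) by rewrite fine_ge0.
pose r : {nonneg R} := NngNum PF0.
pose C : set (set (T1 * T2)) := [set A `*` B | A in measurable & B in measurable].
pose m1' : {measure set (T1 * T2) -> \bar R} := pushforward (mrestr P mF) XY.
pose m2' : {measure set (T1 * T2) -> \bar R} := pushforward P XY.
pose m1 := m1' mXY.
pose m2 : {measure set (T1 * T2) -> \bar R} := mscale r (m2' mXY).
have E1 A : m1 A = P (F `&` [set w | A (X w, Y w)]) by rewrite setIC.
have E2 A : m2 A = (P F * P [set w | A (X w, Y w)])%E by rewrite PF.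
rewrite -E1 -E2; apply: (measure_unique C (fun=> setT)) => //.
- exact: measurable_prod_measurableType.
- move=> _ _ [A1 mA1 [B1 mB1 <-]] [A2 mA2 [B2 mB2 <-]].
  exists (A1 `&` A2); first exact: measurableI.
  by exists (B1 `&` B2); [exact: measurableI|rewrite setXI].
- by move=> _; exists setT => //; exists setT => //; rewrite setXTT.
- by rewrite bigcup_const.
- by move=> _ [A mA [B mB <-]]; rewrite E1 E2; exact: H.
- move=> _; rewrite E1; apply: (@le_lt_trans _ _ (P setT)).
    apply: le_measure; rewrite ?inE //.
    by rewrite (_ : [set _ | _] = setT) ?setIT //; apply/seteqP; split.
  by rewrite probability_setT ltry.
Qed.

End IndependentPair.

Lemma measure_tail_unique (R : realType) (m1 m2 : {measure set R -> \bar R}) :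
  (forall t : R, m1 [set` `]t, +oo[] = m2 [set` `]t, +oo[]) ->
  (m1 setT < +oo)%E ->
  forall A : set R, measurable A -> m1 A = m2 A.
Proof.
move=> m12 m1T A mA.
apply: (measure_unique (@measurable_realfun.RGenOInfty.G R)
  (fun k => [set` `](- k%:R), +oo[])) => //.
- exact: measurable_realfun.RGenOInfty.measurableE.
- move=> _ _ [x ->] [y ->]; exists (Num.max x y).
  apply/seteqP; split => z /=; rewrite !in_itv /= !andbT gt_max.
    by case=> -> ->.
  by case/andP.
- by move=> k; exists (- k%:R).
- rewrite -subTset => x _; exists (Num.truncn `|x|).+1 => //=.
  rewrite in_itv /= andbT ltrNl (le_lt_trans (ler_norm _)) // normrN truncnS_gt //.
- by move=> _ [x ->].
- move=> k; apply: le_lt_trans m1T; apply: le_measure; rewrite ?inE //.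
Qed.

Lemma FTC2_is_derive (R : realType) (f F : R -> R) (a b : R) : a < b ->
  (forall x, a <= x <= b -> is_derive x 1 F (f x)) ->
  (forall x, a <= x <= b -> {for x, continuous f}) ->
  (\int[lebesgue_measure]_(x in `[a, b]) (f x)%:E = (F b)%:E - (F a)%:E)%E.
Proof.
move=> ab dF cf.
have cF x : a <= x <= b -> {for x, continuous F}.
  by move=> /dF [dx _]; apply: differentiable_continuous; apply/derivable1_diffP.
apply: continuous_FTC2 => //.
- apply: continuous_in_subspaceT => x; rewrite inE /= in_itv /=; exact: cf.
- split.
  + by move=> x; rewrite in_itv /= => /andP[ax xb]; case: (dF x); rewrite ?ltW.
  + by apply: cvg_at_right_filter; apply: cF; rewrite lexx ltW.
  + by apply: cvg_at_left_filter; apply: cF; rewrite lexx ltW.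
- move=> x; rewrite in_itv /= => /andP[ax xb].
  by rewrite derive1E; case: (dF x) => [|_ ->]; rewrite ?ltW.
Qed.

(** * Gamma tails *)

(** Survival function of the sum of [m.+1] independent exponential variables, the Gamma law of shape
    [m.+1]. For [t >= 0] it is also the probability that a Poisson variable of mean [t] is at most
    [m]. *)
Definition gamma_tail (R : realType) (m : nat) (t : R) : R :=
  if t < 0 then 1 else expR (- t) * \sum_(j < m.+1) t ^+ j / j`!%:R.

(** Minus the logarithm of a uniform variable is exponential. Integrals against the law become
    Lebesgue integrals over the unit interval. *)
Lemma integral_exp_law (R : realType) (nu : probability R R) (f : _ -> \bar R) :
  (forall t : R, 0 <= t -> nu [set` `]t, +oo[] = (expR (- t))%:E) ->
  measurable_fun [set: R] f -> (forall x, 0 <= f x)%E ->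
  (\int[nu]_x f x = \int[lebesgue_measure]_(u in `[0%R, 1%R]) f (- ln u)%R)%E.
Proof.
move=> nuE mf f0.
have mln : measurable_fun setT (fun u : R => - ln u).
  by apply: measurableT_comp => //; exact: measurable_ln.
have mpre A : measurable A -> measurable ((fun u : R => - ln u) @^-1` A).
  by move=> mA; rewrite -[X in measurable X]setTI; exact: mln.
have mfln : measurable_fun setT (fun u : R => f (- ln u)).
  exact: measurableT_comp.
pose U := @uniform_prob R 0 1 ltr01.
have UE A : measurable A -> U A = lebesgue_measure (A `&` `[0, 1]).
  move=> mA; transitivity (\int[uniform_prob (@ltr01 R)]_x (\1_A x)%:E)%E.
    by rewrite integral_indic // setIT.
  rewrite integral_uniform ?subr0 ?invr1 ?mul1e ?integral_indic //.
  exact/measurable_EFinP/measurable_indic.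
pose V' : {measure set R -> \bar R} := pushforward U (fun u : R => - ln u).
pose V := V' mln.
have nuV A : measurable A -> nu A = V A.
  apply: measure_tail_unique; last first.
    exact: le_lt_trans (probability_le1 nu measurableT) (ltry 1).
  move=> t; transitivity (U ((fun u : R => - ln u) @^-1` [set` `]t, +oo[])); last by [].
  rewrite UE; last first.
    by apply: mpre; exact: measurable_itv.
  have [t0|t0] := leP 0 t.
    apply: etrans (nuE t t0) _.
    rewrite (_ : _ `&` _ = [set` `]0, (expR (- t))[]).
      by rewrite lebesgue_measure_itv /= lte_fin expR_gt0 sube0.
    apply/seteqP; split => u /=; rewrite !in_itv /= andbT.
      (* At [u = 0] the default [ln 0 = 0] gives the value [0], which does not exceed [t >= 0]. *)
      move=> [tu /andP[]]; rewrite le_eqVlt => /orP[/eqP u0|u0] u1.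
        by move: tu; rewrite -u0 ln0 // oppr0 ltNge t0.
      by rewrite u0 -[u]lnK ?posrE // ltr_expR ltrNr.
    move=> /andP[u0 ut]; rewrite ltrNr -ltr_expR lnK ?posrE // ut (ltW u0).
    split => //; apply: (le_trans (ltW ut)).
    by rewrite -[leRHS]expR0 ler_expR oppr_le0.
  rewrite (_ : _ `&` _ = [set` `[0, 1]]).
    rewrite lebesgue_measure_itv /= lte_fin ltr01 sube0.
    apply/eqP; rewrite eq_le probability_le1 //=.
    rewrite -expR0 -oppr0 -nuE //.
    apply: le_measure; rewrite ?inE // => x /=; rewrite !in_itv /= !andbT.
    exact: lt_trans.
  apply/seteqP; split => u /=; first by case.
  rewrite !in_itv /= andbT => /andP[u0 u1]; split; last by rewrite u0.
  by apply: lt_le_trans t0 _; rewrite oppr_ge0 ln_le0.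
transitivity (\int[V]_x f x)%E; first by apply: eq_measure_integral => A mA _; exact: nuV.
rewrite ge0_integral_pushforward // preimage_setT.
by rewrite integral_uniform /= ?subr0 ?invr1 ?mul1e.
Qed.

(** For [u < expR (- t)] the argument is negative and the integrand is [1]; this part yields the
    term of index [0]. The rest is integrated explicitly and yields the terms of index [1] to
    [m.+1]. *)
Lemma integral_gamma_tail (R : realType) (m : nat) (t : R) :
  measurable_fun setT (fun u : R => (gamma_tail m (t + ln u))%:E) ->
  (\int[lebesgue_measure]_(u in `[0%R, 1%R]) (gamma_tail m (t + ln u))%:E
   = (gamma_tail m.+1 t)%:E)%E.
Proof.
move=> mg; set g := fun u : R => _ in mg *.
have mgS D : measurable_fun D g by exact: measurable_funTS.
have g0 u : (0 <= g u)%E.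
  rewrite lee_fin /gamma_tail; case: ifPn => // ; rewrite -leNgt => h.
  by rewrite mulr_ge0 ?expR_ge0 // sumr_ge0 // => j _; rewrite divr_ge0 ?exprn_ge0.
have g1 u : 0 < u -> u < expR (- t) -> g u = 1%E.
  move=> u0 ut; rewrite /g /gamma_tail ifT //.
  by rewrite addrC -ltrBrDr sub0r -ltr_expR lnK ?posrE.
rewrite -integral_itv_obnd_cbnd //.
have [t0|t0] := leP t 0.
  rewrite -integral_itv_bndo_bndc // (eq_integral (cst 1%E)); last first.
    move=> u; rewrite inE /= in_itv /= => /andP[u0 u1]; apply: g1 => //.
    by apply: lt_le_trans u1 _; rewrite -[leLHS]expR0 ler_expR oppr_ge0.
  rewrite integral_cst // mul1e /= lebesgue_measure_itv /= lte_fin ltr01 sube0.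
  rewrite /gamma_tail; case: ltP => // t0'.
  have -> : t = 0 by apply/eqP; rewrite eq_le t0.
  rewrite oppr0 expR0 mul1r big_ord_recl big1 ?addr0 /= ?divr1 // => i _.
  by rewrite expr0n mul0r.
have c0 : 0 < expR (- t) := expR_gt0 _.
have c1 : expR (- t) < 1 by rewrite -[ltRHS]expR0 ltr_expR oppr_lt0.
rewrite (_ : [set` `]0, 1]] = [set` `]0, (expR (- t))[] `|` [set` `[(expR (- t)), 1]]); last first.
  by rewrite -itv_bndbnd_setU //= bnd_simp // ltW.
rewrite ge0_integral_setU //=; last 3 first.
- exact: mgS.
- by move=> u _; exact: g0.
- apply/disj_setPS => u [] /=; rewrite !in_itv /= => /andP[_ h] /andP[h' _].
  by move: h; rewrite ltNge h'.
rewrite (eq_integral (cst 1%E)); last first.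
  by move=> u; rewrite inE /= in_itv /= => /andP[u0 u1]; apply: g1.
rewrite integral_cst // mul1e /= lebesgue_measure_itv /= lte_fin c0 sube0.
(* [p] is the primitive, null at [0], of the truncated exponential series. The factor
   [expR (- ln u) = u^-1] of the integrand is the derivative of [ln], so [F] is a primitive. *)
pose p : {poly R} := \sum_(j < m.+1) (j.+1`!%:R^-1) *: 'X^(j.+1).
pose F (u : R) : R := expR (- t) * p.[t + ln u].
pose f (u : R) : R := expR (- t) * (p^`().[t + ln u] * u^-1).
have dF (u : R) : 0 < u -> is_derive u 1 F (f u).
  move=> u0; apply: is_deriveZ; apply: is_derive1_comp.
  have := is_derive1_ln u0 => h.
  by rewrite -[u^-1]add0r; apply: is_deriveD.
have pE (x : R) : p^`().[x] = \sum_(j < m.+1) x ^+ j / j`!%:R.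
  rewrite /p raddf_sum horner_sum; apply: eq_bigr => j _ /=.
  rewrite derivZ derivXn hornerZ hornerMn hornerXn /= factS natrM invfM.
  have j1 : j.+1%:R != 0 :> R by rewrite pnatr_eq0.
  have jf : j`!%:R != 0 :> R by rewrite pnatr_eq0 -lt0n fact_gt0.
  move: (x ^+ j) => y; rewrite -[y *+ _]mulr_natr.
  move: (j.+1%:R) (j`!%:R) j1 jf => c c' c0' c0''.
  by field; rewrite c0' c0''.
transitivity ((expR (- t))%:E + \int[lebesgue_measure]_(x in `[expR (- t), 1%R]) (f x)%:E)%E.
  congr (_ + _)%E; apply: eq_integral => u; rewrite inE /= in_itv /= => /andP[u0 u1]; congr EFin.
  have u00 : 0 < u := lt_le_trans c0 u0.
  rewrite /gamma_tail ifF; last first.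
    by apply/negbTE; rewrite -leNgt -lerBlDl sub0r -ler_expR lnK ?posrE.
  rewrite /f pE opprD expRD expRN [expR (- ln u)]expRN lnK ?posrE // -mulrA.
  by rewrite -expRN [_ * u^-1]mulrC.
have dF' u : expR (- t) <= u <= 1 -> is_derive u 1 F (f u).
  by move=> /andP[u0 _]; apply: dF; exact: lt_le_trans c0 u0.
have cf u : expR (- t) <= u <= 1 -> {for u, continuous f}.
  move=> /andP[u0 _]; have u00 : 0 < u := lt_le_trans c0 u0.
  apply: cvgMr; apply: cvgM; last by apply: cvgV; rewrite ?gt_eqF.
  apply: (@continuous_comp _ _ _ (fun x : R => t + ln x) (horner p^`())); last first.
    exact: continuous_horner.
  by apply: cvgD; [exact: cvg_cst|exact: continuous_ln].
rewrite (FTC2_is_derive c1 dF' cf).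
rewrite -EFinB -EFinD; congr EFin.
rewrite /F ln1 addr0 expRK subrr /gamma_tail ltNge (ltW t0) /=.
rewrite -mulrBr -{1}[expR (- t)]mulr1 -mulrDr; congr (_ * _).
rewrite big_ord_recl /= expr0 fact0 divr1; congr (_ + _).
rewrite /p !horner_sum -sumrB; apply: eq_bigr => j _.
by rewrite !hornerZ !hornerXn expr0n mulr0 subr0 mulrC.
Qed.

Section AddExponential.
Context d (T : measurableType d) (R : realType) (P : probability T R).
Variables (E X : T -> R) (m : nat).
Hypotheses (mE : measurable_fun setT E) (mX : measurable_fun setT X).
Hypothesis E_exp : forall t : R, 0 <= t -> P [set w | t < E w] = (expR (- t))%:E.
Hypothesis X_gamma : forall t : R, P [set w | t < X w] = (gamma_tail m t)%:E.
Hypothesis EX_indep : forall A B : set R, measurable A -> measurable B ->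
  P (E @^-1` A `&` X @^-1` B) = (P (E @^-1` A) * P (X @^-1` B))%E.

(** By independence the joint law is the product of the two laws; its sections at [E = x] have mass
    [gamma_tail m (t - x)], which is then integrated against the exponential law. *)
Lemma gamma_tail_add (t : R) :
  P [set w | t < E w + X w] = (gamma_tail m.+1 t)%:E.
Proof.
pose mfE : {mfun T >-> R} := HB.pack E (isMeasurableFun.Build _ _ _ _ E mE).
pose mfX : {mfun T >-> R} := HB.pack X (isMeasurableFun.Build _ _ _ _ X mX).
pose nu : probability R R := distribution P mfE.
pose ga : probability R R := distribution P mfX.
pose EX w := (E w, X w).
have mEX : measurable_fun setT EX by exact: measurable_fun_pair.
pose m' : {measure set (R * R) -> \bar R} := pushforward P EX.
pose D : set (R * R) := [set z | t < z.1 + z.2].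
have mD : measurable D.
  have : measurable_fun setT (fun z : R * R => z.1 + z.2).
    by apply: measurable_funD; [exact: measurable_fst|exact: measurable_snd].
  move=> /(_ measurableT [set` `]t, +oo[] (measurable_itv _)); rewrite setTI.
  by congr measurable; apply/seteqP; split => z /=; rewrite in_itv /= andbT.
have -> : P [set w | t < E w + X w] = m' mEX D by [].
rewrite -(@product_measure_unique _ _ _ _ _ nu ga (m' mEX)) //.
rewrite /product_measure1.
have sec (x : R) : ga (xsection D x) = (gamma_tail m (t - x))%:E.
  rewrite -X_gamma; congr (P _); apply/seteqP; split => w /=.
    by rewrite /xsection /= inE /= ltrBlDl.
  by rewrite /xsection /= inE /= ltrBlDl.
under eq_integral do rewrite /= sec.
have msec : measurable_fun [set: R] (fun x : R => (gamma_tail m (t - x))%:E).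
  apply: (eq_measurable_fun (ga \o xsection D)) => [x _|]; first exact: sec.
  exact: measurable_fun_xsection.
have gt0 (u : R) : (0 <= (gamma_tail m u)%:E)%E by rewrite -X_gamma.
rewrite integral_exp_law //.
  under eq_integral do rewrite opprK.
  apply: integral_gamma_tail.
  apply: (eq_measurable_fun (fun u : R => (gamma_tail m (t - (- ln u)))%:E)) => [u _|].
    by rewrite opprK.
  by apply: (measurableT_comp msec); apply: measurableT_comp.
by move=> s s0; rewrite -E_exp //; congr (P _); apply/seteqP; split => w /=;
  rewrite in_itv /= andbT.
Qed.

End AddExponential.

(** * Arcs of the covering model *)

Section IndepExtend.
Context d (T : measurableType d) (R : realType) (P : probability T R).

Definition indep_slots (m : nat) (S : nat -> set (set T)) : Prop :=
  forall A : nat -> set T, (forall k, (k < m)%N -> S k (A k)) ->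
    P (\bigcap_(k < m) A k) = (\prod_(k < m) P (A k))%E.

Lemma bigcap_mkord_upd m (A : nat -> set T) (B : set T) j : (j < m)%N ->
  \bigcap_(k < m) (if k == j then B else A k) =
  \bigcap_(k < m) (if k == j then setT else A k) `&` B.
Proof.
move=> jm; apply/seteqP; split => [w H|w [H Bw] k km].
  split; last by have := H j jm; rewrite eqxx.
  by move=> k km; have := H k km; case: eqP.
by have := H k km; case: eqP.
Qed.

Lemma prode_upd m (A : nat -> set T) (B : set T) j : (j < m)%N ->
  (\prod_(k < m) P (if k == j :> nat then B else A k))%E =
  (P B * \prod_(k < m) P (if k == j :> nat then setT else A k))%E.
Proof.
move=> jm; rewrite (bigD1 (Ordinal jm)) //= eqxx; congr (_ * _)%E.
rewrite [RHS](bigD1 (Ordinal jm)) //= eqxx probability_setT mul1e.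
by apply: eq_bigr => k; rewrite -val_eqE /= => /negbTE ->.
Qed.

(* The classes are enlarged one slot at a time, the product of the other slots
   playing the role of [F]. *)
Lemma indep_slots_extend m (S S' : nat -> set (set T)) :
  (forall k A, S k A -> measurable A) -> (forall k A, S' k A -> measurable A) ->
  (forall k, S k setT) -> (forall k, S' k setT) ->
  (forall k F, measurable F ->
     (forall A, S k A -> P (F `&` A) = (P F * P A)%E) ->
     forall A, S' k A -> P (F `&` A) = (P F * P A)%E) ->
  indep_slots m S -> indep_slots m S'.
Proof.
move=> mS mS' ST S'T ext iS.
suff H j : (j <= m)%N -> indep_slots m (fun k => if (k < j)%N then S' k else S k).
  move=> A AS'; apply: (H m (leqnn _)) => k km; rewrite km; exact: AS'.
elim: j => [_|j IHj jm]; first exact: iS.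
move=> A AS; pose A' k := if k == j then setT else A k.
have mA k : (k < m)%N -> measurable (A k).
  by move=> km; have := AS k km; case: ifP => _; [exact: mS'|exact: mS].
have IH := IHj (ltnW jm).
have EA : A = fun k => if k == j then A j else A k.
  by apply/funext => k; case: eqP => // ->.
rewrite EA bigcap_mkord_upd // prode_upd // muleC.
have classA' B k : (k < m)%N -> S j B ->
    (if (k < j)%N then S' k else S k) (if k == j then B else A k).
  move=> km SB; have := AS k km; rewrite ltnS leq_eqVlt.
  by case: (eqVneq k j) => [->|kj]; rewrite /= ?ltnn.
have PF : P (\bigcap_(k < m) A' k) = (\prod_(k < m) P (A' k))%E.
  by apply: IH => k km; apply: classA'.
rewrite -PF; apply: (ext j).
- apply: bigcap_measurableType => k km.
  by rewrite /A'; case: eqP => // _; exact: mA.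
- move=> B SB; rewrite -bigcap_mkord_upd // IH => [|k km]; last exact: classA'.
  by rewrite prode_upd // PF muleC.
- by have := AS j jm; rewrite leqnn.
Qed.

End IndepExtend.

Lemma measurable_fibers d (T : measurableType d) (I : countType) (X : T -> I) :
  (forall i, measurable (X @^-1` [set i])) -> forall A, measurable (X @^-1` A).
Proof.
move=> mX A.
have -> : X @^-1` A = \bigcup_i (if i \in A then X @^-1` [set i] else set0).
  apply/seteqP; split => [w Aw|w [i _]].
    by exists (X w) => //; rewrite mem_set.
  by case: ifPn => // /set_mem Ai /= ->.
apply: countable_bigcupT_measurable; first exact: countableP.
by move=> i; case: ifP => _.
Qed.

Lemma measurable_nat2 (M : set (nat * nat)) : measurable M.
Proof.
apply: countable_measurable; last exact: countableP.
move=> [a b]; rewrite (_ : [set (a, b)] = [set a] `*` [set b]).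
  exact: measurableX.
by apply/seteqP; split => [_ -> //|[x y] /= [-> ->]].
Qed.

Section CoveringModel.
Context d (T : measurableType d) (R : realType) (P : probability T R).
Variables (N : nat) (Rad U : nat -> T -> nat) (E : nat -> T -> R).
Local Notation n := N.+1.
Hypothesis model : covering_model P n Rad U E.

Let mRad k (A : set nat) : measurable (Rad k @^-1` A).
Proof. by case: model => -[H _] _ _ _ _; exact: H. Qed.
Let mU k (A : set nat) : measurable (U k @^-1` A).
Proof. by case: model => -[_ [H _]] _ _ _ _; exact: H. Qed.
Let mE k : measurable_fun setT (E k).
Proof. by case: model => -[_ [_ H]] _ _ _ _; exact: H. Qed.

Lemma measurable_gap k (C : set R) : measurable C -> measurable (E k @^-1` C).
Proof. by move=> mC; rewrite -[X in measurable X]setTI; exact: mE. Qed.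

Lemma model_Rad k r : (1 <= r)%N -> P [set w | (r <= Rad k w)%N] = (r%:R^-1)%:E.
Proof. by case: model => _ H _ _ _; exact: H. Qed.
Lemma model_U k i : (i < n)%N -> P [set w | U k w = i] = (n%:R^-1)%:E.
Proof. by case: model => _ _ H _ _; exact: H. Qed.
Lemma model_E k (t : R) : 0 <= t -> P [set w | t < E k w] = (expR (- t))%:E.
Proof. by case: model => _ _ _ H _; exact: H. Qed.

Let model_indep (m : nat) (A B : nat -> set nat) (C : nat -> set R) :
  (forall k, measurable (C k)) ->
  P (\bigcap_(k < m) (Rad k @^-1` A k `&` U k @^-1` B k `&` E k @^-1` C k))
  = (\prod_(k < m) (P (Rad k @^-1` A k) * P (U k @^-1` B k) * P (E k @^-1` C k)))%E.
Proof. by case: model => _ _ _ _ H; exact: H. Qed.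

(** The model speaks only of initial blocks of indices, so the slots before [k] are filled with the
    full set. *)
Lemma slot_prob k (A B : set nat) (C : set R) : measurable C ->
  P (Rad k @^-1` A `&` U k @^-1` B `&` E k @^-1` C)
  = (P (Rad k @^-1` A) * P (U k @^-1` B) * P (E k @^-1` C))%E.
Proof.
move=> mC.
pose A' j := if j == k then A else setT; pose B' j := if j == k then B else setT.
pose C' j := if j == k then C else setT.
have mC' j : measurable (C' j) by rewrite /C'; case: eqP.
have := @model_indep k.+1 A' B' C' mC'.
rewrite big_ord_recr /= /A' /B' /C' eqxx big1 ?mul1e => [<-|j _]; last first.
  by rewrite ltn_eqF // !preimage_setT !probability_setT !mul1e.
congr (P _); apply/seteqP; split => w; last by move=> /(_ k (ltnSn k)) /=; rewrite eqxx.
by move=> H j /= _; case: eqP => [->|//]; rewrite ?eqxx; exact: H.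
Qed.

Definition arc (k : nat) (w : T) : nat * nat := (U k w, Rad k w).

Lemma measurable_arc k (M : set (nat * nat)) : measurable (arc k @^-1` M).
Proof.
apply: measurable_fibers => -[u r].
rewrite (_ : _ @^-1` _ = U k @^-1` [set u] `&` Rad k @^-1` [set r]).
  exact: measurableI.
by apply/seteqP; split => w /=; rewrite /arc; [case=> -> ->|case=> -> ->].
Qed.

Definition slot (M : set (nat * nat)) (C : set R) (k : nat) : set T :=
  arc k @^-1` M `&` E k @^-1` C.

Lemma measurable_slot M C k : measurable C -> measurable (slot M C k).
Proof. by move=> mC; apply: measurableI; [exact: measurable_arc|exact: measurable_gap]. Qed.

Let mUf k : measurable_fun setT (U k).
Proof. by move=> _ A _; rewrite setTI. Qed.
Let mRf k : measurable_fun setT (Rad k).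
Proof. by move=> _ A _; rewrite setTI. Qed.

Lemma slot_probM M C k : measurable C ->
  P (slot M C k) = (P (arc k @^-1` M) * P (E k @^-1` C))%E.
Proof.
move=> mC; rewrite /slot setIC [RHS]muleC.
apply: (indep_pair_event (measurable_gap k mC) (mUf k) (mRf k)); last exact: measurable_nat2.
move=> A B _ _; rewrite setIC [U k @^-1` _ `&` _]setIC slot_prob // muleC; congr (_ * _)%E.
have := @slot_prob k B A setT measurableT.
by rewrite preimage_setT setIT probability_setT mule1.
Qed.

Lemma indep_slot m (M : nat -> set (nat * nat)) (C : nat -> set R) :
  (forall k, measurable (C k)) ->
  P (\bigcap_(k < m) slot (M k) (C k) k) =
  (\prod_(k < m) (P (arc k @^-1` M k) * P (E k @^-1` C k)))%E.
Proof.
move=> mC.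
pose S k : set (set T) := [set X | exists A B D, measurable D /\
  X = Rad k @^-1` A `&` U k @^-1` B `&` E k @^-1` D].
pose S' k : set (set T) := [set X | exists M D, measurable D /\ X = slot M D k].
have iS : indep_slots P m S.
  move=> X /= SX.
  have /choice[F HF] : forall k, exists p : set nat * set nat * set R,
     measurable p.2 /\ ((k < m)%N -> X k = Rad k @^-1` p.1.1 `&` U k @^-1` p.1.2 `&` E k @^-1` p.2).
    move=> k; case: (ltnP k m) => km; last first.
      by exists (set0, set0, set0); split; [exact: measurable0|].
    by have [A [B [D [mD XE]]]] := SX k km; exists (A, B, D).
  have -> : \bigcap_(k < m) X k = \bigcap_(k < m)
    (Rad k @^-1` (F k).1.1 `&` U k @^-1` (F k).1.2 `&` E k @^-1` (F k).2).
    by apply: eq_bigcapr => k km; rewrite (HF k).2.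
  rewrite model_indep => [|k]; last exact: (HF k).1.
  by apply: eq_bigr => k _; rewrite [in RHS](HF k).2 // slot_prob //; exact: (HF k).1.
have iS' : indep_slots P m S'.
  apply: (indep_slots_extend _ _ _ _ _ iS).
  - move=> k _ [A [B [D [mD ->]]]]; apply: measurableI; last exact: measurable_gap.
    exact: measurableI.
  - by move=> k _ [M' [D [mD ->]]]; exact: measurable_slot.
  - by move=> k; exists setT, setT, setT; split => //; rewrite !preimage_setT !setIT.
  - by move=> k; exists setT, setT; split => //; rewrite /slot !preimage_setT !setIT.
  - move=> k F mF FS _ [M' [D [mD ->]]].
    have mD' := measurable_gap k mD.
    have FD : P (F `&` E k @^-1` D) = (P F * P (E k @^-1` D))%E.
      apply: FS; exists setT, setT, D; split => //.
      by rewrite !preimage_setT !setTI.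
    rewrite slot_probM // /slot (setIC (arc k @^-1` _)) setIA.
    rewrite [X in _ = (_ * X)%E]muleC muleA -FD.
    apply: (indep_pair_event (measurableI _ _ mF mD') (mUf k) (mRf k)); last exact: measurable_nat2.
    move=> A B _ _.
    have URE : P (U k @^-1` A `&` Rad k @^-1` B) = (P (Rad k @^-1` B) * P (U k @^-1` A))%E.
      have := @slot_prob k B A setT measurableT.
      by rewrite preimage_setT setIT probability_setT mule1 setIC.
    rewrite FD URE -setIA [E k @^-1` _ `&` _]setIC [U k @^-1` _ `&` _]setIC FS;
      last by exists B, A, D.
    by rewrite slot_prob // -!muleA; congr (_ * _)%E; rewrite muleA muleC.
rewrite iS'; last by move=> k km; exists (M k), (C k).
by apply: eq_bigr => k _; rewrite slot_probM.
Qed.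

End CoveringModel.

(** * Arrival times *)

Lemma probability_eq_on d (T : measurableType d) (R : realType)
  (P : probability T R) (G A B : set T) :
  measurable G -> measurable A -> measurable B -> P G = 1%E ->
  A `&` G = B `&` G -> P A = P B.
Proof.
move=> mG mA mB PG AB.
have PGC : P (~` G) = 0%E by rewrite probability_setC // PG subee.
have H X : measurable X -> P X = P (X `&` G).
  move=> mX; rewrite (measureDI P mX mG) -[RHS]add0e; congr (_ + _)%E.
  apply/eqP; rewrite eq_le measure_ge0 andbT -PGC.
  by apply: le_measure; rewrite ?inE; [exact: measurableD|exact: measurableC|move=> x []].
by rewrite H // AB -H.
Qed.

Lemma arrivalS (R : realType) (e : nat -> R) k :
  arrival e k.+1 = arrival e k + e k.+1.
Proof. by rewrite /arrival big_ord_recr. Qed.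

Lemma arrival0 (R : realType) (e : nat -> R) : arrival e 0 = e 0%N.
Proof. by rewrite /arrival big_ord_recr big_ord0 /= add0r. Qed.

Lemma arrival_le (R : realType) (e : nat -> R) : (forall k, 0 <= e k) ->
  forall j k, (j <= k)%N -> arrival e j <= arrival e k.
Proof.
move=> e0 j; elim=> [|k IHk]; first by rewrite leqn0 => /eqP ->.
rewrite leq_eqVlt => /orP[/eqP -> //|]; rewrite ltnS => /IHk; rewrite arrivalS => h.
by rewrite (le_trans h) // lerDl.
Qed.

Lemma poisN_eq (R : realType) (e : nat -> R) (t : R) (m : nat) :
  (forall k, 0 <= e k) -> ((0 < m)%N -> arrival e m.-1 <= t) -> t < arrival e m ->
  poisN e t = m.
Proof.
move=> e0 m1 m2; rewrite /poisN.
have -> : [set k | arrival e k <= t] = `I_m.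
  apply/seteqP; split => k /= h.
    rewrite ltnNge; apply/negP => mk; move: m2; rewrite ltNge => /negP; apply.
    exact: le_trans (arrival_le e0 mk) h.
  case: m m1 m2 h => // m /(_ isT) m1 _ h; apply: le_trans m1.
  by apply: arrival_le => //; rewrite -ltnS.
apply: xget_unique => [|y /= h]; first exact: card_eqxx.
by apply/esym/card_eq_II.
Qed.

Section Arrivals.
Context d (T : measurableType d) (R : realType) (P : probability T R).
Variables (N : nat) (Rad U : nat -> T -> nat) (E : nat -> T -> R).
Local Notation n := N.+1.
Hypothesis model : covering_model P n Rad U E.

Local Notation arr m := (fun w => arrival (E ^~ w) m).
Local Notation arc := (arc Rad U).
Local Notation slot := (slot Rad U E).

Lemma measurable_arrival m : measurable_fun setT (arr m).
Proof.
elim: m => [|m IHm].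
  apply: (eq_measurable_fun (E 0%N)) => [w _|]; first by rewrite arrival0.
  by case: model => -[_ [_ H]] _ _ _ _; exact: H.
apply: (eq_measurable_fun (fun w => arrival (E ^~ w) m + E m.+1 w)) => [w _|].
  by rewrite arrivalS.
apply: measurable_funD => //.
by case: model => -[_ [_ H]] _ _ _ _; exact: H.
Qed.

Lemma measurable_arrival_gt m t : measurable [set w | t < arrival (E ^~ w) m].
Proof.
have := measurable_arrival m measurableT (measurable_itv `]t, +oo[); rewrite setTI.
by congr measurable; apply/seteqP; split => w /=; rewrite in_itv /= andbT.
Qed.

Definition upd (C : nat -> set R) (j : nat) (B : set R) : nat -> set R :=
  fun k => if k == j then B else C k.

Definition cap_slot L M C : set T := \bigcap_(k < L) slot (M k) (C k) k.

Lemma measurable_cap_slot L M C : (forall k, measurable (C k)) -> measurable (cap_slot L M C).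
Proof.
move=> mC; apply: bigcap_measurableType => k _; exact: (measurable_slot model).
Qed.

Lemma cap_slot_upd L M C j B : (j < L)%N -> C j = setT ->
  cap_slot L M (upd C j B) = cap_slot L M C `&` E j @^-1` B.
Proof.
move=> jL Cj; apply/seteqP; split => [w H|w [H Hj] k kL].
  split; last by have [] := H j jL; rewrite /upd eqxx.
  by move=> k kL; have [h1 h2] := H k kL; split => //; move: h2; rewrite /upd;
    case: eqP => // -> _; rewrite Cj.
by have [h1 h2] := H k kL; split => //; rewrite /upd; case: eqP => // ->.
Qed.

Lemma upd_measurable C j B : (forall k, measurable (C k)) -> measurable B ->
  forall k, measurable (upd C j B k).
Proof. by move=> mC mB k; rewrite /upd; case: eqP. Qed.

Lemma cap_slot_updP L M C j B : (forall k, measurable (C k)) -> measurable B ->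
  (j < L)%N -> C j = setT ->
  P (cap_slot L M (upd C j B)) = (P (cap_slot L M C) * P (E j @^-1` B))%E.
Proof.
move=> mC mB jL Cj; rewrite /cap_slot !(indep_slot model) //; last exact: upd_measurable.
rewrite (bigD1 (Ordinal jL)) //= [in RHS](bigD1 (Ordinal jL)) //=.
rewrite /upd eqxx Cj preimage_setT probability_setT mule1.
rewrite [RHS]muleAC; congr (_ * _)%E.
by apply: eq_bigr => k; rewrite -val_eqE /= => /negbTE ->.
Qed.

(** The cylinder may constrain every arc but only the waiting times after [m]. In the inductive
    step, constraining [E m.+1] as well keeps it of this form, so the arrival, a function of the
    pair [(E m.+1, arr m)], is covered by [indep_pair_event]. *)
Lemma arrival_indep L m M C : (m < L)%N -> (forall k, measurable (C k)) ->
  (forall k, (k <= m)%N -> C k = setT) -> forall A, measurable A ->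
  P (cap_slot L M C `&` arr m @^-1` A) = (P (cap_slot L M C) * P (arr m @^-1` A))%E.
Proof.
elim: m M C => [|m IHm] M C mL mC CT A mA.
  have -> : arr 0 = E 0%N by apply/funext => w; rewrite arrival0.
  by rewrite -cap_slot_upd ?CT // cap_slot_updP ?CT.
have mEm : measurable_fun setT (E m.+1).
  by case: model => -[_ [_ H]] _ _ _ _; exact: H.
pose D : set (R * R) := [set z | A (z.2 + z.1)].
have mD : measurable D.
  have : measurable_fun setT (fun z : R * R => z.2 + z.1).
    by apply: measurable_funD; [exact: measurable_snd|exact: measurable_fst].
  by move=> /(_ measurableT A mA); rewrite setTI.
have -> : arr m.+1 @^-1` A = [set w | D (E m.+1 w, arrival (E ^~ w) m)].
  by apply/seteqP; split => w; rewrite /D /= arrivalS.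
apply: (indep_pair_event (measurable_cap_slot L M mC) mEm (measurable_arrival m)) => //.
have CT' B k : (k <= m)%N -> upd C m.+1 B k = setT.
  by move=> km; rewrite /upd ltn_eqF // CT // ltnW.
have prodE B A' : measurable B -> measurable A' ->
    P (E m.+1 @^-1` B `&` arr m @^-1` A') = (P (E m.+1 @^-1` B) * P (arr m @^-1` A'))%E.
  move=> mB mA'.
  have TE : cap_slot L (fun=> setT) (upd (fun=> setT) m.+1 B) = E m.+1 @^-1` B.
    rewrite cap_slot_upd // (_ : cap_slot _ _ _ = setT) ?setTI //.
    by apply/seteqP; split => // w _ k _; split.
  rewrite -TE IHm //; first exact: ltnW.
  - exact: upd_measurable.
  - by move=> k km; rewrite /upd ltn_eqF.
move=> B A' mB mA'; rewrite prodE // setIA -cap_slot_upd ?CT //.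
rewrite IHm ?(ltnW mL) //; first by rewrite cap_slot_updP ?CT // muleA.
- exact: upd_measurable.
- exact: CT'.
Qed.

Lemma arrival_gamma m t :
  P [set w | t < arrival (E ^~ w) m] = (gamma_tail m t)%:E.
Proof.
elim: m t => [|m IHm] t.
  under eq_set do rewrite arrival0.
  rewrite /gamma_tail; have [t0|t0] := ltP t 0.
    apply/eqP; rewrite eq_le probability_le1 /=; last first.
      have := measurable_gap model 0 (measurable_itv `]t, +oo[).
      by congr measurable; apply/seteqP; split => w /=; rewrite in_itv /= andbT.
    rewrite -expR0 -oppr0 -(model_E model 0) //.
    apply: le_measure; rewrite ?inE.
    + have := measurable_gap model 0 (measurable_itv `]0, +oo[).
      by congr measurable; apply/seteqP; split => w /=; rewrite in_itv /= andbT.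
    + have := measurable_gap model 0 (measurable_itv `]t, +oo[).
      by congr measurable; apply/seteqP; split => w /=; rewrite in_itv /= andbT.
    + by move=> w /=; exact: lt_trans.
  by rewrite (model_E model) // big_ord_recr big_ord0 /= add0r expr0 fact0 divr1 mulr1.
have mEm : measurable_fun setT (E m.+1).
  by case: model => -[_ [_ H]] _ _ _ _; exact: H.
rewrite -(@gamma_tail_add _ _ _ P _ _ _ mEm (measurable_arrival m)) //.
- by congr (P _); apply/seteqP; split => w /=; rewrite arrivalS addrC.
- by move=> s s0; rewrite (model_E model).
- move=> B A mB mA.
  have TE : cap_slot m.+2 (fun=> setT) (upd (fun=> setT) m.+1 B) = E m.+1 @^-1` B.
    rewrite cap_slot_upd // (_ : cap_slot _ _ _ = setT) ?setTI //.
    by apply/seteqP; split => // w _ k _; split.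
  rewrite -TE arrival_indep //; first exact: upd_measurable.
  by move=> k km; rewrite /upd ltn_eqF.
Qed.

End Arrivals.

(** * Poissonization *)

(** The value [0] is set apart because it is also the default taken by [poisN] when infinitely many
    arrivals occur before [t]. Positive values are described through finite sets of indices, of
    which there are countably many. *)
Lemma poisN_fsetP (R : realType) (e : nat -> R) (t : R) (m : nat) : (0 < m)%N ->
  poisN e t = m <->
  exists X : {fset nat}, #|` X|%fset = m /\ forall k, (arrival e k <= t) = (k \in X).
Proof.
move=> m0; split=> [|[X [Xm XE]]].
  rewrite /poisN; case: xgetP => [y yE Py ym|_ m0']; last by rewrite -m0' in m0.
  move: Py; rewrite /= ym => cm.
  have /finite_fsetP[X XE] : finite_set [set k | arrival e k <= t] by exists m.
  exists X; split; first by apply/card_eq_fsetP; rewrite -XE.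
  move=> k; have := congr1 (fun A => A k) XE => /= h.
  by apply/idP/idP => [|kX]; [rewrite h|rewrite h].
rewrite /poisN; apply: xget_unique => /=.
  rewrite (_ : [set k | _] = [set` X]); first exact/card_eq_fsetP.
  by apply/seteqP; split => k /=; rewrite XE.
move=> y; rewrite (_ : [set k | _] = [set` X]).
  by move/card_eq_fsetP <-.
by apply/seteqP; split => k /=; rewrite XE.
Qed.

Lemma exp_series_sum (R : realType) (a x : R) : 0 <= x ->
  (\sum_(m <oo) (a * (x ^+ m / m`!%:R))%:E)%E = (a * expR x)%:E.
Proof.
move=> x0; apply/cvg_lim => //.
rewrite (_ : (fun k => _) = EFin \o (fun k => a * series (exp_coeff x) k)).
  apply: cvg_EFin; first exact: nearW.
  by apply: cvgMr; exact: is_cvg_series_exp_coeff.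
apply/funext => k /=; rewrite sumEFin /series /= mulr_sumr.
by congr EFin.
Qed.

Section Poisson.
Context d (T : measurableType d) (R : realType) (P : probability T R).
Variables (N : nat) (Rad U : nat -> T -> nat) (E : nat -> T -> R).
Local Notation n := N.+1.
Hypothesis model : covering_model P n Rad U E.

Local Notation arr m := (fun w => arrival (E ^~ w) m).
Local Notation arc := (arc Rad U).

Lemma measurable_arrival_le k (tau : T -> R) : measurable_fun setT tau ->
  measurable [set w | arrival (E ^~ w) k <= tau w].
Proof.
move=> mtau.
have : measurable_fun setT (fun w => tau w - arrival (E ^~ w) k).
  by apply: measurable_funB => //; exact: measurable_arrival model k.
move=> /(_ measurableT _ (measurable_itv `[0, +oo[)); rewrite setTI.
by congr measurable; apply/seteqP; split => w /=; rewrite in_itv /= andbT subr_ge0.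
Qed.

(** The time [tau] is random because the process is later observed at its own arrival times. *)
Lemma measurable_poisN (tau : T -> R) : measurable_fun setT tau ->
  forall A : set nat, measurable [set w | A (poisN (E ^~ w) (tau w))].
Proof.
move=> mtau.
have pos m : (0 < m)%N -> measurable [set w | poisN (E ^~ w) (tau w) = m].
  move=> m0.
  have -> : [set w | poisN (E ^~ w) (tau w) = m] = \bigcup_(X : {fset nat})
      (if #|` X|%fset == m then
         \bigcap_k [set w | (arrival (E ^~ w) k <= tau w) = (k \in X)] else set0).
    apply/seteqP; split => [w /(poisN_fsetP _ _ m0)[X [Xm XE]]|w [X _]].
      by exists X => //; rewrite Xm eqxx => k _ /=.
    case: eqP => // Xm H; apply/(poisN_fsetP _ _ m0); exists X; split => // k.
    exact: H.
  apply: countable_bigcupT_measurable; first exact: countableP.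
  move=> X; case: eqP => // _; apply: bigcapT_measurable => k.
  have mk := measurable_arrival_le k mtau.
  case: (k \in X) => //.
  by rewrite (_ : [set w | _] = ~` [set w | arrival (E ^~ w) k <= tau w]);
    [exact: measurableC|apply/seteqP; split => w /=; case: (_ <= _)].
(* The fiber over [0], default cases included, is the complement of the others. *)
apply: (@measurable_fibers _ _ _ (fun w => poisN (E ^~ w) (tau w))) => -[|m].
  rewrite (_ : _ @^-1` _ = ~` \bigcup_m [set w | poisN (E ^~ w) (tau w) = m.+1]).
    by apply: measurableC; apply: bigcupT_measurable => m; exact: pos.
  apply/seteqP; split => w /=; first by move=> w0 [m _ /=]; rewrite w0.
  by case E0 : (poisN _ _) => [//|m] H; case: H; exists m.
exact: (pos m.+1).
Qed.

Lemma gap_ge0_full : P [set w | forall k, 0 <= E k w] = 1%E.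
Proof.
have mE0 k : measurable [set w | 0 <= E k w].
  have := measurable_gap model k (measurable_itv `[0, +oo[).
  by congr measurable; apply/seteqP; split => w /=; rewrite in_itv /= andbT.
have mE0' k : measurable [set w | 0 < E k w].
  have := measurable_gap model k (measurable_itv `]0, +oo[).
  by congr measurable; apply/seteqP; split => w /=; rewrite in_itv /= andbT.
have E1 k : P (~` [set w | 0 <= E k w]) = 0%E.
  rewrite probability_setC // (_ : P _ = 1%E) ?subee //.
  have e1 : P [set w | 0 < E k w] = 1%E by rewrite (model_E model) // oppr0 expR0.
  apply/eqP; rewrite eq_le probability_le1 //= -e1.
  by apply: le_measure; [exact/mem_set/mE0'|exact/mem_set/mE0|move=> w /=; exact: ltW].
have -> : [set w | forall k, 0 <= E k w] = ~` \bigcup_k ~` [set w | 0 <= E k w].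
  rewrite setC_bigcup; apply/seteqP; split => [w H k _|w H k].
    by rewrite setCK; exact: H.
  by have := H k I; rewrite setCK.
have mU : measurable (\bigcup_k ~` [set w | 0 <= E k w]).
  by apply: bigcupT_measurable => k; exact: measurableC.
rewrite probability_setC // (_ : P _ = 0%E) ?sube0 //.
apply: measure_negligible => //; apply: negligible_bigcup => k.
by apply/negligibleP; [exact: measurableC|exact: E1].
Qed.

Lemma cvg_gamma_tail1 (t : R) : 0 <= t -> gamma_tail m t @[m --> \oo] --> (1 : R).
Proof.
move=> t0; rewrite -expR0 -(addNr t) expRD.
rewrite (_ : (fun m => gamma_tail m t) =
             (fun m => expR (- t) * series (exp_coeff t) m.+1)); last first.
  apply/funext => m; rewrite /gamma_tail ltNge t0 /=; congr (_ * _).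
  by rewrite /series /= big_mkord.
apply: cvgMr; rewrite (cvg_shiftS (series (exp_coeff t))).
exact: is_cvg_series_exp_coeff.
Qed.

Lemma measurable_gap_ge0 : measurable [set w | forall k, 0 <= E k w].
Proof.
rewrite (_ : [set w | _] = \bigcap_k [set w | 0 <= E k w]).
  apply: bigcapT_measurable => k.
  have := measurable_gap model k (measurable_itv `[0, +oo[).
  by congr measurable; apply/seteqP; split => w /=; rewrite in_itv /= andbT.
by apply/seteqP; split => w /= H k; [move=> _; exact: H|exact: (H k I)].
Qed.

Lemma arrival_unbounded_full (t : R) : 0 <= t ->
  P [set w | exists m, t < arrival (E ^~ w) m] = 1%E.
Proof.
move=> t0.
have mA m : measurable [set w | t < arrival (E ^~ w) m].
  exact: (measurable_arrival_gt model).
rewrite (_ : [set w | _] = \bigcup_m [set w | t < arrival (E ^~ w) m]); last first.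
  by apply/seteqP; split => w /= [m]; exists m.
apply/eqP; rewrite eq_le probability_le1 /=; last exact: bigcupT_measurable.
pose A : set T := \bigcup_m [set w | t < arrival (E ^~ w) m].
have H m : ((gamma_tail m t)%:E <= P A)%E.
  rewrite -(arrival_gamma model); apply: le_measure.
  - exact/mem_set/mA.
  - exact/mem_set/bigcupT_measurable.
  - by move=> w /= h; exists m.
have c1 : (gamma_tail m t)%:E @[m --> \oo] --> 1%E.
  by apply: cvg_EFin; [exact: nearW|exact: cvg_gamma_tail1].
by apply: (cvge_to_le c1); apply: nearW => m; exact: H.
Qed.

(* Off this event [poisN] may be the default value 0 of [xget]. *)
Definition regular_clock (t : R) : set T :=
  [set w | forall k, 0 <= E k w] `&` [set w | exists m, t < arrival (E ^~ w) m].

Lemma measurable_regular_clock t : measurable (regular_clock t).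
Proof.
apply: measurableI; first exact: measurable_gap_ge0.
rewrite (_ : [set w | _] = \bigcup_m [set w | t < arrival (E ^~ w) m]).
  by apply: bigcupT_measurable => m; exact: (measurable_arrival_gt model).
by apply/seteqP; split => w /= [m]; exists m.
Qed.

Lemma regular_clock_full (t : R) : 0 <= t -> P (regular_clock t) = 1%E.
Proof.
move=> t0; rewrite /regular_clock.
have m1 := measurable_gap_ge0.
have m2 : measurable [set w | exists m, t < arrival (E ^~ w) m].
  rewrite (_ : [set w | _] = \bigcup_m [set w | t < arrival (E ^~ w) m]).
    by apply: bigcupT_measurable => m; exact: (measurable_arrival_gt model).
  by apply/seteqP; split => w /= [m]; exists m.
rewrite -(arrival_unbounded_full t0).
apply: (probability_eq_on m1) => //; [exact: measurableI|exact: gap_ge0_full|].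
by rewrite setIAC setIid setIC.
Qed.

Lemma regular_poisNP (t : R) w m : regular_clock t w ->
  poisN (E ^~ w) t = m <->
  t < arrival (E ^~ w) m /\ ((0 < m)%N -> arrival (E ^~ w) m.-1 <= t).
Proof.
move=> [E0 [j tj]]; split => [<-|[h1 h2]]; last exact: poisN_eq.
have [m0 Hm0 m0_min] := ex_minnP (ex_intro (fun j => t < arrival (E ^~ w) j) j tj).
have m0' : (0 < m0)%N -> arrival (E ^~ w) m0.-1 <= t.
  move=> m00; rewrite leNgt; apply/negP => /m0_min; rewrite leqNgt prednK //.
  by rewrite leqnn.
by rewrite (poisN_eq E0 m0' Hm0).
Qed.

Variables (B : set (nat * nat)) (q : R).
Hypothesis q_ge0 : 0 <= q.
Hypothesis arcB : forall k, P (arc k @^-1` B) = q%:E.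

Definition first_arcs (m : nat) : set T := \bigcap_(k < m) arc k @^-1` B.

Lemma measurable_first_arcs m : measurable (first_arcs m).
Proof. by apply: bigcap_measurableType => k _; exact: (measurable_arc model). Qed.

Lemma first_arcs_arrival m j t :
  P (first_arcs m `&` [set w | t < arrival (E ^~ w) j]) = (q ^+ m * gamma_tail j t)%:E.
Proof.
(* The block has to contain the [m] constrained arcs as well as the [j.+1] waiting times that make
   up the arrival. *)
pose L := (maxn m j.+1); pose M k : set (nat * nat) := if (k < m)%N then B else setT.
pose C (k : nat) : set R := setT.
have mC k : measurable (C k) by exact: measurableT.
have capE : cap_slot Rad U E L M C = first_arcs m.
  apply/seteqP; split => w H k km.
    have kL : (k < L)%N by rewrite (leq_trans km) // leq_maxl.
    by have [h _] := H k kL; move: h; rewrite /M km.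
  by split => //; rewrite /M; case: ifP => // k_m; exact: H.
have capP : P (first_arcs m) = (q ^+ m)%:E.
  rewrite -capE /cap_slot (indep_slot model _ _ mC) /L.
  under eq_bigr do rewrite preimage_setT probability_setT mule1.
  rewrite -(subnKC (leq_maxl m j.+1)) big_split_ord /= [X in (_ * X)%E]big1 ?mule1.
    rewrite (eq_bigr (fun=> q%:E)) => [|k _]; last by rewrite /M ltn_ord arcB.
    by rewrite prodEFin prodr_const card_ord.
  move=> k _; rewrite /M ltnNge leq_addr /= preimage_setT; exact: probability_setT.
have ms : measurable (`]t, +oo[ : set R) by exact: measurable_itv.
rewrite EFinM -capP -(arrival_gamma model) -capE.
have jL : (j < L)%N by rewrite /L leq_max ltnSn orbT.
have := arrival_indep model M jL mC (fun _ _ => erefl) ms.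
have -> : arr j @^-1` `]t, +oo[ = [set w | t < arrival (E ^~ w) j].
  by apply/seteqP; split => w /=; rewrite in_itv /= andbT.
by [].
Qed.

(** Up to a null event, [m] arrivals by time [t] means that arrival [m] comes after [t] and arrival
    [m.-1] does not. The difference of the two gamma tails is the Poisson mass. *)
Lemma first_arcs_poisN m t : 0 <= t ->
  P (first_arcs m `&` [set w | poisN (E ^~ w) t = m])
  = (expR (- t) * ((q * t) ^+ m / m`!%:R))%:E.
Proof.
move=> t0; have mG := measurable_regular_clock t; have PG := regular_clock_full t0.
have mN : measurable [set w | poisN (E ^~ w) t = m].
  by have := @measurable_poisN (fun=> t) (measurable_cst _) [set m].
have mV := measurable_first_arcs m.
have mA j : measurable (first_arcs m `&` [set w | t < arrival (E ^~ w) j]).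
  by apply: measurableI => //; exact: (measurable_arrival_gt model).
case: m mN mV mA => [|m] mN mV mA.
  rewrite -[RHS](_ : (q ^+ 0 * gamma_tail 0 t)%:E = _); last first.
    by rewrite /gamma_tail ltNge t0 /= big_ord_recr big_ord0 /= add0r !expr0 mul1r.
  rewrite -first_arcs_arrival; apply: (probability_eq_on mG) => //.
    exact: measurableI.
  apply/seteqP; split => w [[h1 h2] Gw]; split => //; split => //.
    by have /(regular_poisNP 0 Gw)[] := h2.
  by apply/(regular_poisNP 0 Gw).
have -> : P (first_arcs m.+1 `&` [set w | poisN (E ^~ w) t = m.+1]) =
  P ((first_arcs m.+1 `&` [set w | t < arrival (E ^~ w) m.+1]) `\`
      (first_arcs m.+1 `&` [set w | t < arrival (E ^~ w) m])).
  apply: (probability_eq_on mG) => //; [exact: measurableI|exact: measurableD|].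
  apply/seteqP; split => w [].
    move=> [h1 h2] Gw; have /(regular_poisNP _ Gw)[h3 /(_ isT) /= h4] := h2.
    by split => //; split => // -[_]; rewrite /= ltNge h4.
  move=> [[h1 h2] h3] Gw; split => //; split => //=.
  apply/(regular_poisNP _ Gw); split => // _ /=; rewrite leNgt.
  by apply/negP => h4; apply: h3.
set A := _ `&` [set w | _]; set A' := first_arcs m.+1 `&` _.
have -> : P (A `\` A') = (P A - P (A `&` A'))%E.
  apply: measureD; [exact: mA|exact: mA|].
  exact: le_lt_trans (probability_le1 P (mA m.+1)) (ltry 1).
have -> : P (A `&` A') = (q ^+ m.+1 * gamma_tail m t)%:E.
  rewrite -first_arcs_arrival; apply: (probability_eq_on mG) => //.
    by apply: measurableI; exact: mA.
  apply/seteqP; split => w []; first by move=> [_ ?] ?; split.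
  move=> [h1 h2] [E0 Gw]; split => //; split => //; split => //=.
  by apply: lt_le_trans h2 _; exact: arrival_le.
rewrite /A first_arcs_arrival.
rewrite -EFinB /gamma_tail ltNge t0 /=; congr EFin.
rewrite -mulrBr -mulrBr big_ord_recr /= [_ + _ - _]addrC addrA addNr add0r.
by rewrite exprMn; ring.
Qed.

(** Poisson thinning: arcs outside [B] arrive at rate [1 - q], and none has arrived by time [t]. It
    is obtained by summing over the number of arrivals. *)
Lemma poisson_event t : 0 <= t ->
  P [set w | forall k, (k < poisN (E ^~ w) t)%N -> B (arc k w)]
  = (expR (- (1 - q) * t))%:E.
Proof.
move=> t0.
have mN m : measurable [set w | poisN (E ^~ w) t = m].
  by have := @measurable_poisN (fun=> t) (measurable_cst _) [set m].
have -> : [set w | forall k, (k < poisN (E ^~ w) t)%N -> B (arc k w)] =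
  \bigcup_m (first_arcs m `&` [set w | poisN (E ^~ w) t = m]).
  apply/seteqP; split => [w H|w [m _ [H /= Nm]] k].
    by exists (poisN (E ^~ w) t) => //; split.
  by rewrite Nm; exact: H.
have mF m : measurable (first_arcs m `&` [set w | poisN (E ^~ w) t = m]).
  by apply: measurableI => //; exact: measurable_first_arcs.
transitivity (\sum_(m <oo) P (first_arcs m `&` [set w | poisN (E ^~ w) t = m]))%E.
  apply: measure_semi_bigcup => //; last exact: bigcupT_measurable.
  apply/trivIsetP => i j _ _ ij; apply/seteqP; split => w //= [[_ wi] [_ wj]].
  by move/eqP: ij; rewrite -wi -wj.
under eq_eseriesr do rewrite first_arcs_poisN //.
rewrite exp_series_sum ?mulr_ge0 // -expRD; congr (expR _)%:E; ring.
Qed.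

End Poisson.

(** * The uncovered set of the covering model *)

Lemma sum_fiber_prob d (T : measurableType d) (R : realType) (P : probability T R)
  (I : finType) (X : T -> I) (phi : pred I) :
  (forall i, measurable (X @^-1` [set i])) ->
  \sum_i fine (P (X @^-1` [set i])) * (phi i)%:R = fine (P [set w | phi (X w)]).
Proof.
move=> mX.
have -> : P [set w | phi (X w)] = (\sum_(i | phi i) P (X @^-1` [set i]))%E.
  have -> : [set w | phi (X w)] = \bigcup_(i in [set i | phi i]) X @^-1` [set i].
    by apply/seteqP; split => w /=; [move=> h; exists (X w)|move=> [i h /= ->]].
  transitivity (\sum_(i \in [set i | phi i]) P (X @^-1` [set i]))%E.
    apply: measure_fin_bigcup => //; first exact: finite_finset.
    by move=> i j _ _ [w [/= <- <-]].
  rewrite (fsbigE [seq i <- index_enum I | phi i]) ?filter_uniq ?index_enum_uniq //.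
  - rewrite big_filter_cond; apply: eq_bigl => i.
    by apply/andP/idP => [[]|phi_i] //; split => //; exact/mem_set.
  - by move=> i /=; rewrite mem_filter => /andP[].
  - by move=> i /= phi_i; rewrite mem_filter phi_i mem_index_enum.
rewrite (eq_bigr (fun i => (fine (P (X @^-1` [set i])))%:E)) => [|i _]; last first.
  by rewrite fineK // fin_num_measure.
rewrite sumEFin /=.
rewrite [RHS]big_mkcond /=; apply: eq_bigr => i _.
by case: (phi i); rewrite ?mulr1 ?mulr0.
Qed.

(** The arc starts at [a + x.+1], the site from which [next_gap] counts, and the origin [a] plays
    the part of the point [n]. The last offset inside an arc of length [r] is [r - 1], hence the
    strict inequality. *)
Lemma hit_arc (N : nat) (a x : nat) (Q : pred nat) (r : nat) : (x < N.+1)%N ->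
  let n := N.+1 in let u := ((a + x.+1) %% n)%N in
  in_arc n u r (a %% n) || has (fun z => Q z && in_arc n u r ((a + z) %% n)) (iota 1 N)
  = (next_gap n Q x < r)%N.
Proof.
move=> xn n u; have n0 : (0 < n)%N by [].
have ngle : (next_gap n Q x <= n - x.+1)%N.
  by rewrite /next_gap (leq_trans (find_size _ _)) // size_iota.
have arcP z : reflect (exists2 j, (j < r)%N & (a + z) = a + (x.+1 + j) %[mod n])
    (in_arc n u r ((a + z) %% n)).
  apply: (iffP hasP) => -[j].
    rewrite mem_iota add0n => jr /eqP e; exists j => //.
    by rewrite e /u modnDml addnA.
  move=> jr e; exists j; first by rewrite mem_iota add0n.
  by apply/eqP; rewrite e /u modnDml addnA.
apply/idP/idP => [|ng_lt].
  move=> H; have [z [zn zQ [j jr e]]] : exists z, [/\ (z < n)%N, (z == 0%N) || Q z &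
      exists2 j, (j < r)%N & (a + z) = a + (x.+1 + j) %[mod n]].
    case/orP: H => [|/hasP[z]].
      by rewrite -{1}[a]addn0 => /arcP h; exists 0%N; split.
    rewrite mem_iota => zN /andP[Qz /arcP h]; exists z; split => //; last by rewrite Qz orbT.
    by rewrite /n; lia.
  apply: leq_ltn_trans jr; rewrite leqNgt; apply/negP => j_lt.
  have xj : (x.+1 + j < n)%N by lia.
  have zE : z = (x.+1 + j)%N.
    by move/eqP: e; rewrite eqn_modDl !modn_small // => /eqP.
  have Qz : Q (x + j.+1)%N by case/orP: zQ; rewrite zE ?addSnnS //; lia.
  have := before_find 0%N j_lt; rewrite nth_iota ?add0n; last by lia.
  by rewrite Qz.
case: (ltngtP (next_gap n Q x) (n - x.+1)) ngle => // [lt|eq] _; last first.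
  apply/orP; left; rewrite -[a in (a %% n)%N]addn0; apply/arcP.
  exists (next_gap n Q x) => //; rewrite eq subnKC // modnDr addn0 //.
apply/orP; right; apply/hasP; exists (x.+1 + next_gap n Q x)%N.
  by rewrite mem_iota; lia.
apply/andP; split; last by apply/arcP; exists (next_gap n Q x).
have := nth_find 0%N (a := fun j => Q (x + j.+1)%N) (s := iota 0 (n - x.+1)).
rewrite has_find size_iota => /(_ lt); rewrite nth_iota // add0n.
by rewrite -/(next_gap n Q x) addSnnS.
Qed.

Lemma sum_rotate (V : nmodType) (N b : nat) (F : nat -> V) :
  \sum_(u < N.+1) F u = \sum_(x < N.+1) F ((b + x) %% N.+1)%N.
Proof.
pose h (x : 'I_N.+1) : 'I_N.+1 := inord ((b + x) %% N.+1).
have h_inj : injective h.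
  move=> x y /(congr1 val) /=; rewrite !inordK ?ltn_mod // => /eqP.
  by rewrite eqn_modDl !modn_small // => /eqP/val_inj.
by rewrite (reindex_inj h_inj) /=; apply: eq_bigr => x _; rewrite inordK // ltn_mod.
Qed.

Definition uncovered (R : realType) (N : nat) (Rad U : nat -> nat) (e : nat -> R)
    (t : R) : {set 'I_N.+1} :=
  [set i : 'I_N.+1 | ~~ in_C N.+1 Rad U (poisN e t) i]%SET.

Lemma C_uncovered_card (R : realType) N Rad U (e : nat -> R) t :
  C_uncovered N.+1 Rad U (poisN e t) = #|uncovered N Rad U e t|.
Proof.
rewrite /C_uncovered -sum1_count (_ : iota 0 N.+1 = index_iota 0 N.+1); last first.
  by rewrite /index_iota subn0.
by rewrite big_mkcond big_mkord -sum1_card [RHS]big_mkcond /=;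
  apply: eq_bigr => i _; rewrite inE.
Qed.

Lemma X_full_uncovered (R : realType) N Rad U (e : nat -> R) t :
  X_full N.+1 Rad U e t = (uncovered N Rad U e t == finset.set0).
Proof.
apply/allP/eqP => [H|H i].
  by apply/setP => i; rewrite !inE H // mem_iota /= ltn_ord.
rewrite mem_iota => /andP[_ iN]; have := finset.in_set0 (Ordinal iN).
by rewrite -H inE /= => /negbFE.
Qed.

Section DiscreteLaw.
Context d (T : measurableType d) (R : realType) (P : probability T R).
Variables (N : nat) (Rad U : nat -> T -> nat) (E : nat -> T -> R).
Local Notation n := N.+1.
Hypothesis model : covering_model P n Rad U E.

Local Notation arc := (arc Rad U).
Local Notation unc t w := (uncovered N (Rad ^~ w) (U ^~ w) (E ^~ w) t).

Lemma measurable_uncovered (tau : T -> R) : measurable_fun setT tau ->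
  forall S, measurable [set w | unc (tau w) w = S].
Proof.
move=> mtau S.
pose Cm m w : {set 'I_N.+1} := [set i : 'I_N.+1 | ~~ in_C n (Rad ^~ w) (U ^~ w) m i]%SET.
have -> : [set w | unc (tau w) w = S] = \bigcup_m
    ([set w | poisN (E ^~ w) (tau w) = m] `&` [set w | Cm m w = S]).
  apply/seteqP; split => [w h|w [m _ [/= <- h]]]; last exact: h.
  by exists (poisN (E ^~ w) (tau w)).
apply: bigcupT_measurable => m; apply: measurableI.
  exact: (measurable_poisN model mtau [set m]).
have mC i : measurable [set w | in_C n (Rad ^~ w) (U ^~ w) m i].
  have -> : [set w | in_C n (Rad ^~ w) (U ^~ w) m i] =
     \bigcup_(k in `I_m) arc k @^-1` [set p | in_arc n p.1 p.2 i].
    apply/seteqP; split => w /=.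
      by move=> /hasP[k]; rewrite mem_iota add0n => km h; exists k.
    by move=> [k km h]; apply/hasP; exists k => //; rewrite mem_iota add0n.
  by apply: bigcup_measurable => k _; exact: (measurable_arc model).
have -> : [set w | Cm m w = S] = \bigcap_(i : 'I_N.+1)
    [set w | (~~ in_C n (Rad ^~ w) (U ^~ w) m i) = (i \in S)].
  apply/seteqP; split => [w /= <- i _ /=|w H]; first by rewrite inE.
  by apply/setP => i; rewrite inE; exact: H.
apply: fin_bigcap_measurable; first exact: finite_finset.
move=> i _; case: (i \in S).
  rewrite (_ : [set w | _] = ~` [set w | in_C n (Rad ^~ w) (U ^~ w) m i]).
    exact: measurableC.
  by apply/seteqP; split => w /=; case: in_C.
rewrite (_ : [set w | _] = [set w | in_C n (Rad ^~ w) (U ^~ w) m i]) //.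
by apply/seteqP; split => w /=; case: in_C.
Qed.

Definition uncovered_weight (t : R) (S : {set 'I_n}) : R :=
  fine (P [set w | unc t w = S]).

Lemma uncovered_weight_ge0 t S : 0 <= uncovered_weight t S.
Proof. by rewrite fine_ge0. Qed.

Lemma sum_uncovered_weight t (phi : pred {set 'I_n}) :
  \sum_(S | phi S) uncovered_weight t S = fine (P [set w | phi (unc t w)]).
Proof.
rewrite -(@sum_fiber_prob _ _ _ P _ (fun w => unc t w)); last first.
  by move=> S; exact: (measurable_uncovered (@measurable_cst _ _ _ _ setT t)).
by rewrite big_mkcond; apply: eq_bigr => S _; case: (phi S); rewrite ?mulr1 ?mulr0.
Qed.

(** Conditionally on its start, the arc misses the set when its length is at most the corresponding
    [next_gap], by [hit_arc]; then average over the uniform start. *)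
Lemma arc_miss_prob k a (Q : pred nat) :
  P (arc k @^-1` [set p | ~~ (in_arc n p.1 p.2 (a %% n)
      || has (fun z => Q z && in_arc n p.1 p.2 ((a + z) %% n)) (iota 1 N))])
  = (1 - n%:R^-1 * \sum_(x < n) (next_gap n Q x).+1%:R^-1)%:E.
Proof.
set B := [set p | _].
have mB := measurable_arc model k B.
have mU u : measurable (U k @^-1` [set u]) by case: model => -[_ [H _]] _ _ _ _; exact: H.
have mR A : measurable (Rad k @^-1` A) by case: model => -[H _] _ _ _ _; exact: H.
have UE u : (u < n)%N -> P (U k @^-1` [set u]) = (n%:R^-1)%:E.
  by move=> un; exact: (model_U model).
have sumU : (\sum_(u < n) P (U k @^-1` [set (u : nat)]) = 1)%E.
  rewrite (eq_bigr (fun=> (n%:R^-1)%:E)) => [|u _]; last exact: UE.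
  by rewrite sumEFin sumr_const card_ord -[_ *+ n]mulr_natl divff // pnatr_eq0.
have tU : trivIset setT (fun u : 'I_n => U k @^-1` [set (u : nat)]).
  by move=> i j _ _ [w [/= wi wj]]; apply: val_inj; rewrite /= -wi -wj.
(* [U k] takes values in [nat]; that it lies below [n] almost surely follows from the [n] masses
   [1 / n] adding up to one. *)
pose V := \big[setU/set0]_(u < n) (U k @^-1` [set (u : nat)]).
have PV : P V = 1%E.
  by rewrite -sumU; apply: measure_bigsetU_ord.
have mV : measurable V by apply: bigsetU_measurable.
have -> : P (arc k @^-1` B) =
    P (\big[setU/set0]_(u < n) (arc k @^-1` B `&` U k @^-1` [set (u : nat)])).
  apply: (probability_eq_on mV) => //.
    by apply: bigsetU_measurable => u _; exact: measurableI.
  by rewrite -big_distrr /= -/V -setIA setIid.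
transitivity (\sum_(u < n) P (arc k @^-1` B `&` U k @^-1` [set (u : nat)]))%E.
  apply: measure_bigsetU_ord => [u|]; first exact: measurableI.
  by move=> i j _ _ [w [[_ /= wi] [_ /= wj]]]; apply: val_inj; rewrite /= -wi -wj.
pose F (u : nat) : \bar R := P (arc k @^-1` B `&` U k @^-1` [set u]).
(* The starts are renumbered from [a.+1], so that the start of index [x] is the one of [hit_arc]. *)
rewrite -/(\sum_(u < n) F u)%E (@sum_rotate _ N a.+1 F).
have FE x : (x < n)%N -> F ((a.+1 + x) %% n)%N =
    (n%:R^-1 * (1 - (next_gap n Q x).+1%:R^-1))%:E.
  move=> xn; rewrite addSnnS; set u := (_ %% n)%N.
  have un : (u < n)%N by rewrite ltn_mod.
  have -> : F u = P (Rad k @^-1` [set r | (r <= next_gap n Q x)%N] `&`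
                     U k @^-1` [set u] `&` E k @^-1` setT).
    congr (P _); rewrite preimage_setT setIT; apply/seteqP; split => w [] /=.
      by move=> h1 h2; split => //; move: h1; rewrite /B /= /arc h2 hit_arc // -leqNgt.
    by move=> h1 h2; split => //; rewrite /B /= /arc h2 hit_arc // -leqNgt.
  rewrite (slot_prob model) // preimage_setT probability_setT mule1 UE // muleC EFinM.
  congr (_ * _)%E; rewrite EFinB -(model_Rad model k (ltn0Sn _)).
  rewrite -probability_setC //; last exact: (mR [set r | (next_gap n Q x < r)%N]).
  by congr (P _); apply/seteqP; split => w /=; rewrite [(Rad k w <= _)%N]leqNgt => /negP.
rewrite (eq_bigr (fun x : 'I_n => (n%:R^-1 * (1 - (next_gap n Q x).+1%:R^-1))%:E)); last first.
  by move=> x _; exact: FE.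
rewrite sumEFin -mulr_sumr sumrB sumr_const card_ord mulrBr -[_ *+ n]mulr_natl mulr1.
by rewrite mulVf // pnatr_eq0.
Qed.

(** Thinning with the miss probability of one arc: the factor [n] of the time cancels the [1 / n] of
    the uniform start, leaving in the exponent a sum over the sites. *)
Lemma discrete_renewal_law (alpha : R) : 0 <= alpha -> forall (a : nat) (Q : pred nat),
  wsum (uncovered_weight (alpha * n%:R)) (fun S => (site S a 0 && contains Q S a 0)%:R)
  = \prod_(0 <= x < n) hazard_ratio (fun k => alpha / k.+1%:R) (next_gap n Q x).
Proof.
move=> a0 a Q; set t := alpha * n%:R.
have t0 : 0 <= t by rewrite mulr_ge0.
rewrite /wsum /uncovered_weight (@sum_fiber_prob _ _ _ P _ (fun w => unc t w)); last first.
  by move=> S; exact: (measurable_uncovered (@measurable_cst _ _ _ _ setT t)).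
pose B := [set p | ~~ (in_arc n p.1 p.2 (a %% n)
      || has (fun z => Q z && in_arc n p.1 p.2 ((a + z) %% n)) (iota 1 N))].
pose s : R := \sum_(x < n) (next_gap n Q x).+1%:R^-1.
have sn : n%:R^-1 * s <= 1.
  rewrite mulrC ler_pdivrMr // mul1r /s -[n in n%:R]card_ord -sumr_const.
  by apply: ler_sum => x _; rewrite invf_le1 // ler1n.
have siteE w x : site (unc t w) a x =
    ~~ in_C n (Rad ^~ w) (U ^~ w) (poisN (E ^~ w) t) ((a + x) %% n)%N.
  by rewrite /site inE inordK // ltn_mod.
have -> : [set w | site (unc t w) a 0 && contains Q (unc t w) a 0] =
    [set w | forall k, (k < poisN (E ^~ w) t)%N -> B (arc k w)].
  apply/seteqP; split => w /=.
    move=> /andP[s0 /allP sQ] k km; rewrite /B /= negb_or; apply/andP; split.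
      move: s0; rewrite siteE addn0; apply: contra => h.
      by apply/hasP; exists k => //; rewrite mem_iota.
    apply/hasPn => z zN; rewrite negb_and -implybE; apply/implyP => Qz.
    have := sQ z; rewrite subSS subn0 Qz siteE => /(_ zN); apply: contra => h.
    by apply/hasP; exists k => //; rewrite mem_iota.
  move=> H; apply/andP; split.
    rewrite siteE addn0; apply/hasPn => k; rewrite mem_iota add0n => km.
    by have := H k km; rewrite /B /= negb_or => /andP[].
  apply/allP => z; rewrite subSS subn0 => zN; apply/implyP => Qz.
  rewrite siteE; apply/hasPn => k; rewrite mem_iota add0n => km.
  have := H k km; rewrite /B /= negb_or => /andP[_ /hasPn/(_ z zN)].
  by rewrite Qz.
rewrite (@poisson_event _ _ _ P _ _ _ _ model B (1 - n%:R^-1 * s)) //=; last 2 first.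
- by rewrite subr_ge0.
- by move=> k; rewrite arc_miss_prob.
rewrite big_mkord /hazard_ratio -expR_sum; congr expR.
rewrite subKr sumrN -mulr_sumr mulNr -/s /t; congr (- _).
by rewrite [alpha * n%:R]mulrC mulrACA mulVf ?mul1r ?pnatr_eq0 // mulrC.
Qed.

End DiscreteLaw.

(** * Integrals over cells *)

Lemma is_derive_inv (R : realType) (x : R) : x != 0 ->
  is_derive x 1 (fun y : R => y^-1) (- x ^- 2).
Proof.
move=> x0; apply: DeriveDef; first by apply: (@derivableV _ _ id).
by rewrite (@deriveV _ _ id) // derive_id /GRing.scale /= mulr1.
Qed.

Lemma integral_invsq_tail (R : realType) (c : R) : 0 < c ->
  (\int[lebesgue_measure]_(y in `]0%R, +oo[) ((\1_([set y : R | (c < y)%R]) y)%:E * (y ^-2)%:E)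
   = (c^-1)%:E)%E.
Proof.
move=> c0; pose f (y : R) := y ^-2; pose F (y : R) := - y^-1.
have cf (x : R) : 0 < x -> {for x, continuous f}.
  move=> x0; apply: (@cvgV _ _ _ _ (fun y : R => y ^+ 2)).
    by rewrite expf_neq0 // gt_eqF.
  exact: exprn_continuous.
have dF (x : R) : 0 < x -> is_derive x 1 F (f x).
  move=> x0; have h := is_derive_inv (lt0r_neq0 x0).
  by rewrite /f -[f in is_derive _ _ _ f]opprK; apply: is_deriveN.
have -> : (\int[lebesgue_measure]_(y in `]0%R, +oo[)
     ((\1_([set y : R | (c < y)%R]) y)%:E * (y ^-2)%:E) =
     \int[lebesgue_measure]_(y in `]c, +oo[) (f y)%:E)%E.
  have -> : [set` `]c, +oo[] = [set` `]0, +oo[] `&` [set y : R | c < y].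
    apply/seteqP; split => y /=; rewrite !in_itv /= !andbT; last by case.
    by move=> cy; split => //; exact: lt_trans cy.
  rewrite [RHS]integral_mkcondr; apply: eq_integral => y _.
  rewrite patchE indicE; case: (y \in _); first by rewrite mul1e.
  by rewrite mul0e.
rewrite integral_itv_obnd_cbnd; last first.
  apply/measurable_EFinP; apply: open_continuous_measurable_fun => //.
  move=> x; rewrite inE /= in_itv /= andbT => cx; apply: cf; exact: lt_trans cx.
have f0 x : c <= x -> 0 <= f x.
  by move=> cx; rewrite /f invr_ge0 exprn_ge0 // (le_trans (ltW c0)).
have cfc : {within [set` `[c, +oo[], continuous f}.
  apply: continuous_in_subspaceT => x; rewrite inE /= in_itv /= andbT => cx.
  by apply: cf; exact: lt_le_trans cx.
have Fy : F x @[x --> +oo] --> (0 : R).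
  rewrite -oppr0; apply: cvgN.
  by apply: (gtr0_cvgV0 _).2; [exact: nbhs_pinfty_gt|exact: cvg_id].
have dFc x : c < x -> derivable F x 1.
  by move=> cx; have [] := dF x (lt_trans c0 cx).
have Fc : F x @[x --> c^'+] --> F c.
  apply: cvg_at_right_filter; have [/derivable1_diffP h _] := dF c c0.
  exact: differentiable_continuous.
have F' : {in `]c, +oo[, F^`()%classic =1 f}.
  move=> x; rewrite in_itv /= andbT => cx; have [_ h] := dF x (lt_trans c0 cx).
  by rewrite derive1E h.
by rewrite (ge0_continuous_FTC2y f0 cfc Fy dFc Fc F') /F sub0e -EFinN opprK.
Qed.

Lemma integral_cells (R : realType) (n : nat) (G : R -> R) (g : nat -> R -> R) (J : nat -> R) :
  (0 < n)%N -> (forall x, 0 <= x < 1 -> 0 <= G x) ->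
  (forall i x, (i < n)%N -> i%:R / n%:R <= x < i.+1%:R / n%:R -> G x = g i x) ->
  (forall i, (i < n)%N -> measurable_fun
     ([set` `[(i%:R / n%:R), (i.+1%:R / n%:R)[] : set R) (g i)) ->
  (forall i, (i < n)%N ->
     (\int[lebesgue_measure]_(x in `[(i%:R / n%:R)%R, (i.+1%:R / n%:R)%R[)
         (g i x)%:E = (J i)%:E)%E) ->
  (\int[lebesgue_measure]_(x in `[0%R, 1%R[) (G x)%:E = (\sum_(i < n) J i)%:E)%E.
Proof.
move=> n0 G0 Gg mg Ig; have n0' : 0 < n%:R :> R by rewrite ltr0n.
pose I k : set R := [set` `[0, (k%:R / n%:R)[].
suff H k : (k <= n)%N -> measurable_fun (I k) G /\
    (\int[lebesgue_measure]_(x in I k) (G x)%:E = (\sum_(i < k) J i)%:E)%E.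
  by have [_] := H n (leqnn _); rewrite /I divff // gt_eqF.
elim: k => [_|k IHk kn].
  have -> : I 0%N = set0.
    by apply/seteqP; split => x //=; rewrite /I /= in_itv /= mul0r => /andP[x0]; rewrite ltNge x0.
  by rewrite big_ord0 integral_set0; split => //; exact: measurable_fun_set0.
have [mG IG] := IHk (ltnW kn).
pose C : set R := [set` `[(k%:R / n%:R), (k.+1%:R / n%:R)[].
have IE : I k.+1 = I k `|` C.
  rewrite /I /C -itv_bndbnd_setU //= bnd_simp ?divr_ge0 //.
  by rewrite ler_pM2r ?invr_gt0 // ler_nat.
have GC x : x \in C -> G x = g k x.
  by rewrite inE /C /= in_itv /= => h; exact: Gg.
have mGC : measurable_fun C G.
  by apply: (eq_measurable_fun (g k)) => [x xC|]; [rewrite GC|exact: mg].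
have mU : measurable_fun (I k `|` C) G.
  apply/measurable_funU; [exact: measurable_itv|exact: measurable_itv|by split].
have G0U x : (I k `|` C) x -> (0 <= (G x)%:E)%E.
  rewrite -IE /I /= in_itv /= => /andP[x0 xk]; rewrite lee_fin G0 // x0 /=.
  by apply: lt_le_trans xk _; rewrite ler_pdivrMr // mul1r ler_nat.
have disj : [disjoint I k & C].
  apply/disj_setPS => x [] /=; rewrite /I /C /= !in_itv /= => /andP[_ h] /andP[h' _].
  by move: h; rewrite ltNge h'.
have IC : (\int[lebesgue_measure]_(x in C) (G x)%:E = (J k)%:E)%E.
  by rewrite -Ig //; apply: eq_integral => x xC; rewrite GC.
rewrite IE; split => //.
have -> : (\int[lebesgue_measure]_(x in I k `|` C) (G x)%:E =
  \int[lebesgue_measure]_(x in I k) (G x)%:E + \int[lebesgue_measure]_(x in C) (G x)%:E)%E.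
  apply: ge0_integral_setU => //; [exact: measurable_itv|exact: measurable_itv|].
  exact/measurable_EFinP.
by rewrite IG IC big_ord_recr.
Qed.

Lemma integral_inv_cell (R : realType) (a b e : R) : a < b -> b < e ->
  measurable_fun ([set` `[a, b[] : set R) (fun x : R => (e - x)^-1) /\
  (\int[lebesgue_measure]_(x in `[a, b[) ((e - x)^-1)%:E = (ln ((e - a) / (e - b)))%:E)%E.
Proof.
move=> ab be.
have cg (x : R) : x < e -> {for x, continuous (fun x : R => (e - x)^-1)}.
  move=> xe; apply: (@cvgV _ _ _ _ (fun y : R => e - y)).
    by rewrite gt_eqF // subr_gt0.
  by apply: cvgB; [exact: cvg_cst|exact: cvg_id].
have mg : measurable_fun ([set` `[a, b]] : set R) (fun x : R => (e - x)^-1).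
  apply: subspace_continuous_measurable_fun => //.
  apply: continuous_in_subspaceT => x; rewrite inE /= in_itv /= => /andP[_ xb].
  by apply: cg; exact: le_lt_trans be.
have mg' : measurable_fun ([set` `[a, b[] : set R) (fun x : R => (e - x)^-1).
  apply: measurable_funS mg => // x /=; rewrite !in_itv /= => /andP[-> /ltW ->] //.
split => //; rewrite integral_itv_bndo_bndc; last exact/measurable_EFinP.
pose F (x : R) := - ln (e - x).
have dF x : a <= x <= b -> is_derive x 1 F ((e - x)^-1).
  move=> /andP[_ xb]; have xe : 0 < e - x by rewrite subr_gt0 (le_lt_trans xb).
  rewrite -[_^-1]opprK; apply: is_deriveN.
  have h1 := is_derive1_ln xe.
  have h2 : is_derive x 1 (fun x : R => e - x) (-1).
    by rewrite -[-1]add0r; apply: is_deriveB.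
  have := @is_derive1_comp _ (@ln R) (fun x : R => e - x) x _ _ h1 h2.
  by rewrite mulrN1.
have cg' x : a <= x <= b -> {for x, continuous (fun x : R => (e - x)^-1)}.
  by move=> /andP[_ xb]; apply: cg; exact: le_lt_trans be.
rewrite (FTC2_is_derive ab dF cg') -EFinB /F opprK addrC ln_div ?posrE ?subr_gt0 //.
exact: lt_trans be.
Qed.

(** * Cells left free by the Poisson arcs *)

(** The closed cell lies inside the open arc lifted to the line. An arc longer than one turn is
    treated as an interval like the others, so a cell around its starting point need not count as
    covered; the difference disappears as the cells shrink. *)
Definition covers_cell (R : realType) (n : nat) (p : R * R) (c : nat) : Prop :=
  exists m : int, p.1 < c%:R / n%:R + m%:~R /\ c.+1%:R / n%:R + m%:~R < p.1 + p.2.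

Definition hits_cells (R : realType) (N a : nat) (Q : pred nat) : set (R * R) :=
  [set p | exists z, [/\ (z < N.+1)%N, (z == 0%N) || Q z
     & covers_cell N.+1 p ((a + z) %% N.+1)]].

(* The arc only has to reach the right end of the first cell of [Q] after the one
   containing [x], or of the base cell, met after at most one turn. *)
Lemma hits_cellsP (R : realType) (N a : nat) (Q : pred nat) (i x0 : nat) (x y : R) :
  let n := N.+1 in (x0 < n)%N -> ((a + x0) %% n)%N = i ->
  i%:R / n%:R <= x < i.+1%:R / n%:R ->
  hits_cells N a Q (x, y) <-> (i + (next_gap n Q x0).+2)%:R / n%:R - x < y.
Proof.
move=> n x0n ai /andP[ix xi].
have n0 : 0 < n%:R :> R by rewrite ltr0n.
have := hit_arc a Q _ x0n => /= hit.
have uE : ((a + x0.+1) %% n)%N = (i.+1 %% n)%N.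
  by rewrite -ai addnS -addn1 -modnDml addn1.
split.
  move=> [z [zn zQ [m [/= h1 h2]]]].
  set c := ((a + z) %% n)%N in h1 h2.
  have cn : (c < n)%N by rewrite ltn_mod.
  have LE : c%:R / n%:R + m%:~R = (c%:Z + m * n%:Z)%:~R / n%:R :> R.
    by rewrite rmorphD rmorphM /= mulrDl mulfK // gt_eqF.
  have iL : (i%:Z < c%:Z + m * n%:Z)%R.
    rewrite -(ltr_int R) -(@ltr_pM2r _ n%:R^-1) ?invr_gt0 //.
    by rewrite -LE; apply: le_lt_trans h1.
  have m0 : (0 <= m)%R.
    rewrite leNgt; apply/negP => m0; have : (m * n%:Z <= - n%:Z)%R by nia.
    lia.
  case: m m0 => // m _ in h1 h2 LE iL *.
  have /subnKC jE : (i.+1 <= c + m * n)%N by lia.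
  set j := (_ - _)%N in jE.
  have : (next_gap n Q x0 < j.+1)%N.
    rewrite -hit uE; apply/orP.
    have inarc : in_arc n (i.+1 %% n) j.+1 c.
      apply/hasP; exists j; first by rewrite mem_iota add0n /=.
      by rewrite modnDml jE addnC modnMDl modn_small.
    case/orP: zQ => [/eqP z0|Qz]; first by left; rewrite -[a]addn0 -[X in (a + X)%N]z0.
    have [z0|z0] := posnP z; first by left; rewrite -[a]addn0 -[X in (a + X)%N]z0.
    right; apply/hasP; exists z; last by rewrite Qz.
    by rewrite mem_iota; lia.
  rewrite ltnS => ngj; rewrite ltrBlDl; apply: le_lt_trans h2.
  have -> : c.+1%:R / n%:R + m%:R = (c + m * n).+1%:R / n%:R :> R.
    by rewrite -addSn natrD natrM mulrDl mulfK // gt_eqF.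
  rewrite ler_pM2r ?invr_gt0 // ler_nat -jE; lia.
rewrite ltrBlDl => xy.
have : (next_gap n Q x0 < (next_gap n Q x0).+1)%N by [].
rewrite -hit uE => H.
have [z [zn zQ /hasP[j]]] : exists z, [/\ (z < n)%N, (z == 0%N) || Q z &
    in_arc n (i.+1 %% n) (next_gap n Q x0).+1 ((a + z) %% n)].
  case/orP: H => [h|/hasP[z]]; first by exists 0%N; rewrite addn0.
  rewrite mem_iota => zN /andP[Qz h]; exists z; split => //; last by rewrite Qz orbT.
  by rewrite /n; lia.
rewrite mem_iota add0n => jng /eqP azE.
exists z; split => //; rewrite azE modnDml.
set L := (i.+1 + j)%N; exists ((L %/ n)%N : int) => /=.
have E k : ((L %% n)%N + k)%:R / n%:R + (L %/ n)%N%:R = (L + k)%:R / n%:R :> R.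
  have -> : (L + k = L %/ n * n + (L %% n + k))%N by rewrite addnA -divn_eq.
  by rewrite [in RHS]natrD natrM [RHS]mulrDl mulfK ?gt_eqF // addrC.
split.
  have := E 0%N; rewrite !addn0 => ->; apply: lt_le_trans xi _.
  by rewrite ler_pM2r ?invr_gt0 // ler_nat leq_addr.
have := E 1%N; rewrite !addn1 => ->; apply: le_lt_trans xy.
by rewrite ler_pM2r ?invr_gt0 // ler_nat /L; lia.
Qed.

Lemma measurable_covers_cell (R : realType) n c :
  measurable [set p : R * R | covers_cell n p c].
Proof.
have -> : [set p : R * R | covers_cell n p c] = \bigcup_(m : int)
   ([set p | p.1 < c%:R / n%:R + m%:~R] `&` [set p | c.+1%:R / n%:R + m%:~R < p.1 + p.2]).
  by apply/seteqP; split => p [m]; [move=> [h1 h2]; exists m|move=> _ [h1 h2]; exists m].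
apply: countable_bigcupT_measurable; first exact: countableP.
move=> m; apply: measurableI.
  have := @measurable_fst _ _ R R measurableT _ (measurable_itv `]-oo, (c%:R / n%:R + m%:~R)[).
  by rewrite setTI; congr measurable; apply/seteqP; split => p /=; rewrite in_itv.
have : measurable_fun setT (fun z : R * R => z.1 + z.2).
  by apply: measurable_funD; [exact: measurable_fst|exact: measurable_snd].
move=> /(_ measurableT _ (measurable_itv `](c.+1%:R / n%:R + m%:~R), +oo[)); rewrite setTI.
by congr measurable; apply/seteqP; split => p /=; rewrite in_itv /= andbT.
Qed.

Lemma measurable_hits_cells (R : realType) N a Q : measurable (@hits_cells R N a Q).
Proof.
have -> : @hits_cells R N a Q = \bigcup_(z in [set z | (z < N.+1)%N /\ (z == 0%N) || Q z])
    [set p | covers_cell N.+1 p ((a + z) %% N.+1)].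
  apply/seteqP; split => p; first by move=> [z [zN zQ h]]; exists z.
  by move=> [z [zN zQ] h]; exists z.
by apply: bigcup_measurable => z _; exact: measurable_covers_cell.
Qed.

(** For a start [x] in cell [i] the arc must pass the point [e i], which has intensity
    [1 / (e i - x)]. Integrating over the cell gives the logarithm of the ratio of the distances to
    [e i], namely [(D + 2) / (D + 1)] with [D] the next gap. *)
Lemma ms_intensity_hits_cells (R : realType) (alpha : R) N a Q :
  ms_intensity alpha (hits_cells N a Q) =
  (alpha * \sum_(x < N.+1) ln (1 + (next_gap N.+1 Q x).+1%:R^-1))%:E.
Proof.
set n := N.+1; have n0 : 0 < n%:R :> R by rewrite ltr0n.
(* The position of cell [i] counted from the origin [a]. *)
pose x0 i := ((i + (n - a %% n)) %% n)%N.
have x0n i : (x0 i < n)%N by rewrite ltn_mod.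
have x0K i : (i < n)%N -> ((a + x0 i) %% n)%N = i.
  move=> iN; rewrite /x0 modnDmr.
  have rn : (a %% n < n)%N by rewrite ltn_mod.
  have -> : (a + (i + (n - a %% n)) = (a %/ n).+1 * n + i)%N.
    by rewrite {1}(divn_eq a n) mulSn; lia.
  by rewrite modnMDl modn_small.
pose e i : R := (i + (next_gap n Q (x0 i)).+2)%:R / n%:R.
pose cell (x : R) := Num.truncn (n%:R * x).
have cellP x i : i%:R / n%:R <= x < i.+1%:R / n%:R -> cell x = i.
  move=> /andP[ix xi]; apply: truncn_def.
  by rewrite mulrC -ler_pdivrMr // ix /= -ltr_pdivlMr.
have cellP' (x : R) : 0 <= x < 1 ->
    (cell x < n)%N /\ (cell x)%:R / n%:R <= x < (cell x).+1%:R / n%:R.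
  move=> /andP[x00 x1]; have nx0 : 0 <= n%:R * x by rewrite mulr_ge0.
  have := truncn_itv nx0; rewrite -/(cell x) => /andP[h1 h2].
  split; last by rewrite ler_pdivrMr // ltr_pdivlMr // mulrC h1 h2.
  by rewrite -(ltr_nat R); apply: le_lt_trans h1 _; rewrite gtr_pMr.
have eg x i : x < i.+1%:R / n%:R -> 0 < e i - x.
  move=> xi; rewrite subr_gt0 (lt_le_trans xi) // /e ler_pM2r ?invr_gt0 // ler_nat.
  by lia.
pose G x : R := (e (cell x) - x)^-1.
pose J i : R := ln ((e i - i%:R / n%:R) / (e i - i.+1%:R / n%:R)).
rewrite /ms_intensity.
have -> : (\int[lebesgue_measure]_(x in `[0%R, 1%R[) \int[lebesgue_measure]_(y in `]0%R, +oo[)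
     ((\1_(hits_cells N a Q) (x, y))%:E * (y ^-2)%:E) =
   \int[lebesgue_measure]_(x in `[0%R, 1%R[) (G x)%:E)%E.
  apply: eq_integral => x; rewrite inE /= in_itv /= => x01.
  have [cx /[dup] cx' /andP[_ xc]] := cellP' x x01.
  rewrite /G -integral_invsq_tail; last exact: eg.
  apply: eq_integral => y _; congr (_ * _)%E; congr EFin.
  rewrite !indicE; congr (_%:R); congr nat_of_bool; apply: asbool_equiv_eq.
  by rewrite /= (hits_cellsP Q y (x0n _) (x0K _ cx) cx').
have lt_cell i : i%:R / n%:R < i.+1%:R / n%:R :> R by rewrite ltr_pM2r ?invr_gt0 // ltr_nat.
have lt_e i : i.+1%:R / n%:R < e i.
  by rewrite /e ltr_pM2r ?invr_gt0 // ltr_nat; lia.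
rewrite (@integral_cells R n G (fun i x => (e i - x)^-1) J) //; first last.
- by move=> i _; have [_] := integral_inv_cell (lt_cell i) (lt_e i).
- by move=> i _; have [] := integral_inv_cell (lt_cell i) (lt_e i).
- by move=> i x iN h; rewrite /G (cellP x i h).
- move=> x x01; rewrite /G invr_ge0; apply/ltW/eg.
  by have [_ /andP[]] := cellP' x x01.
rewrite -EFinM (@sum_rotate _ N a J); congr (_ * _)%:E.
apply: eq_bigr => x _; set i := ((a + x) %% n)%N.
have iN : (i < n)%N by rewrite ltn_mod.
have x0E : x0 i = x.
  have := x0K i iN => /eqP; rewrite {2}/i => h.
  have : (a + x0 i == a + x %[mod n])%N by rewrite h.
  by rewrite eqn_modDl !modn_small // => /eqP.
rewrite /J /e x0E; congr ln; set D := (next_gap n Q x).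
have -> : (i + D.+2)%:R / n%:R - i%:R / n%:R = D.+2%:R / n%:R :> R.
  by rewrite natrD mulrDl addrC addKr.
have -> : (i + D.+2)%:R / n%:R - i.+1%:R / n%:R = D.+1%:R / n%:R :> R.
  by rewrite (_ : (i + D.+2)%N = (i.+1 + D.+1)%N); [rewrite natrD mulrDl addrC addKr|lia].
rewrite invf_div mulrA divfK ?gt_eqF // -[D.+2%:R]natr1 mulrDl divff ?pnatr_eq0 //.
by rewrite mul1r.
Qed.

Section PoissonArcs.
Context d (T : measurableType d) (R : realType) (P : probability T R).
Variables (alpha : R) (pts : nat -> T -> R * R).
Hypothesis alpha_gt0 : 0 < alpha.
Hypothesis ppp : is_MS_PPP P alpha pts.

Let mpts i : measurable_fun setT (pts i).
Proof. by case: ppp => H _ _; exact: H. Qed.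

Lemma measurable_pts i (A : set (R * R)) : measurable A -> measurable (pts i @^-1` A).
Proof. by move=> mA; rewrite -[X in measurable X]setTI; exact: mpts. Qed.

Lemma void_prob (A : set (R * R)) (l : R) : measurable A ->
  ms_intensity alpha A = l%:E ->
  P [set w | forall i, ~ A (pts i w)] = (expR (- l))%:E.
Proof.
move=> mA lE; case: ppp => _ _ H.
have := H 1%N (fun=> A) (fun=> 0%N) (fun=> mA) _ _.
rewrite lE ltry big_ord_recl big_ord0 mule1 /= /poisson_mass expr0 fact0 mulr1 divr1.
move=> /(_ (fun=> isT)) <- => [|i j]; last by rewrite !ltnS !leqn0 => /eqP -> /eqP ->.
congr (P _); apply/seteqP; split => w /=.
  move=> void j _ /=; rewrite /point_count eseries0 // => i _ _.
  by rewrite indicE memNset //; exact: void.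
move=> /(_ 0%N isT) /= cnt i Ai.
have : (1%:E <= point_count (pts ^~ w) A)%E.
  rewrite /point_count; apply: le_trans (nneseries_lim_ge i.+1 _) => [|k _ _];
    last by rewrite lee_fin.
  rewrite big_nat_recr //= indicE mem_set // leeDr //.
  by apply: sume_ge0 => k _; rewrite lee_fin.
by rewrite cnt lee_fin ler10.
Qed.

Definition free_cells (N : nat) (w : T) : {set 'I_N.+1} :=
  [set c : 'I_N.+1 | `[< forall i, ~ covers_cell N.+1 (pts i w) c >]]%SET.

Lemma measurable_free_cells N S : measurable [set w | free_cells N w = S].
Proof.
have mC (c : nat) : measurable [set w | forall i, ~ covers_cell N.+1 (pts i w) c].
  have -> : [set w | forall i, ~ covers_cell N.+1 (pts i w) c] =
     \bigcap_i ~` (pts i @^-1` [set p | covers_cell N.+1 p c]).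
    by apply/seteqP; split => [w H i _|w H i]; exact: H.
  apply: bigcapT_measurable => i; apply: measurableC; apply: measurable_pts.
  exact: measurable_covers_cell.
have -> : [set w | free_cells N w = S] = \bigcap_(c : 'I_N.+1)
    [set w | `[< forall i, ~ covers_cell N.+1 (pts i w) c >] = (c \in S)].
  apply/seteqP; split => [w /= <- c _ /=|w H]; first by rewrite inE.
  by apply/setP => c; rewrite inE; exact: H.
apply: fin_bigcap_measurable; first exact: finite_finset.
move=> c _; case: (c \in S).
  rewrite (_ : [set w | _] = [set w | forall i, ~ covers_cell N.+1 (pts i w) c]) //.
  by apply/seteqP; split => w /= /asboolP.
rewrite (_ : [set w | _] = ~` [set w | forall i, ~ covers_cell N.+1 (pts i w) c]).
  exact: measurableC.
by apply/seteqP; split => w /=; [move/negbT/asboolPn|move=> /asboolPn/negbTE].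
Qed.

Definition free_weight N (S : {set 'I_N.+1}) : R := fine (P [set w | free_cells N w = S]).

Lemma free_renewal_law N (a : nat) (Q : pred nat) :
  wsum (@free_weight N) (fun S => (site S a 0 && contains Q S a 0)%:R)
  = \prod_(0 <= x < N.+1)
      hazard_ratio (fun k => alpha * ln (1 + k.+1%:R^-1)) (next_gap N.+1 Q x).
Proof.
rewrite /wsum /free_weight (@sum_fiber_prob _ _ _ P _ (free_cells N)); last first.
  exact: measurable_free_cells.
have siteE w x : site (free_cells N w) a x <->
    (forall i, ~ covers_cell N.+1 (pts i w) ((a + x) %% N.+1)).
  by rewrite /site inE inordK ?ltn_mod //; split => /asboolP.
have -> : [set w | site (free_cells N w) a 0 && contains Q (free_cells N w) a 0] =
    [set w | forall i, ~ hits_cells N a Q (pts i w)].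
  apply/seteqP; split => w /=.
    move=> /andP[/siteE s0 /allP sQ] i [z [zN zQ h]].
    have [z0|z0] := posnP z; first by apply: (s0 i); rewrite -[X in (a + X)%N]z0.
    have Qz : Q z by case/orP: zQ z0 => // /eqP ->.
    have := sQ z; rewrite subSS subn0 mem_iota Qz => /(_ ltac:(lia)) /siteE/(_ i).
    by apply.
  move=> H; apply/andP; split.
    by apply/siteE => i h; apply: (H i); exists 0%N.
  apply/allP => z; rewrite subSS subn0 mem_iota => zN; apply/implyP => Qz.
  apply/siteE => i h; apply: (H i); exists z; split => //; first by lia.
  by rewrite Qz orbT.
rewrite (void_prob (measurable_hits_cells _ _ _) (ms_intensity_hits_cells _ _ _ _)) /=.
by rewrite big_mkord /hazard_ratio -expR_sum sumrN mulr_sumr.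
Qed.

End PoissonArcs.

(** * Covering the circle *)

Definition cells_covered (R : realType) (n : nat) (p : nat -> R * R) : Prop :=
  forall c, (c < n)%N -> exists i, covers_cell n (p i) c.

Lemma cells_covered_ms_covers (R : realType) (n : nat) (p : nat -> R * R) :
  (0 < n)%N -> cells_covered n p -> ms_covers p.
Proof.
move=> n_gt0 cov z /andP[z0 z1].
have n0 : 0 < n%:R :> R by rewrite ltr0n.
have nz0 : 0 <= n%:R * z by rewrite mulr_ge0.
set c := Num.truncn (n%:R * z).
have := truncn_itv nz0; rewrite -/c => /andP[h1 h2].
have cn : (c < n)%N by rewrite -(ltr_nat R); apply: le_lt_trans h1 _; rewrite gtr_pMr.
have [i [m [/= l r]]] := cov c cn; exists i; rewrite /in_Pi; case: ifP => // _.
exists m; rewrite (lt_le_trans l) /=.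
  by rewrite (le_lt_trans _ r) // lerD2r ler_pdivlMr // mulrC ltW.
by rewrite lerD2r ler_pdivrMr // mulrC.
Qed.

(** Removes the special case of long arcs from [in_Pi], and adds the endpoint [1], the same point of
    the circle as [0], so that compactness of the segment can be used. *)
Lemma ms_covers_strict (R : realType) (p : nat -> R * R) (z : R) :
  ms_covers p -> 0 <= z <= 1 -> exists i (m : int), (p i).1 < z + m%:~R < (p i).1 + (p i).2.
Proof.
move=> cov.
have base (y : R) : 0 <= y < 1 -> exists i (m : int), (p i).1 < y + m%:~R < (p i).1 + (p i).2.
  move=> /cov[i]; rewrite /in_Pi; case: ifPn => [len _|_ [m h]]; last by exists i, m.
  (* The first integer above [(p i).1 - y] moves [y] past the start of the arc by at most one, which
     is less than its length. *)
  exists i, (Num.floor ((p i).1 - y) + 1).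
  have /andP[h1 h2] := floor_itv ((p i).1 - y).
  rewrite rmorphD /= in h2 *; apply/andP; split; lra.
move=> /andP[z0]; rewrite le_eqVlt => /predU1P[->|z1]; last by apply: base; rewrite z0.
have [|i [m h]] := base 0; first by rewrite lexx ltr01.
by exists i, (m - 1); rewrite rmorphB /= addrCA subrr addr0 -[m%:~R]add0r.
Qed.

(** A Lebesgue number argument: an arc containing [z] also contains all short segments that start
    near [z], and compactness makes the admissible length uniform. *)
Lemma ms_covers_cells_covered (R : realType) (p : nat -> R * R) :
  ms_covers p -> \forall N \near \oo, cells_covered N.+1 p.
Proof.
move=> cov.
pose Pk (k : nat) (z : R) := exists i (m : int),
  (p i).1 < z + m%:~R /\ z + k.+1%:R^-1 + m%:~R < (p i).1 + (p i).2.
have H : \forall k \near \oo, `[0, 1]%classic `<=` Pk k.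
  apply: (compact_near_coveringP `[(0:R), 1]).1; first exact: segment_compact.
  move=> z0 /=; rewrite in_itv /= => /(ms_covers_strict cov)[i [m]].
  set z : R := z0; clearbody z => /andP[h1 h2].
  have k0 : \forall k \near \oo, k.+1%:R^-1 < ((p i).1 + (p i).2 - m%:~R - z) / 2 :> R.
    have e0 : 0 < ((p i).1 + (p i).2 - m%:~R - z) / 2 by lra.
    exact: (near_infty_natSinv_lt (PosNum e0)).
  have zl : \forall y \near z, (p i).1 - m%:~R < y by apply: lt_nbhsr; lra.
  have zr : \forall y \near z, y < ((p i).1 + (p i).2 - m%:~R + z) / 2 by apply: lt_nbhsl; lra.
  near=> y k => /=; exists i, m.
  have a1 : (p i).1 - m%:~R < y by near: y.
  have a2 : y < ((p i).1 + (p i).2 - m%:~R + z) / 2 by near: y.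
  have a3 : k.+1%:R^-1 < ((p i).1 + (p i).2 - m%:~R - z) / 2 :> R by near: k.
  split; first by rewrite -ltrBlDr.
  move: a2 a3; move: (k.+1%:R^-1 : R) ((p i).1) ((p i).2) (m%:~R : R) => e x l u a2 a3.
  lra.
apply: filterS H => N H c cN.
have N0 : 0 < N.+1%:R :> R by rewrite ltr0n.
have [|i [m [h1 h2]]] := H (c%:R / N.+1%:R).
  by rewrite /= in_itv /= divr_ge0 //= ler_pdivrMr // mul1r ler_nat ltnW.
exists i, m; split => //; rewrite -natr1 [(_ + 1) / _]mulrDl div1r.
exact: h2.
Unshelve. all: by end_near. Qed.

Section CircleCovering.
Context d (T : measurableType d) (R : realType) (P : probability T R).
Variables (alpha : R) (pts : nat -> T -> R * R).
Hypothesis alpha_gt0 : 0 < alpha.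
Hypothesis alpha_lt1 : alpha < 1.
Hypothesis ppp : is_MS_PPP P alpha pts.

Lemma free_cells_eq0 N w :
  free_cells pts N w = finset.set0 <-> cells_covered N.+1 (pts ^~ w).
Proof.
split => [S0 c cN|cov].
  have : Ordinal cN \notin free_cells pts N w by rewrite S0 finset.in_set0.
  by rewrite inE => /asboolPn/existsNP[i /contrapT]; exists i.
apply/setP => c; rewrite finset.in_set0 inE; apply/asboolPn => H.
by have [i /(H i)] := cov c (ltn_ord c).
Qed.

Let empty N : set T := [set w | free_cells pts N w = finset.set0].
(** The grids for successive [N] are not nested, so [empty N] is not monotone. Intersecting over all
    larger [N] gives an increasing sequence of events, whose union is the covering event. *)
Let persist M : set T := \bigcap_(N in [set N | (M <= N)%N]) empty N.

Let mempty N : measurable (empty N).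
Proof. exact: (measurable_free_cells ppp). Qed.

Let mpersist M : measurable (persist M).
Proof. by apply: bigcap_measurable; [exists M => /=|move=> N _; exact: mempty]. Qed.

Let coversE : [set w | ms_covers (pts ^~ w)] = \bigcup_M persist M.
Proof.
apply/seteqP; split => [w /= cov|w [M _ H]].
  have [M _ H] := ms_covers_cells_covered cov.
  by exists M => // N /= MN; apply/free_cells_eq0; exact: H.
apply: (@cells_covered_ms_covers _ M.+1) => //; apply/free_cells_eq0.
by apply: (H M) => /=.
Qed.

Lemma measurable_ms_covers : measurable [set w | ms_covers (pts ^~ w)].
Proof. by rewrite coversE; exact: bigcupT_measurable. Qed.

Lemma free_cells_empty_cvg : fine (P (empty N)) @[N --> \oo] --> alpha.
Proof.
have k1 k : 0 < k.+1%:R :> R by rewrite ltr0n.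
have a0 := ltW alpha_gt0.
have mono j k : (j <= k)%N ->
    alpha * ln (1 + k.+1%:R^-1) <= alpha * ln (1 + j.+1%:R^-1).
  move=> jk; rewrite ler_wpM2l // ler_ln ?posrE ?addr_gt0 ?invr_gt0 //.
  by rewrite lerD2l lef_pV2 ?posrE // ler_nat.
have ge k : alpha / k.+2%:R <= alpha * ln (1 + k.+1%:R^-1).
  rewrite ler_wpM2l //.
  have -> : 1 + k.+1%:R^-1 = (1 - k.+2%:R^-1)^-1 :> R.
    rewrite -[k.+2%:R]natr1; have := k1 k; set x := k.+1%:R => x0.
    by field; rewrite !lt0r_neq0 //; lra.
  have lt1 : -1 < - k.+2%:R^-1 :> R by rewrite ltrN2 invf_lt1 // ltr1n.
  rewrite lnV ?posrE; last by rewrite subr_gt0 -ltrN2.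
  by rewrite lerNr; exact: le_ln1Dx.
have le k : alpha * ln (1 + k.+1%:R^-1) <= alpha / k.+1%:R.
  by rewrite ler_wpM2l // le_ln1Dx // (lt_trans (ltrN10 R)) // invr_gt0.
have H := nonempty_weight_cvg alpha_gt0 alpha_lt1 mono ge le (free_renewal_law alpha_gt0 ppp).
rewrite -[alpha](subKr 1); apply: cvg_trans (cvgB (cvg_cst _) H); apply: near_eq_cvg.
apply: nearW => N; apply/esym.
transitivity (1 - \sum_(S | S != finset.set0) @free_weight _ _ _ P pts N S);
  last by [].
have -> : \sum_(S | S != finset.set0) @free_weight _ _ _ P pts N S =
    fine (P [set w | free_cells pts N w != finset.set0]).
  rewrite -(@sum_fiber_prob _ _ _ P _ (free_cells pts N) (fun S => S != finset.set0)).
    rewrite big_mkcond; apply: eq_bigr => S _.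
    by case: (S != _); rewrite ?mulr1 ?mulr0.
  exact: measurable_free_cells ppp N.
have -> : [set w | free_cells pts N w != finset.set0] = ~` empty N.
  by apply/seteqP; split => w /eqP.
rewrite probability_setC //= fineB ?fin_num_measure //=.
by rewrite subKr.
Qed.

(** [persist M] is contained in [empty M], which is contained in the covering event; the first has
    probabilities tending to that of covering, the second to [alpha]. *)
Theorem ms_covers_prob : P [set w | ms_covers (pts ^~ w)] = alpha%:E.
Proof.
rewrite -[LHS]fineK ?fin_num_measure //; last exact: measurable_ms_covers.
have mc := measurable_ms_covers.
congr EFin; apply/eqP; rewrite eq_le; apply/andP; split.
  have H : fine (P (persist M)) @[M --> \oo] --> fine (P [set w | ms_covers (pts ^~ w)]).
    apply: fine_cvg; rewrite fineK ?fin_num_measure // coversE.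
    apply: nondecreasing_cvg_mu => //; first exact: bigcupT_measurable.
    move=> m n mn; apply/subsetPset => w H N /= nN; apply: H => /=.
    exact: leq_trans nN.
  apply: (ler_cvg_to H free_cells_empty_cvg); apply: nearW => M.
  apply: fine_le; rewrite ?fin_num_measure //.
  by apply: le_measure; rewrite ?inE // => w; apply => /=.
apply: (ler_cvg_to free_cells_empty_cvg (@cvg_cst _ _ _ _ _)); apply: nearW => M.
apply: fine_le; rewrite ?fin_num_measure //.
apply: le_measure; rewrite ?inE // => w /= /free_cells_eq0.
exact: cells_covered_ms_covers.
Qed.

End CircleCovering.

(** * The cover time *)

Lemma X_full_poisN_gt0 (R : realType) N (Rad U : nat -> nat) (e : nat -> R) (t : R) :
  X_full N.+1 Rad U e t -> (0 < poisN e t)%N.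
Proof. by rewrite /X_full /C_full lt0n /=; apply: contraTneq => ->. Qed.

(** The covered set does not change between the latest arrival up to [t] and [t] itself. Hence the
    infimum over real times reduces to countably many arrivals, which makes the cover time
    measurable. *)
Lemma X_full_at_arrival (R : realType) N (Rad U : nat -> nat) (e : nat -> R) (t : R) :
  X_full N.+1 Rad U e t ->
  exists k, arrival e k <= t /\ X_full N.+1 Rad U e (arrival e k).
Proof.
move=> full; have m0 := X_full_poisN_gt0 full.
have [X [Xm XE]] := (@poisN_fsetP _ _ _ _ m0).1 erefl.
have [k0 k0X] : exists k, k \in X by apply/fset0Pn; rewrite -cardfs_gt0 Xm.
pose k := [arg max_(i > [` k0X]%fset) arrival e (fsval i)]%O.
have kmax (j : X) : arrival e (fsval j) <= arrival e (fsval k).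
  by rewrite /k; case: Order.TotalTheory.arg_maxP => //= i _; exact.
exists (fsval k); split; first by rewrite XE fsvalP.
rewrite /X_full (_ : poisN e (arrival e (fsval k)) = poisN e t) //.
apply/(poisN_fsetP _ _ m0); exists X; split => // j.
apply/idP/idP => [h|jX].
  by rewrite -XE (le_trans h) // XE fsvalP.
exact: (kmax [` jX]%fset).
Qed.

Lemma cover_time_ltP (R : realType) N (Rad U : nat -> nat) (e : nat -> R) (s : \bar R) :
  (cover_time N.+1 Rad U e < s)%E <->
  exists k, ((arrival e k)%:E < s)%E /\ X_full N.+1 Rad U e (arrival e k).
Proof.
rewrite /cover_time; split => [/ereal_inf_ltP[y [t /= full <-] ts]|[k [ks full]]].
  have [k [kt fullk]] := X_full_at_arrival full.
  by exists k; split => //; apply: le_lt_trans ts; rewrite lee_fin.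
by apply/ereal_inf_ltP; exists (arrival e k)%:E => //; exists (arrival e k).
Qed.

Lemma cover_time_le (R : realType) n (Rad U : nat -> nat) (e : nat -> R) (t : R) :
  X_full n Rad U e t -> (cover_time n Rad U e <= t%:E)%E.
Proof. by move=> full; apply: ereal_inf_lbound; exists t. Qed.

Lemma cover_time_ge0 (R : realType) N (Rad U : nat -> nat) (e : nat -> R) :
  (forall k, 0 <= e k) -> (0 <= cover_time N.+1 Rad U e)%E.
Proof.
move=> e0; apply: le_ereal_inf_tmp => _ [t /= full <-]; rewrite lee_fin.
have [k [kt _]] := X_full_at_arrival full; apply: le_trans kt.
by apply: sumr_ge0.
Qed.

Lemma C_full_mono n (Rad U : nat -> nat) m m' :
  (m <= m')%N -> C_full n Rad U m -> C_full n Rad U m'.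
Proof.
move=> mm' /allP full; apply/allP => x /full /hasP[k]; rewrite mem_iota => km h.
by apply/hasP; exists k => //; rewrite mem_iota add0n; apply: leq_trans mm'.
Qed.

Section CoverTime.
Context d (T : measurableType d) (R : realType) (P : probability T R).
Variables (N : nat) (Rad U : nat -> T -> nat) (E : nat -> T -> R).
Hypothesis model : covering_model P N.+1 Rad U E.

Local Notation full t w := (X_full N.+1 (Rad ^~ w) (U ^~ w) (E ^~ w) t).
Local Notation ctime w := (cover_time N.+1 (Rad ^~ w) (U ^~ w) (E ^~ w)).

Lemma measurable_X_full (tau : T -> R) :
  measurable_fun setT tau -> measurable [set w | full (tau w) w].
Proof.
move=> mtau; have := measurable_uncovered model mtau finset.set0.
by congr measurable; apply/seteqP; split => w /=; rewrite X_full_uncovered; move/eqP.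
Qed.

Lemma measurable_cover_time : measurable_fun setT (fun w => ctime w).
Proof.
apply: (measurability _ (ErealGenInftyO.measurableE R)) => //.
move=> _ [_ [x -> <-]]; rewrite setTI.
have -> : (fun w => ctime w) @^-1` `]-oo, x%:E[%classic =
    \bigcup_k ([set w | arrival (E ^~ w) k < x]
      `&` [set w | full (arrival (E ^~ w) k) w]).
  apply/seteqP; split => w /=; rewrite in_itv /=.
    by move=> /cover_time_ltP[k [ks fk]]; exists k.
  by move=> [k _ [/= ks fk]]; apply/cover_time_ltP; exists k.
apply: bigcupT_measurable => k; apply: measurableI; last first.
  by apply: measurable_X_full; exact: (measurable_arrival model).
have := measurable_arrival model k measurableT (measurable_itv `]-oo, x[).
by rewrite setTI; congr measurable; apply/seteqP; split => w /=; rewrite in_itv.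
Qed.

Lemma X_full_mono w s t : regular_clock E t w -> s <= t -> full s w -> full t w.
Proof.
move=> reg st fs; have m0 := X_full_poisN_gt0 fs.
apply: C_full_mono fs.
have /(regular_poisNP _ reg)[h1 h2] : poisN (E ^~ w) t = poisN (E ^~ w) t by [].
have [X [Xm XE]] := (@poisN_fsetP _ _ _ _ m0).1 erefl.
rewrite -[X in (X <= _)%N]Xm -[X in (_ <= X)%N](size_iota 0).
apply: uniq_leq_size => // k; rewrite -XE mem_iota add0n /= => ks.
rewrite ltnNge; apply/negP => km; move: h1; rewrite ltNge => /negP; apply.
by rewrite (le_trans _ st) // (le_trans _ ks) //; apply: arrival_le => //; case: reg.
Qed.

Definition fin_cover_time w : R := fine (ctime w).

Lemma measurable_fin_cover_time_le t : measurable [set w | fin_cover_time w <= t].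
Proof.
have mf : measurable_fun setT fin_cover_time.
  by apply: measurableT_comp measurable_cover_time; exact: fine_measurable.
have := mf measurableT _ (measurable_itv `]-oo, t]).
by rewrite setTI; congr measurable; apply/seteqP; split => w /=; rewrite in_itv.
Qed.

Let full_prob t : R := fine (P [set w | full t w]).

Let mfull t : measurable [set w | full t w].
Proof. by apply: (@measurable_X_full (fun=> t)); exact: measurable_cst. Qed.

Lemma cover_time_prob_ge t : full_prob t <= fine (P [set w | fin_cover_time w <= t]).
Proof.
(* On [G] the cover time lies between [0] and [t], so it is finite and [fine] keeps its value. *)
pose G : set T := [set w | forall k, 0 <= E k w].
have mG : measurable G := measurable_gap_ge0 model.
have PG : P G = 1%E := gap_ge0_full model.
apply: fine_le; rewrite ?fin_num_measure //; first exact: measurable_fin_cover_time_le.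
have -> : P [set w | full t w] = P ([set w | full t w] `&` G).
  by apply: (probability_eq_on mG) => //; [exact: measurableI|rewrite -setIA setIid].
apply: le_measure.
- by apply/mem_set; exact: measurableI.
- by apply/mem_set; exact: measurable_fin_cover_time_le.
move=> w [/= fw Gw]; rewrite /fin_cover_time.
have := cover_time_le fw; have := cover_time_ge0 N (Rad ^~ w) (U ^~ w) Gw.
by case: (ctime w) => //= r _; rewrite lee_fin.
Qed.

(* [fine] sends an infinite cover time to 0; the complement of the event at time
   [y] accounts for it. *)
Lemma cover_time_prob_le t t' y : t < t' -> 0 <= t' ->
  fine (P [set w | fin_cover_time w <= t]) <= full_prob t' + (1 - full_prob y).
Proof.
move=> tt' t'0; have mC := measurable_fin_cover_time_le t.
have mG := measurable_regular_clock model t'.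
have PG := regular_clock_full model t'0.
rewrite -lee_fin EFinD EFinB /full_prob !fineK ?fin_num_measure //.
have -> : (1 - P [set w | full y w] = P (~` [set w | full y w]))%E.
  by rewrite probability_setC.
have -> : P [set w | fin_cover_time w <= t] =
    P ([set w | fin_cover_time w <= t] `&` regular_clock E t').
  by apply: (probability_eq_on mG) => //; [exact: measurableI|rewrite -setIA setIid].
apply: le_trans (measureU2 _ _ _); [|exact: mfull|exact/measurableC/mfull].
apply: le_measure.
- by apply/mem_set; exact: measurableI.
- by apply/mem_set; apply: measurableU => //; exact: measurableC.
move=> w [/= cw reg]; have [fy|] := boolP (full y w); last by move/negP; right.
left; have /cover_time_ltP[k [kt fk]] : (ctime w < t'%:E)%E.
  have := cover_time_le fy; move: cw; rewrite /fin_cover_time.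
  case: (ctime w) => [r|//|] /= rt _; last exact: ltNyr.
  by rewrite lte_fin; apply: le_lt_trans rt tt'.
by apply: X_full_mono fk => //; apply/ltW; rewrite -lte_fin.
Qed.

End CoverTime.

(** * Limits *)

Section Limits.
Context d (T : measurableType d) (R : realType) (P : probability T R).
Variables (Rad U : nat -> nat -> T -> nat) (E : nat -> nat -> T -> R).
Hypothesis model : forall n, (0 < n)%N -> covering_model P n (Rad n) (U n) (E n).

Local Notation full N t w :=
  (X_full N.+1 (Rad N.+1 ^~ w) (U N.+1 ^~ w) (E N.+1 ^~ w) t).
Local Notation left N t w :=
  (uncovered N (Rad N.+1 ^~ w) (U N.+1 ^~ w) (E N.+1 ^~ w) t).

Let weight (alpha : R) N :=
  @uncovered_weight _ _ _ P N (Rad N.+1) (U N.+1) (E N.+1) (alpha * N.+1%:R).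

Let weight_ge0 alpha N (S : {set 'I_N.+1}) : 0 <= weight alpha S.
Proof. exact: uncovered_weight_ge0. Qed.

Let mono (alpha : R) (a0 : 0 < alpha) j k : (j <= k)%N -> alpha / k.+1%:R <= alpha / j.+1%:R.
Proof. by move=> jk; rewrite ler_pM2l // lef_pV2 ?posrE ?ltr0n // ler_nat. Qed.

Let law (alpha : R) (a0 : 0 < alpha) N (a : nat) (Q : pred nat) :=
  discrete_renewal_law (model (ltn0Sn N)) (ltW a0) a Q.

Lemma X_full_prob_cvg (alpha : R) : 0 < alpha -> alpha < 1 ->
  fine (P [set w | full N (alpha * N.+1%:R) w]) @[N --> \oo] --> alpha.
Proof.
move=> a0 a1.
have H := nonempty_weight_cvg a0 a1 (mono a0) (fun k => mono a0 (leqnSn k))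
  (fun k => lexx _) (law a0).
rewrite -[X in _ --> X](subKr 1); apply: cvg_trans (cvgB (cvg_cst _) H).
apply: near_eq_cvg; apply: nearW => N.
transitivity (1 - \sum_(S | S != finset.set0) @weight alpha N S); first by [].
rewrite (sum_uncovered_weight (model (ltn0Sn N))).
set A := [set w | full N _ w].
have mA : measurable A.
  by apply: (@measurable_X_full _ _ _ _ _ _ _ _ (model (ltn0Sn N)) (fun=> alpha * N.+1%:R)).
have -> : [set w | left N (alpha * N.+1%:R) w != finset.set0] = ~` A.
  by apply/seteqP; split => w; rewrite /A /= X_full_uncovered => /negP.
by rewrite probability_setC //= fineB ?fin_num_measure //= subKr.
Qed.

Definition clamp01 (x : R) : R := Num.max 0 (Num.min x 1).

(** The covering probability has a known limit only at times [alpha * n] with [alpha] in [(0, 1)].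
    The value at [x] is therefore squeezed between nearby times, and the correction for infinite
    cover times is evaluated at a time [y'] close to [1]. *)
Lemma cover_time_law_cvg (x : R) :
  fine (P [set w | fine (cover_time n (Rad n ^~ w) (U n ^~ w) (E n ^~ w)) / n%:R <= x])
    @[n --> \oo] --> clamp01 x.
Proof.
rewrite -(cvg_shiftS _).
pose F N (y : R) : R := fine (P [set w |
  fin_cover_time N (Rad N.+1) (U N.+1) (E N.+1) w <= y * N.+1%:R]).
have mF N y : measurable [set w | fin_cover_time N (Rad N.+1) (U N.+1) (E N.+1) w <= y].
  exact: (measurable_fin_cover_time_le (model (ltn0Sn N))).
suff : F N x @[N --> \oo] --> clamp01 x.
  apply: cvg_trans; apply: near_eq_cvg; apply: nearW => N; congr (fine (P _)).
  by apply/seteqP; split => w /=; rewrite ler_pdivrMr ?ltr0n.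
have n0 N : 0 < N.+1%:R :> R by rewrite ltr0n.
have F01 N : 0 <= F N x <= 1.
  by rewrite fine_ge0 //= -lee_fin fineK ?fin_num_measure // probability_le1.
have low (y : R) : 0 < y -> y < 1 -> y <= x -> forall e : R, 0 < e ->
    \forall N \near \oo, y - e < F N x.
  move=> y0 y1 yx e e0.
  have := cvgr_gt _ (X_full_prob_cvg y0 y1) (y - e).
  rewrite gtrBl => /(_ _ e0); apply: filterS => N h.
  apply: lt_le_trans h _; apply: le_trans (cover_time_prob_ge (model (ltn0Sn N)) _) _.
  apply: fine_le; rewrite ?fin_num_measure //.
  apply: le_measure; rewrite ?inE // => w /= /le_trans; apply.
  by rewrite ler_pM2r.
have up (y y' : R) : 0 < y -> y < 1 -> x < y -> 0 < y' -> y' < 1 -> forall e : R, 0 < e ->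
    \forall N \near \oo, F N x < y + (1 - y') + e.
  move=> y0 y1 xy y'0 y'1 e e0.
  have h1 := cvgr_lt _ (X_full_prob_cvg y0 y1) (y + e / 2).
  have h2 := cvgr_gt _ (X_full_prob_cvg y'0 y'1) (y' - e / 2).
  have {h1} : \forall N \near \oo, fine (P [set w | full N (y * N.+1%:R) w]) < y + e / 2.
    by apply: h1; rewrite ltrDl divr_gt0.
  have {h2} : \forall N \near \oo, y' - e / 2 < fine (P [set w | full N (y' * N.+1%:R) w]).
    by apply: h2; rewrite gtrBl divr_gt0.
  apply: filterS2 => N g2 g1.
  have := @cover_time_prob_le _ _ _ _ _ _ _ _ (model (ltn0Sn N)) (x * N.+1%:R)
     (y * N.+1%:R) (y' * N.+1%:R).
  rewrite ltr_pM2r // => /(_ xy (mulr_ge0 (ltW y0) (ler0n _ _))) => h.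
  by rewrite /F; apply: le_lt_trans h _; lra.
apply/cvgrPdist_lt => e e0.
have lowN : \forall N \near \oo, clamp01 x - e < F N x.
  have [x0|x0] := leP x 0.
    apply: nearW => N; have /andP[f0 _] := F01 N.
    by rewrite /clamp01 max_l ?ge_min ?x0 // sub0r (lt_le_trans _ f0) // oppr_lt0.
  (* [1 - D] stays positive and within [e / 2] of [1]; taking the minimum with [x] gives an
     admissible time that loses at most half of the error. *)
  pose D : R := Num.min (e / 2) 2^-1; pose y : R := Num.min x (1 - D).
  have c1 : clamp01 x <= 1 by rewrite ge_max ler01 ge_min lexx orbT.
  have c2 : clamp01 x <= x by rewrite ge_max (ltW x0) ge_min lexx.
  have [y0 y1 yx yc] : [/\ 0 < y, y < 1, y <= x & clamp01 x - e <= y - e / 2].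
    have [D0 De Dh] : [/\ 0 < D, D <= e / 2 & D <= 2^-1].
      by rewrite /D; case: (leP (e / 2) 2^-1) => ?; split; lra.
    by rewrite /y; case: (leP x (1 - D)) => ?; split; lra.
  have e20 : 0 < e / 2 by rewrite divr_gt0.
  by have := low y y0 y1 yx _ e20; apply: filterS => N; exact: le_lt_trans.
have upN : \forall N \near \oo, F N x < clamp01 x + e.
  have [x1|x1] := leP 1 x.
    apply: nearW => N; have /andP[_ f1] := F01 N.
    by rewrite /clamp01 min_r // max_r // (le_lt_trans f1) // ltrDl.
  (* The bound at the times [m + D] and [1 - D] is [m + 2 * D + e / 4], at most [m + 3 * e / 4]. *)
  pose m : R := Num.max 0 x; pose D := Num.min (e / 4) ((1 - m) / 2).
  have [m1 xm cm] : [/\ m < 1, x <= m & clamp01 x = m].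
    by rewrite /clamp01 /m min_l ?(ltW x1) // le_max lexx orbT gt_max ltr01 x1.
  have m0 : 0 <= m by rewrite le_max lexx.
  clearbody m.
  have [D0 D1 D2] : [/\ 0 < D, D < 1 - m & D <= e / 4].
    by rewrite /D; case: (leP (e / 4) ((1 - m) / 2)) => ?; split; lra.
  have [] := up (m + D) (1 - D) _ _ _ _ _ (e / 4); try lra.
  move=> K _ H; exists K => // N KN; have := H N KN; rewrite /=; lra.
by near=> N; rewrite ltr_distlC; apply/andP; split; near: N.
Unshelve. all: by end_near. Qed.


Variable alpha : R.
Hypothesis alpha_gt0 : 0 < alpha.
Hypothesis alpha_lt1 : alpha < 1.

Let log_law (n : nat) (x : R) : R := fine (P [set w |
  ln (C_uncovered n (Rad n ^~ w) (U n ^~ w) (poisN (E n ^~ w) (alpha * n%:R)))%:R / ln n%:R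
   * (~~ X_full n (Rad n ^~ w) (U n ^~ w) (E n ^~ w) (alpha * n%:R))%:R <= x]).

Let log_size N (S : {set 'I_N.+1}) : R :=
  ln #|S|%:R / ln N.+1%:R * (S != finset.set0)%:R.

Let log_size_ge0 N (S : {set 'I_N.+1}) : 0 <= log_size S.
Proof.
rewrite /log_size; have [->|S0] := eqVneq; first by rewrite mulr0.
by rewrite mulr1 divr_ge0 // ln_ge0 // ler1n // card_gt0.
Qed.

Let log_lawE N x : log_law N.+1 x = \sum_(S | log_size S <= x) @weight alpha N S.
Proof.
rewrite (sum_uncovered_weight (model (ltn0Sn N))); congr (fine (P _)).
by apply/seteqP; split => w; rewrite /= /log_size C_uncovered_card X_full_uncovered.
Qed.

Let weight_sum1 N : \sum_S @weight alpha N S = 1.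
Proof.
rewrite (sum_uncovered_weight (model (ltn0Sn N)) _ predT) /=.
by rewrite (_ : [set _ | _] = setT) ?probability_setT //; apply/seteqP; split.
Qed.

(** [0 < N] keeps [ln N.+1] positive, so that the quotient of logarithms can be cleared. *)
Let log_size_le N (S : {set 'I_N.+1}) x : (0 < N)%N -> S != finset.set0 ->
  (log_size S <= x) = (#|S|%:R <= N.+1%:R `^ x).
Proof.
move=> N0 S0; have S1 : 0 < #|S|%:R :> R by rewrite ltr0n card_gt0.
have lnN : 0 < ln N.+1%:R :> R by rewrite ln_gt0 // ltr1n.
by rewrite /log_size S0 mulr1 ler_pdivrMr // -ln_powR ler_ln ?posrE ?powR_gt0 // ltr0n.
Qed.

Lemma log_law_neg (x : R) : x < 0 -> log_law n x @[n --> \oo] --> (0 : R).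
Proof.
move=> x0; rewrite -(cvg_shiftS _); apply: cvg_near_cst; apply: nearW => N.
by rewrite /= log_lawE big1 // => S /(le_trans (log_size_ge0 S)); rewrite leNgt x0.
Qed.

Let ge k : alpha / k.+2%:R <= alpha / k.+1%:R := mono alpha_gt0 (leqnSn k).
Let le k : alpha / k.+1%:R <= alpha / k.+1%:R := lexx _.

(** The event consists of the empty uncovered set, of probability tending to [alpha], and of the
    nonempty sets of size at most [n ^ x], of vanishing probability. *)
Lemma log_law_small (x : R) : 0 <= x -> x < 1 - alpha -> log_law n x @[n --> \oo] --> alpha.
Proof.
move=> x0 x1; rewrite -(cvg_shiftS _).
have H1 := nonempty_weight_cvg alpha_gt0 alpha_lt1 (mono alpha_gt0) ge le (law alpha_gt0).
have H2 := small_weight_cvg0 alpha_gt0 alpha_lt1 (mono alpha_gt0) ge le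
  (fun N S => @weight_ge0 alpha N S) (law alpha_gt0) x0 x1.
suff : [sequence log_law n.+1 x]_n @ \oo --> 1 - (1 - alpha) + 0 by rewrite addr0 subKr.
apply: cvg_trans (cvgD (cvgB (cvg_cst _) H1) H2); apply: near_eq_cvg; near=> N.
rewrite /= log_lawE.
transitivity (1 - \sum_(S | S != finset.set0) @weight alpha N S +
  \sum_(S : {set 'I_N.+1} | (0 < #|S|)%N && (#|S|%:R <= N.+1%:R `^ x :> R))
    @weight alpha N S); first by [].
rewrite -[X in X - _ + _ = _](weight_sum1 N).
rewrite (bigID (fun S : {set 'I_N.+1} => S == finset.set0)) /= addrK.
rewrite [RHS](bigID (fun S : {set 'I_N.+1} => S == finset.set0)) /=; congr (_ + _).
  apply: eq_bigl => S; rewrite andbC /=; have [->|//] := eqVneq.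
  by rewrite /log_size eqxx mulr0 x0.
apply: eq_bigl => S; rewrite card_gt0 andbC; case: (eqVneq S finset.set0) => S0.
  by rewrite !andbF.
rewrite !andbT log_size_le //; near: N; exact: nbhs_infty_gt.
Unshelve. all: by end_near. Qed.

Lemma log_law_large (x : R) : 1 - alpha < x -> log_law n x @[n --> \oo] --> (1 : R).
Proof.
move=> x1; have x0 : 0 <= x by rewrite (le_trans _ (ltW x1)) // subr_ge0 ltW.
rewrite -(cvg_shiftS _).
have H := large_weight_cvg0 alpha_gt0 alpha_lt1 ge
  (fun N S => @weight_ge0 alpha N S) (law alpha_gt0) x1.
suff : [sequence log_law n.+1 x]_n @ \oo --> (1 - 0 : R) by rewrite subr0.
apply: cvg_trans (cvgB (cvg_cst _) H); apply: near_eq_cvg; near=> N.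
rewrite /= log_lawE.
transitivity (1 - \sum_(S : {set 'I_N.+1} | N.+1%:R `^ x < #|S|%:R :> R) @weight alpha N S);
  first by [].
rewrite -[X in X - _ = _](weight_sum1 N).
rewrite (bigID (fun S : {set 'I_N.+1} => N.+1%:R `^ x < #|S|%:R :> R)) /=.
rewrite addrAC subrr add0r.
apply: eq_bigl => S; rewrite -leNgt; have [->|S0] := eqVneq S finset.set0.
  by rewrite /log_size eqxx mulr0 x0 cards0 powR_ge0.
rewrite log_size_le //; near: N; exact: nbhs_infty_gt.
Unshelve. all: by end_near. Qed.

End Limits.

(** * The uniform law *)

Section UniformLaw.
Variable R : realType.

(* [uniform_prob] lives on the measurable type [measurableTypeR R], whose
   canonical structure is not the one attached to [R] itself. *)
Definition of_measurableTypeR (x : measurableTypeR R) : R := x.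

Let measurable_of_measurableTypeR : measurable_fun setT of_measurableTypeR.
Proof. exact: measurable_id. Qed.

HB.instance Definition _ :=
  isMeasurableFun.Build _ _ _ _ of_measurableTypeR measurable_of_measurableTypeR.

Definition uniform01 : probability R R :=
  distribution (uniform_prob (@ltr01 R)) of_measurableTypeR.

Lemma uniform01E (A : set R) : measurable A ->
  uniform01 A = lebesgue_measure (A `&` `[0, 1]%classic).
Proof.
move=> mA; transitivity (uniform_prob (@ltr01 R) A); first by [].
rewrite /uniform_prob integral_uniform_pdf (eq_integral (fun=> 1%E)).
  by rewrite integral_cst ?mul1e //; exact: measurableI.
by move=> x; rewrite inE => -[_] /=; rewrite in_itv /uniform_pdf /= => ->; rewrite subr0 invr1.
Qed.

Lemma uniform01_le (x : R) : uniform01 [set` `]-oo, x]] = (clamp01 x)%:E.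
Proof.
rewrite uniform01E //.
have -> : `]-oo, x]%classic `&` `[0, 1]%classic = [set` `[0, Num.min x 1]] :> set R.
  apply/seteqP; split => y /=; rewrite !in_itv /= le_min.
    by move=> [-> /andP[-> ->]].
  by move=> /and3P[-> -> ->].
rewrite /= lebesgue_measure_itv /= lte_fin /clamp01 oppr0 adde0.
by case: ltP => // _.
Qed.

Lemma law_cdf_uniform01 : law_cdf uniform01 = clamp01 (R := R).
Proof. by apply/funext => x; rewrite /law_cdf uniform01_le. Qed.

Lemma nontrivial_uniform01 : nontrivial_law uniform01.
Proof.
move=> c; suff -> : uniform01 [set c] = 0%E by rewrite eq_sym onee_neq0.
rewrite uniform01E //; apply/eqP; rewrite -measure_le0 -(lebesgue_measure_set1 c).
by apply: le_measure (@subIsetl _ _ _); apply/mem_set => //; exact: measurableI.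
Qed.

Lemma law_support_uniform01 : law_support uniform01 = [set` `[0, 1]].
Proof.
apply/seteqP; split => y.
  move=> supp; rewrite /= in_itv /=; apply/negPn/negP => y01.
  pose e : R := Num.max (- y) (y - 1).
  have e0 : 0 < e.
    by rewrite lt_max oppr_gt0 subr_gt0; move: y01; rewrite negb_and -!ltNge.
  have := supp e e0; rewrite uniform01E // (_ : _ `&` _ = set0) ?measure0 ?ltxx //.
  apply/seteqP; split => // z; rewrite /= !in_itv /= => -[/andP[z1 z2] /andP[z3 z4]].
  move: y01 z1 z2 e0; rewrite negb_and -!ltNge /e.
  by case: (leP (- y) (y - 1)) => ? /orP[] *; lra.
rewrite /= in_itv /= => /andP[y0 y1] e e0; rewrite uniform01E //.
pose a := Num.max 0 (y - e); pose b := Num.min 1 (y + e).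
have ab : a < b.
  by rewrite lt_min !gt_max ltr01 /=; apply/and3P; split; lra.
have sub : [set` `]a, b[] `<=` [set` `]y - e, y + e[] `&` [set` `[0, 1]].
  move=> z; rewrite /= !in_itv /= lt_min gt_max.
  by move=> /andP[/andP[h1 h2] /andP[h3 h4]]; rewrite h2 h4 !ltW.
have pos : (0 < @lebesgue_measure R [set` `]a, b[])%E.
  by rewrite lebesgue_measure_itv /= lte_fin ab lte_fin subr_gt0.
apply: lt_le_trans pos _; apply: le_measure; [apply/mem_set => //| |exact: sub].
by apply/mem_set; exact: measurableI.
Qed.

End UniformLaw.

Theorem mainTheorem3 (R : realType) (d : measure_display)
  (T : measurableType d) (P : probability T R)
  (Rad U : nat -> nat -> T -> nat) (E : nat -> nat -> T -> R) :
  (forall n : nat, (0 < n)%N -> covering_model P n (Rad n) (U n) (E n)) ->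
  exists Y : probability R R,
    [/\ cvg_in_law
          (fun n => distr_fn P (fun w =>
             fine (cover_time n (Rad n ^~ w) (U n ^~ w) (E n ^~ w)) / n%:R))
          (law_cdf Y),
        nontrivial_law Y,
        law_support Y = [set` `[0, 1]] &
        forall alpha : R, 0 < alpha < 1 ->
        forall (d' : measure_display) (T' : measurableType d')
               (P' : probability T' R) (pts : nat -> T' -> R * R),
          is_MS_PPP P' alpha pts ->
          P' [set w' | ms_covers (pts ^~ w')] = Y [set` `]-oo, alpha]] /\
          cvg_in_law
            (fun n => distr_fn P (fun w =>
               (ln (C_uncovered n (Rad n ^~ w) (U n ^~ w)
                      (poisN (E n ^~ w) (alpha * n%:R)))%:R / ln n%:R)
               * (~~ X_full n (Rad n ^~ w) (U n ^~ w) (E n ^~ w)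
                      (alpha * n%:R))%:R))
            (distr_fn P' (fun w' =>
               (1 - alpha) * \1_[set w'' | ~ ms_covers (pts ^~ w'')] w'))].
Proof.
move=> model; exists (uniform01 R); split.
- by move=> x _; rewrite law_cdf_uniform01; exact: (cover_time_law_cvg model).
- exact: nontrivial_uniform01.
- exact: law_support_uniform01.
move=> alpha /andP[a0 a1] d' T' P' pts ppp.
have cov := ms_covers_prob a0 a1 ppp.
split.
  rewrite cov uniform01_le /clamp01 min_l ?ltW // max_r //; exact: ltW.
set G := distr_fn P' _.
(* The limit has two atoms: [0] with mass [alpha] and [1 - alpha] with mass [1 - alpha]. *)
have GE x : G x = if x < 0 then 0 else if x < 1 - alpha then alpha else 1.
  rewrite /G /distr_fn; have [x0|x0] := ltP x 0.
    rewrite (_ : [set _ | _] = set0) ?measure0 //.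
    apply/seteqP; split => // w /=; apply/negP; rewrite -ltNge (lt_le_trans x0) //.
    by rewrite mulr_ge0 // subr_ge0 ltW.
  have [x1|x1] := ltP x (1 - alpha).
    rewrite (_ : [set _ | _] = [set w' | ms_covers (pts ^~ w')]) ?cov //.
    apply/seteqP; split => w /=; rewrite indicE.
      move=> h; apply: contrapT => nc; move: h; rewrite mem_set //= mulr1.
      by rewrite leNgt x1.
    by move=> cw; rewrite memNset ?mulr0 //; apply.
  rewrite (_ : [set _ | _] = setT) ?probability_setT //.
  apply/seteqP; split => // w _ /=; apply: le_trans x1.
  by rewrite ler_piMr ?subr_ge0 ?(ltW a1) // indicE lern1 leq_b1.
move=> x Gx; rewrite GE.
have [x0|x0] := ltP x 0; first exact: (log_law_neg model).
have [x1|x1] := ltP x (1 - alpha); first exact: (log_law_small model a0 a1).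
move: x1; rewrite le_eqVlt => /predU1P[xE|x1]; last exact: (log_law_large model a0 a1).
(* [G] jumps at [1 - alpha]. *)
exfalso.
have b0 : 0 < 1 - alpha by rewrite subr_gt0.
have := cvgr_gt _ Gx alpha.
rewrite GE -xE (ltNge _ 0) (ltW b0) ltxx /= => /(_ _ a1).
(* Continuity would force [G > alpha] near [1 - alpha]. The test point is within [e] of it by the
   first bound in the minimum and positive by the second, and there [G] equals [alpha]. *)
move=> /nbhs_ballP[e /= e0 /(_ (1 - alpha - Num.min (e / 2) ((1 - alpha) / 2)))].
have [D0 De Db] : [/\ 0 < Num.min (e / 2) ((1 - alpha) / 2),
    Num.min (e / 2) ((1 - alpha) / 2) < e
  & Num.min (e / 2) ((1 - alpha) / 2) < 1 - alpha].
  by case: (leP (e / 2) ((1 - alpha) / 2)) => ?; split; lra.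
move: D0 De Db; set D := Num.min _ _ => D0 De Db.
have : ball (1 - alpha) e (1 - alpha - D).
  by rewrite /ball /= opprB addrC subrK gtr0_norm.
move=> + h => /h; rewrite GE.
have -> : (1 - alpha - D < 0) = false by apply/negbTE; rewrite -leNgt; lra.
have -> : (1 - alpha - D < 1 - alpha) by lra.
by rewrite ltxx.
Qed.
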